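(* Let $F$ be a totally real number field of degree $n$ with ring of integers $\mathcal{O}_F$ and different $\mathfrak{D}_F$. Let $\mathbf{f}$ and $\mathbf{g}$ be distinct primitive Hilbert cuspidal non-CM eigenforms over $F$ with trivial nebentypus, of levels $\mathfrak{c}_1,\mathfrak{c}_2$ and integral weights $k=(k_1,\dots,k_n)$, $l=(l_1,\dots,l_n)$ respectively. Assume that $k_1\equiv\dots\equiv k_n\equiv l_1\equiv\dots\equiv l_n\equiv 0\pmod 2$ and that each $k_j,l_j\ge 2$. For each integral ideal $\mathfrak{m}\subseteq\mathcal{O}_F$ let $C(\mathfrak{m},\mathbf{f})$ and $C(\mathfrak{m},\mathbf{g})$ denote the Fourier coefficients of $\mathbf{f}$ and $\mathbf{g}$ at $\mathfrak{m}$. Then for every prime ideal $\mathfrak{p}\subseteq\mathcal{O}_F$ such that $\mathfrak{p}\nmid\mathfrak{c}_1\mathfrak{c}_2\mathfrak{D}_F$, the set $$\{m\in\mathbb{N} : C(\mathfrak{p}^m,\mathbf{f})\,C(\mathfrak{p}^m,\mathbf{g})\neq 0\}$$ has positive density.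
   Context: Density means natural density of a subset $A\subseteq\mathbb{N}$: $\lim_{x\to\infty}\#\{m\le x: m\in A\}/x$. Integral ideals are non-zero. $F$ is a totally real field of degree $n$, $\mathfrak{D}=\mathfrak{D}_F$ its different, $\mathbb{A}_F$ its adele ring, $N$ the ideal norm, $\mathfrak{h}$ the upper half plane, and weights lie in $\mathbb{Z}_{>0}^n$. Multi-index notation: $x^{a}=\prod_j x_j^{a_j}$ over the infinite places. Hilbert cusp forms with trivial nebentypus. For an integral ideal $\mathfrak{b}$ and a finite place $\mathfrak{p}$, let $K_{\mathfrak{p}}(\mathfrak{b})$ be the group of $\begin{pmatrix} a&b\\c&d\end{pmatrix}\in \mathrm{GL}_2(F_{\mathfrak{p}})$ with $a,d\in\mathcal{O}_{\mathfrak{p}}$, $b\in\mathfrak{D}_{\mathfrak{p}}^{-1}$, $c\in\mathfrak{b}_{\mathfrak{p}}\mathfrak{D}_{\mathfrak{p}}$, $|ad-bc|_{\mathfrak{p}}=1$. Put $W(\mathfrak{b})=\mathrm{GL}_2^+(\mathbb{R})^n\prod_{\mathfrak{p}<\infty}K_{\mathfrak{p}}(\mathfrak{b})$. Let $t_1,\dots,t_h$ be ideles with all infinite components $1$ representing the narrow class group of $F$; put $x_\nu=\begin{pmatrix}1&\\&t_\nu\end{pmatrix}$, $x_\nu^{-\iota}=\begin{pmatrix}t_\nu^{-1}&\\&1\end{pmatrix}$, $\Gamma_\nu(\mathfrak{b})=\mathrm{GL}_2(F)\cap x_\nu W(\mathfrak{b})x_\nu^{-1}$. Then $\mathrm{GL}_2(\mathbb{A}_F)$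 is the disjoint union of the sets $\mathrm{GL}_2(F)x_\nu^{-\iota}W(\mathfrak{b})$. Write $(f\|_k\gamma)(z)=\det(\gamma)^{k/2}(cz+d)^{-k}f(\gamma z)$. A Hilbert cusp form of weight $k$, level $\mathfrak{b}$ and trivial nebentypus is a tuple $\mathbf{f}=(f_1,\dots,f_h)$ of functions holomorphic on $\mathfrak{h}^n$ and at the cusps with $f_\nu\|_k\gamma=f_\nu$ for all $\gamma\in\Gamma_\nu(\mathfrak{b})$, such that the constant term of $f_\nu\|_k\gamma$ vanishes for all $\gamma\in\mathrm{GL}_2^+(F)$, and such that the function $\mathbf{f}(\gamma x_\nu^{-\iota}w)=(f_\nu\|_kw_\infty)(i,\dots,i)$ ($\gamma\in\mathrm{GL}_2(F)$, $w\in W(\mathfrak{b})$) on $\mathrm{GL}_2(\mathbb{A}_F)$ is invariant under the center $\mathbb{A}_F^\times$. Fourier coefficients: $f_\nu(z)=\sum_\xi a_\nu(\xi)\exp(2\pi i\sum_j\xi_jz_j)$, with $\xi$ running over totally positive elements of $t_\nu\mathcal{O}_F$. Every integral ideal $\mathfrak{m}$ is $\mathfrak{m}=\xi t_\nu^{-1}\mathcal{O}_F$ with a unique $\nu$ and a totally positive $\xi\in F$, and $C(\mathfrak{m},\mathbf{f})=N(\mathfrak{m})^{k_0/2}a_\nu(\xi)\xi^{-k/2}$, where $k_0=\max\{k_1,\dots,k_n\}$ (with $l$, $l_0=\max\{l_1,\dots,l_n\}$ in place of $k$, $k_0$ for $\mathbf{g}$). Primitive eigenform of level $\mathfrak{b}$: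 a newform of level $\mathfrak{b}$ (in the orthogonal complement of forms coming from levels properly dividing $\mathfrak{b}$) that is a common eigenform of all Hecke operators, normalized by $C(\mathcal{O}_F,\mathbf{f})=1$. It is non-CM if there is no non-trivial quadratic Hecke character $\chi$ of $F$ with $C(\mathfrak{p},\mathbf{f})=\chi(\mathfrak{p})C(\mathfrak{p},\mathbf{f})$ for almost all primes $\mathfrak{p}$. *)

(* Defs.v *)
From HB Require Import structures.
From mathcomp Require Export all_boot all_order all_algebra all_field finmap.
From mathcomp Require Export complex.
From mathcomp Require Export all_classical all_reals all_analysis.

Set Implicit Arguments.
Unset Strict Implicit.
Unset Printing Implicit Defensive.

Import Order.TTheory GRing.Theory Num.Theory.
Export numFieldNormedType.Exports.

Local Open Scope classical_set_scope.
Local Open Scope ring_scope.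
Local Open Scope complex_scope.

(* For a field F with an enumeration sigma_1, ..., sigma_n of all its          *)
(* embeddings (n = [F : Q]), "totally real" means that they are real.          *)
Definition totally_real_field (R : realType) (F : fieldExtType rat) (n : nat)
    (sigma : 'I_n -> {rmorphism F -> R}) : Prop :=
  \dim (fullv : {vspace F}) = n /\
  forall i j, (forall x, sigma i x = sigma j x) -> i = j.

Section Ideals.
Context {R : realType} {F : fieldExtType rat} {n : nat}.
Variable sigma : 'I_n -> {rmorphism F -> R}.

Definition ringO : set F := [set x | integralOver (intr : int -> F) x].

Definition O_submodule (I : set F) : Prop :=
  [/\ I 0, (forall x y, I x -> I y -> I (x + y)) &
      forall a x, ringO a -> I x -> I (a * x)].

Definition fractional_ideal (I : set F) : Prop :=
  [/\ O_submodule I, (exists2 x, I x & x != 0) &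
      exists2 d : F, d != 0 & forall x, I x -> ringO (d * x)].

Definition integral_ideal (I : set F) : Prop :=
  [/\ O_submodule I, (exists2 x, I x & x != 0) & I `<=` ringO].

Definition prime_ideal (p : set F) : Prop :=
  [/\ integral_ideal p, ~ p 1 &
      forall x y, ringO x -> ringO y -> p (x * y) -> p x \/ p y].

Definition idealM (I J : set F) : set F :=
  [set x | exists s : seq (F * F),
    (forall u, u \in s -> I u.1 /\ J u.2) /\ x = \sum_(u <- s) u.1 * u.2].

Definition idealX (I : set F) (m : nat) : set F := iter m (idealM I) ringO.

Definition ideal_dvd (I J : set F) : Prop :=
  exists2 K, integral_ideal K & J = idealM I K.

(* #(O_F / I) *)
Definition idealN (I : set F) : nat :=
  let cosets := [set A : set F | exists2 x, ringO x & A = [set x + y | y in I]] in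
  (#|` fset_set cosets|)%fset.

Definition trace (x : F) : R := \sum_(j < n) sigma j x.

Definition codifferent : set F :=
  [set x | forall y, ringO y -> trace (x * y) \is a Num.int].

Definition different : set F :=
  [set x | forall y, codifferent y -> ringO (x * y)].

Definition totally_positive (x : F) : Prop := forall j, 0 < sigma j x.

(* The completion of F at the prime p with its normalized absolute value,      *)
(* given by its universal property; it is unique up to a unique isometry.      *)
Record completion (p : set F) := Completion {
  cfield :> fieldType;
  cemb : {rmorphism F -> cfield};
  cabs : cfield -> R;
  cabs_ge0 : forall x, 0 <= cabs x;
  cabs_eq0 : forall x, cabs x = 0 <-> x = 0;
  cabsM : forall x y, cabs (x * y) = cabs x * cabs y;
  cabsD : forall x y, cabs (x + y) <= Num.max (cabs x) (cabs y);
  cabs_emb : forall (m : nat) (x : F), idealX p m x -> ~ idealX p m.+1 x ->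
    cabs (cemb x) = (idealN p)%:R ^- m;
  cemb_dense : forall x (e : R), 0 < e -> exists y, cabs (x - cemb y) < e;
  cabs_complete : forall u : nat -> cfield,
    (forall e : R, 0 < e -> exists N, forall i j, (N <= i)%N -> (N <= j)%N ->
      cabs (u i - u j) < e) ->
    exists l, forall e : R, 0 < e -> exists N, forall i, (N <= i)%N ->
      cabs (u i - l) < e
}.

Definition fplace := {p : set F | prime_ideal p}.

End Ideals.

Arguments fplace : clear implicits.
Arguments completion R {F} p.
Arguments cemb {R F p} c.
Arguments cabs {R F p} c.

Definition almost_all {T : Type} (P : T -> Prop) : Prop :=
  finite_set [set v | ~ P v].

Definition mx2 {K : fieldType} (a b c d : K) : 'M[K]_2 :=
  \matrix_(i, j) (if i == 0 then (if j == 0 then a else b)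
                  else (if j == 0 then c else d)).

Definition cexp {R : realType} (z : R[i]) : R[i] :=
  (expR (complex.Re z))%:C * (cos (complex.Im z) +i* sin (complex.Im z)).

Definition has_sum {R : realType} {I : choiceType} (a : I -> R[i]) (s : R[i])
    : Prop :=
  forall e : R, 0 < e -> exists A : {fset I}, forall B : {fset I},
    (A `<=` B)%fset -> `|\sum_(x <- B) a x - s| < e%:C.

(* Integral over C^m = R^{2m}, as an iterated Lebesgue integral.  By Fubini    *)
(* it is the integral for Lebesgue measure of every integrable function.       *)
Fixpoint integral_rV {R : realType} (m : nat) : ('rV[R[i]]_m -> R) -> R :=
  match m with
  | 0 => fun phi => phi 0
  | m'.+1 => fun phi =>
      \int[@lebesgue_measure R]_x \int[@lebesgue_measure R]_y
        integral_rV (fun z : 'rV[R[i]]_m' =>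
          phi (row_mx (const_mx (x +i* y) : 'rV[R[i]]_1) z))
  end.

Definition integralC_rV {R : realType} (m : nat) (phi : 'rV[R[i]]_m -> R[i])
    : R[i] :=
  integral_rV (fun z => complex.Re (phi z))
  +i* integral_rV (fun z => complex.Im (phi z)).

Section Hilbert.
Context {R : realType} {F : fieldExtType rat} {n : nat}.
Variable sigma : 'I_n -> {rmorphism F -> R}.
Variable Fv : forall v : fplace F, completion R (sval v).

Local Notation C := R[i].
Local Notation "`| x |_ v" := (cabs (Fv v) x)
  (at level 0, v at level 2, format "`| x |_ v").
Local Notation iota v := (cemb (Fv v)).

(* Ideles and elements of GL_2(A_F) are families indexed by all the places     *)
(* that satisfy [is_idele], resp. [GL2A].                                      *)
Definition fin_idele := forall v, Fv v.
Definition idele : Type := ('I_n -> R) * fin_idele.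
Definition fin_mx := forall v, 'M[Fv v]_2.
Definition adele_mx : Type := ('I_n -> 'M[R]_2) * fin_mx.

Definition is_idele (s : idele) : Prop :=
  [/\ forall j, s.1 j != 0, forall v, s.2 v != 0 &
      almost_all (fun v => `|s.2 v|_v = 1)].

Definition idele_mul (s s' : idele) : idele :=
  (fun j => s.1 j * s'.1 j, fun v => s.2 v * s'.2 v).

Definition principal_idele (x : F) : idele :=
  (fun j => sigma j x, fun v => iota v x).

Definition GL2A (x : adele_mx) : Prop :=
  [/\ forall j, x.1 j \in unitmx, forall v, x.2 v \in unitmx &
      almost_all (fun v =>
        (forall i j, `|x.2 v i j|_v <= 1) /\ `|\det (x.2 v)|_v = 1)].

Definition adele_mx_mul (x y : adele_mx) : adele_mx :=
  (fun j => x.1 j *m y.1 j, fun v => x.2 v *m y.2 v).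

Definition adele_mx_scale (s : idele) (x : adele_mx) : adele_mx :=
  (fun j => s.1 j *: x.1 j, fun v => s.2 v *: x.2 v).

Definition principal_mx (g : 'M[F]_2) : adele_mx :=
  (fun j => map_mx (sigma j) g, fun v => map_mx (iota v) g).

Definition fin_diag (a d : fin_idele) : adele_mx :=
  (fun _ => 1%:M, fun v => mx2 (a v) 0 0 (d v)).

(* I_v = I O_v, for a fractional ideal I *)
Definition loc (I : set F) (v : fplace F) : set (Fv v) :=
  [set x | exists2 y, I y & `|x|_v <= `|iota v y|_v].

Definition Kloc (b : set F) (v : fplace F) (g : 'M[Fv v]_2) : Prop :=
  [/\ `|g 0 0|_v <= 1, `|g 1 1|_v <= 1,
      loc (codifferent sigma) (g 0 1),
      loc (idealM b (different sigma)) (g 1 0) &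
      `|\det g|_v = 1].

Definition Wgroup (b : set F) (w : adele_mx) : Prop :=
  (forall j, 0 < \det (w.1 j)) /\ (forall v, Kloc b (w.2 v)).

(* A_F^* is the disjoint union of the F^* t_nu (R_{>0}^n x prod_v O_v^* ).     *)
Definition narrow_class_reps (h : nat) (t : 'I_h -> fin_idele) : Prop :=
  (forall nu, is_idele (fun _ => 1, t nu)) /\
  forall s, is_idele s -> exists! nu : 'I_h, exists x : F,
    [/\ x != 0, forall j, 0 < s.1 j * sigma j x &
        forall v, `|s.2 v|_v = `|iota v x * t nu v|_v].

Definition upper_half : set 'rV[C]_n := [set z | forall j, 0 < complex.Im (z 0 j)].

Definition holomorphic_at (f : 'rV[C]_n -> C) (z : 'rV[C]_n) : Prop :=
  differentiable (f : ('rV[C]_n : normedModType C) -> (C^o : normedModType C))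
    (z : ('rV[C]_n : normedModType C)).

Definition aut_factor (g : 'I_n -> 'M[R]_2) (z : 'rV[C]_n) (j : 'I_n) : C :=
  (g j 1 0)%:C * z 0 j + (g j 1 1)%:C.

Definition moebius (g : 'I_n -> 'M[R]_2) (z : 'rV[C]_n) : 'rV[C]_n :=
  \row_j (((g j 0 0)%:C * z 0 j + (g j 0 1)%:C) / aut_factor g z j).

Definition slash (k : 'I_n -> nat) (g : 'I_n -> 'M[R]_2) (f : 'rV[C]_n -> C)
    (z : 'rV[C]_n) : C :=
  (\prod_(j < n) ((\det (g j) `^ ((k j)%:R / 2))%:C * aut_factor g z j ^- k j))
  * f (moebius g z).

(* f(z) = sum_{xi in S} a(xi) exp(2 pi i sum_j xi_j z_j) on the upper half space *)
Definition fourier_expansion (S : set F) (f : 'rV[C]_n -> C) (a : F -> C)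
    : Prop :=
  (forall x, ~ S x -> a x = 0) /\
  forall z, upper_half z ->
    has_sum (fun x => a x * cexp ((2 * pi)%:C * 'i%C *
                                  \sum_(j < n) (sigma j x)%:C * z 0 j)) (f z).

Definition cusp_support (I : set F) : set F :=
  [set x | I x /\ (x = 0 \/ totally_positive sigma x)].

Definition holomorphic_at_infty (f : 'rV[C]_n -> C) : Prop :=
  exists I a, fractional_ideal I /\ fourier_expansion (cusp_support I) f a.

Definition vanishing_constant_term (f : 'rV[C]_n -> C) : Prop :=
  forall I a, fractional_ideal I -> fourier_expansion (cusp_support I) f a ->
    a 0 = 0.

Section Forms.
Context {h : nat}.
Variable t : 'I_h -> fin_idele.

Local Notation form := ('I_h -> 'rV[C]_n -> C).

Definition x_ (nu : 'I_h) : adele_mx := fin_diag (fun _ => 1) (t nu).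

(* x_nu^{-iota} *)
Definition xNi (nu : 'I_h) : adele_mx :=
  fin_diag (fun v => (t nu v)^-1) (fun _ => 1).

Definition Gamma (b : set F) (nu : 'I_h) : set 'M[F]_2 :=
  [set g | \det g != 0 /\ exists2 w, Wgroup b w &
     adele_mx_mul (principal_mx g) (x_ nu) = adele_mx_mul (x_ nu) w].

(* The function on GL_2(A_F) attached to the tuple f; its values outside       *)
(* GL_2(A_F) are irrelevant.                                                   *)
Definition adelic_lift (k : 'I_n -> nat) (b : set F) (f : form) (x : adele_mx)
    : C :=
  xget 0 [set c | exists (g : 'M[F]_2) (nu : 'I_h) (w : adele_mx),
    [/\ \det g != 0, Wgroup b w,
        x = adele_mx_mul (adele_mx_mul (principal_mx g) (xNi nu)) w &
        c = slash k w.1 (f nu) (const_mx 'i%C)]].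

Record cusp_form (k : 'I_n -> nat) (b : set F) (f : form) : Prop := CuspForm {
  cusp_form_holo : forall nu z, upper_half z -> holomorphic_at (f nu) z;
  cusp_form_slash : forall nu g, Gamma b nu g -> forall z, upper_half z ->
    slash k (principal_mx g).1 (f nu) z = f nu z;
  cusp_form_cusps : forall nu g, totally_positive sigma (\det g) ->
    holomorphic_at_infty (slash k (principal_mx g).1 (f nu));
  cusp_form_constant : forall nu g, totally_positive sigma (\det g) ->
    vanishing_constant_term (slash k (principal_mx g).1 (f nu));
  cusp_form_center : forall s x, is_idele s -> GL2A x ->
    adelic_lift k b f (adele_mx_scale s x) = adelic_lift k b f x
}.

(* the fractional ideal t_nu O_F *)
Definition tO (nu : 'I_h) : set F :=
  [set x | forall v, `|iota v x|_v <= `|t nu v|_v].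

Definition fourier_coef (f : form) (nu : 'I_h) : F -> C :=
  xget (fun _ => 0)
    [set a | fourier_expansion (tO nu `&` totally_positive sigma) (f nu) a].

(* C(m, f), for m = xi t_nu^{-1} O_F with xi totally positive *)
Definition coefC (k : 'I_n -> nat) (f : form) (m : set F) : C :=
  xget 0 [set c | exists nu xi,
    [/\ totally_positive sigma xi,
        m = [set x | forall v, `|iota v x|_v <= `|iota v xi / t nu v|_v] &
        c = ((idealN m)%:R `^ ((\max_(j < n) k j)%:R / 2))%:C
            * fourier_coef f nu xi
            * (\prod_(j < n) sigma j xi `^ (- ((k j)%:R / 2)))%:C]].

(* The local semigroup containing K_v(b): the entry a is a unit modulo b_v.    *)
Definition Yloc (b : set F) (v : fplace F) (y : 'M[Fv v]_2) : Prop :=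
  [/\ `|y 0 0|_v <= 1 /\ `|y 1 1|_v <= 1,
      loc (codifferent sigma) (y 0 1),
      loc (idealM b (different sigma)) (y 1 0),
      \det y != 0 &
      exists u r, [/\ `|u|_v <= 1, loc b r & y 0 0 * u + r = 1]].

(* The left cosets K(b) y, for y in prod_v Y_v(b) whose determinant generates  *)
(* m; there are finitely many.                                                 *)
Definition hecke_cosets (b m : set F) : set (set fin_mx) :=
  [set A | exists y : fin_mx,
    [/\ forall v, Yloc b (y v),
        forall v, [set x | `|x|_v <= `|\det (y v)|_v] = @loc m v &
        A = [set (fun v => g v *m y v) | g in
              [set g : fin_mx | forall v, Kloc b (g v)]]]].

(* The Hecke operator T(m) = sum of the double cosets W(b) y W(b) with         *)
(* det(y) O_F = m, acting by phi(x) |-> sum_{W y} phi(x y^iota), without       *)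
(* normalizing factor; y^iota = det(y) y^{-1} is the adjugate of y, and y has  *)
(* trivial infinite components.                                                *)
Definition heckeT (b m : set F) (phi : adele_mx -> C) (x : adele_mx) : C :=
  \sum_(A \in hecke_cosets b m)
    xget 0 [set c | exists2 y, A y &
                      c = phi (x.1, fun v => x.2 v *m \adj (y v))].

Definition hecke_eigenform (k : 'I_n -> nat) (b : set F) (f : form) : Prop :=
  forall m, integral_ideal m -> exists lambda : C, forall x, GL2A x ->
    heckeT b m (adelic_lift k b f) x = lambda * adelic_lift k b f x.

Definition fundamental_domain (G : set 'M[F]_2) (D : set 'rV[C]_n) : Prop :=
  [/\ <<s @open ('rV[C]_n : normedModType C) >> D, D `<=` upper_half &
      forall z, upper_half z -> exists! w, D w /\
        exists2 g, G g & w = moebius (principal_mx g).1 z].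

(* Petersson product, up to a common positive factor: the sum over nu of the   *)
(* integrals of conj(f_nu) g_nu y^k over Gamma_nu(b) \ h^n for the invariant   *)
(* measure prod_j y_j^{-2} dx_j dy_j.                                          *)
Definition petersson (k : 'I_n -> nat) (b : set F) (f g : form) : C :=
  \sum_(nu < h)
    let D := xget set0 (fundamental_domain (Gamma b nu)) in
    integralC_rV (fun z : 'rV[C]_n =>
      \1_D z * (f nu z)^*
      * g nu z * (\prod_(j < n) (complex.Im (z 0 j) ^+ k j / complex.Im (z 0 j) ^+ 2))%:C).

(* The forms coming from a level b' dividing b are the right translates        *)
(* g(x) = g'(x diag(s^{-1}, 1)), with g' of level b' and s an integral finite  *)
(* idele such that b is contained in s b'.                                     *)
Definition coming_from (k : 'I_n -> nat) (b' b : set F) (g : form) : Prop :=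
  exists (g' : form) (s : fin_idele),
    [/\ cusp_form k b' g', is_idele (fun _ => 1, s),
        forall v, `|s v|_v <= 1,
        forall v x, @loc b v x -> @loc b' v (x / s v) &
        forall x, GL2A x -> adelic_lift k b g x =
          adelic_lift k b' g'
            (adele_mx_mul x (fin_diag (fun v => (s v)^-1) (fun _ => 1)))].

Definition newform (k : 'I_n -> nat) (b : set F) (f : form) : Prop :=
  cusp_form k b f /\
  forall b' g, integral_ideal b' -> ideal_dvd b' b -> b' <> b ->
    cusp_form k b g -> coming_from k b' b g -> petersson k b f g = 0.

Definition primitive_eigenform (k : 'I_n -> nat) (b : set F) (f : form)
    : Prop :=
  [/\ newform k b f, hecke_eigenform k b f & coefC k f ringO = 1].

Definition hecke_character (chi : idele -> C) : Prop :=
  [/\ forall s s', is_idele s -> is_idele s' ->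
        chi (idele_mul s s') = chi s * chi s',
      forall s, is_idele s -> chi s != 0,
      forall x, x != 0 -> chi (principal_idele x) = 1 &
      (* continuity *)
      forall e : R, 0 < e -> exists (d : R) (S : set (fplace F)),
        [/\ 0 < d, finite_set S &
            forall s, is_idele s -> (forall j, `|s.1 j - 1| < d) ->
              (forall v, S v -> `|s.2 v - 1|_v < d) ->
              (forall v, `|s.2 v|_v = 1) -> `|chi s - 1| < e%:C]].

Definition nontrivial_quadratic (chi : idele -> C) : Prop :=
  (forall s, is_idele s -> chi s ^+ 2 = 1) /\
  exists2 s, is_idele s & chi s <> 1.

(* s is a uniformizer at v and 1 at the other places; chi(p_v) = chi(s) when   *)
(* chi is unramified at v, hence for almost all v.                             *)
Definition idele_uniformizer (v : fplace F) (s : idele) : Prop :=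
  [/\ forall j, s.1 j = 1, forall u, u <> v -> s.2 u = 1 &
      `|s.2 v|_v = (idealN (sval v))%:R^-1].

Definition non_CM (k : 'I_n -> nat) (f : form) : Prop :=
  ~ exists chi, [/\ hecke_character chi, nontrivial_quadratic chi &
      almost_all (fun v => forall s, idele_uniformizer v s ->
        coefC k f (sval v) = chi s * coefC k f (sval v))].

Definition distinct_forms (f g : form) : Prop :=
  exists nu z, upper_half z /\ f nu z <> g nu z.

End Forms.
End Hilbert.

Definition has_positive_density (R : realType) (A : set nat) : Prop :=
  exists2 d : R, 0 < d &
    (fun N : nat => (\sum_(0 <= m < N.+1) `[< A m >] : nat)%N%:R / N%:R : R)
      @ \oo --> d.

(* Main.v *)
(* Write c_m for C(p^m, f) N(p^m)^{-k_0/2}.  Only the operator T(p) is needed. *)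
(* Since p does not divide c_1 D, the cosets K y of determinant p are those of *)
(* (1 s; 0 pi), s running over O/p, and of (pi 0; 0 1).  Evaluating the        *)
(* eigenvalue equation of the adelic lift at x_nu^{-iota} gives                *)
(*   lambda f_nu(z) = g^{k/2} sum_beta f_mu(g z + beta) + g'^{k/2} f_mu'(g' z) *)
(* and, comparing Fourier coefficients,                                        *)
(*   lambda c_m = N(p) c_{m+1} + c_{m-1},  with c_{-1} = 0 and c_0 = 1.        *)
(* The zeros of such a second-order recurrence are the m with r | m + 1, for a *)
(* fixed r <> 1 (r = 0 if there are none).  Hence the set in question is       *)
(* periodic, and it contains 0.                                                *)
(* The Dedekind theory of O_F rests on a pigeonhole argument: modulo any       *)
(* positive integer there are finitely many classes of elements with bounded   *)
(* denominators, so an element whose powers have bounded denominators is       *)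
(* integral; this makes primes invertible.                                     *)

From HB Require Import structures.
Require Import Defs.
From mathcomp Require Import ring zify lra.

Set Implicit Arguments.
Unset Strict Implicit.
Unset Printing Implicit Defensive.

Import Order.TTheory GRing.Theory Num.Theory.

Local Open Scope classical_set_scope.
Local Open Scope ring_scope.

(** * Integers, traces and the codifferent *)

(** Fix one of the two forms and let c_m be its coefficient at p^m without the power of the norm.
    The eigenvalue equation of T(p) becomes a linear recurrence lambda c_m = M c_(m+1) + c_(m-1)
    with M nonzero, c_(-1) = 0 and c_0 nonzero. Read from c_(-1) on, such a sequence behaves like a
    Lucas sequence: after its first zero, at distance r > 0 from the start, it repeats itself up to
    a nonzero constant, so it vanishes exactly at the multiples of r ([recurrence_zeros]). Since c_0
    is nonzero, r is not 1. So the coefficients of the two forms vanish at p^m exactly when r1,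
    respectively r2, divides m + 1; the m for which neither happens form a periodic set that
    contains 0, and such a set has positive density ([joint_nondivisibility_density]).

    The recurrence rests on three facts. The cosets in T(p) are those of (1 s; 0 pi) and (pi 0; 0 1)
    ([hecke_cosets_split]). Evaluated at an upper triangular adele, each term of T(p) is a component
    of the form at an affine image of z, because the adelic lift does not depend on the
    decomposition used ([adelic_lift_unique], [adelic_lift_upper], [hecke_relation]). Finally
    Fourier coefficients can be compared ([hecke_coef_relation]): expansions are unique
    ([fourier_unique]), and their support lies in the expected ideal ([cusp_form_expansion]), so
    that each translation contributes a factor 1.

    The arithmetic of F starts from one finiteness statement, [congruence_label]. By pigeonhole it
    yields [almost_integral] and finite residue rings; these give the inverse of a prime
    ([prime_ideal_inverse]), hence valuations, the local-global principle and the approximation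
    result [prescribed_norm]. *)

Section Embeddings.
Context {R : realType} {F : fieldExtType rat} {n : nat}.
Variable sigma : 'I_n -> {rmorphism F -> R}.
Hypothesis hF : totally_real_field sigma.

Lemma embedding_scale j (a : rat) (x : F) : sigma j (a *: x) = ratr a * sigma j x.
Proof.
rewrite -mulr_algl rmorphM; congr (_ * _).
exact: (fmorph_eq_rat (sigma j \o in_alg F)).
Qed.

(** Artin's argument, by induction on the number of nonzero coefficients: replacing x by [a * x] and
    subtracting [sigma j1 a] times the relation removes the term of [j1] and keeps that of [j0]. *)
Lemma embeddings_independent (c : 'I_n -> R) :
  (forall x, \sum_j c j * sigma j x = 0) -> forall j, c j = 0.
Proof.
have [m] := ubnP #|[pred j | c j != 0]|; elim: m => // m IH in c * => /ltnSE cm c0 j0.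
apply: contra_notP (notF) => /eqP cj0.
have [j1 /andP[j10 cj1]|all0] := pickP [pred j | (j != j0) && (c j != 0)]; last first.
  case/eqP: cj0; have := c0 1; rewrite (bigD1 j0) //= rmorph1 mulr1 big1 ?addr0 // => j jj0.
  by have := all0 j; rewrite /= jj0 => /negbFE/eqP ->; rewrite mul0r.
have [a /eqP sa] : exists a, sigma j0 a <> sigma j1 a.
  by apply/existsNP => sj; move/eqP: j10; apply; apply/esym/hF.2.
pose c' j := c j * (sigma j a - sigma j1 a).
suff /(_ j0)/eqP : forall j, c' j = 0.
  by rewrite mulf_eq0 (negPf cj0) subr_eq0 (negPf sa).
apply: IH => [|x].
  apply: leq_trans cm; apply/proper_card/properP; split.
    by apply/fintype.subsetP => j; rewrite !inE mulf_eq0 negb_or => /andP[].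
  by exists j1; rewrite !inE ?cj1 // /c' subrr mulr0 eqxx.
have := c0 (a * x); have /(congr1 (fun y => sigma j1 a * y)) := c0 x.
rewrite mulr0 mulr_sumr => h1 h2; transitivity (0 - 0 : R); last by rewrite subrr.
rewrite -[X in X - _]h2 -[X in _ - X]h1 -sumrB.
by apply: eq_bigr => j _; rewrite rmorphM /c'; ring.
Qed.

Lemma rational_basis : exists (e : 'I_n -> F) (a : 'I_n -> {linear F -> rat^o}),
  (forall x, x = \sum_i a i x *: e i) /\ forall i j, a i (e j) = (i == j)%:R.
Proof.
case: hF => dF _; move: sigma hF; rewrite -{}dF => _ _.
exists (tnth (vbasis {:F})), (fun i => coord (vbasis {:F}) i); split=> [x|i j].
  rewrite {1}(coord_vbasis (memvf x)); apply: eq_bigr => i _.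
  by rewrite (tnth_nth 0).
by rewrite (tnth_nth 0) /= coord_free ?(basis_free (vbasisP _)) // eq_sym.
Qed.

(** The matrix of embeddings of a rational basis is invertible by [embeddings_independent]. It
    conjugates multiplication by x into the diagonal matrix of the [sigma j x], so their sum is the
    trace of a rational matrix. *)
Lemma trace_rational : exists tr : {linear F -> rat^o}, forall x, trace sigma x = ratr (tr x).
Proof.
have [e [a [ea _]]] := rational_basis.
pose M x := \matrix_(i, k) a k (e i * x) : 'M[rat]_n.
pose V := \matrix_(i, j) sigma j (e i) : 'M[R]_n.
have Vunit : V \in unitmx.
  rewrite -unitmx_tr -row_free_unit; apply: inj_row_free => v v0.
  apply/rowP => j; rewrite mxE; move: j.
  apply: embeddings_independent => x.
  transitivity (\sum_j \sum_i ratr (a i x) * (v 0 j * sigma j (e i))).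
    apply: eq_bigr => j _; rewrite {1}(ea x) rmorph_sum mulr_sumr.
    by apply: eq_bigr => i _; rewrite embedding_scale mulrCA.
  rewrite exchange_big big1 //= => i _; rewrite -mulr_sumr.
  have /rowP/(_ i) := v0; rewrite !mxE => vi.
  rewrite [X in _ * X](etrans _ vi) ?mulr0 //.
  by apply: eq_bigr => j _; rewrite !mxE.
have linM : linear (fun x => \tr (M x) : rat^o).
  move=> c x y; rewrite /mxtrace scaler_sumr -big_split /=; apply: eq_bigr => i _.
  by rewrite !mxE mulrDr -scalerAr linearP.
pose L := GRing.isLinear.Build rat F rat^o *:%R (fun x => \tr (M x) : rat^o) linM.
exists (HB.pack_for {linear F -> rat^o} (fun x => \tr (M x) : rat^o) L) => x /=.
have -> : trace sigma x = \tr (diag_mx (\row_j sigma j x)).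
  by rewrite mxtrace_diag; apply: eq_bigr => j _; rewrite mxE.
have VM : V *m diag_mx (\row_j sigma j x) = map_mx ratr (M x) *m V.
  apply/matrixP => i j; rewrite mul_mx_diag !mxE -rmorphM {1}(ea (e i * x)) rmorph_sum.
  by apply: eq_bigr => k _; rewrite embedding_scale !mxE.
rewrite -[diag_mx _](mulKmx Vunit) VM mulmxA mxtrace_mulC mulmxA mulmxV // mul1mx.
by rewrite trace_map_mx.
Qed.

End Embeddings.

Section Integers.
Context {F : fieldExtType rat}.
Local Notation O := (@ringO F).

Lemma numfield_intr_eq0 (m : int) : (m%:~R == 0 :> F) = (m == 0).
Proof. by rewrite -(rmorph_int (in_alg F)) fmorph_eq0 intr_eq0. Qed.

Lemma numfield_natr_eq0 (m : nat) : (m%:R == 0 :> F) = (m == 0)%N.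
Proof. by rewrite pmulrn numfield_intr_eq0. Qed.

Lemma ringO_int (m : int) : O m%:~R. Proof. exact: integral_id. Qed.
Lemma ringO_nat (m : nat) : O m%:R. Proof. exact: integral_nat. Qed.
Lemma ringO0 : O 0. Proof. exact: (ringO_nat 0). Qed.
Lemma ringO1 : O 1. Proof. exact: (ringO_nat 1). Qed.
Lemma ringOD x y : O x -> O y -> O (x + y). Proof. exact: integral_add. Qed.
Lemma ringOB x y : O x -> O y -> O (x - y). Proof. exact: integral_sub. Qed.
Lemma ringOM x y : O x -> O y -> O (x * y). Proof. exact: integral_mul. Qed.
Lemma ringON x : O x -> O (- x). Proof. exact: integral_opp. Qed.
Lemma ringOX x m : O x -> O (x ^+ m).
Proof. by move=> Ox; elim: m => [|m IH]; [exact: ringO1|rewrite exprS; exact: ringOM]. Qed.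
Lemma ringO_sum I (r : seq I) (P : pred I) (f : I -> F) :
  (forall i, P i -> O (f i)) -> O (\sum_(i <- r | P i) f i).
Proof. by move=> Of; elim/big_ind: _ => //; [exact: ringO0|exact: ringOD]. Qed.

Lemma ringO_root_monic x (p : {poly F}) :
  p \is monic -> root p x -> (forall i, O p`_i) -> O x.
Proof. by move=> mp px Op; apply: integral_root_monic mp px _; apply/integral_poly. Qed.

Lemma rat_integral_int (q : rat) : integralOver (intr : int -> rat) q -> q \is a Num.int.
Proof.
case=> p mp /(rmorph_root (ratr : rat -> algC)) rp.
suff : (ratr q : algC) \is a Num.int.
  by move=> /intrP[z qz]; apply/intrP; exists z; apply: (fmorph_inj (ratr : rat -> algC)); rewrite [RHS]rmorph_int; exact: qz.
apply: Cint_rat_Aint; first by apply/CratP; exists q.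
have Dp : map_poly ratr (map_poly (intr : int -> rat) p) = map_poly (intr : int -> algC) p.
  by rewrite -map_poly_comp; apply: eq_map_poly => z /=; rewrite rmorph_int.
apply: (@root_monic_Aint (map_poly (intr : int -> algC) p)).
- by rewrite -Dp.
- exact: monic_map.
- by apply/polyOverP => i; rewrite coef_map intr_int.
Qed.

Lemma ringO_denominator (x : F) : exists2 N : nat, (0 < N)%N & O (N%:R * x).
Proof.
have /polyOver1P[q Dq] := minPolyOver 1%AS x.
have [p [c c0 qp]] := rat_poly_scale q.
have px : root (map_poly (intr : int -> F) p) x.
  have := root_minPoly 1%AS x; rewrite Dq qp map_polyZ /= rootZ; last first.
    by rewrite scaler_eq0 oner_eq0 orbF invr_eq0 intr_eq0.
  rewrite -map_poly_comp; congr (root _ _); apply: eq_map_poly => z /=.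
  exact: (rmorph_int (in_alg F)).
have p0 : p != 0.
  apply: contraTneq (monic_minPoly 1%AS x) => p0.
  by rewrite Dq qp p0 !rmorph0 scaler0 rmorph0 monicE lead_coef0 eq_sym oner_eq0.
have lp0 : lead_coef p != 0 by rewrite lead_coef_eq0.
suff Oc : O ((lead_coef p)%:~R * x).
  exists `|lead_coef p|%N; first by rewrite absz_gt0.
  have [e ->] : exists e : int, `|lead_coef p|%N%:R = e%:~R * (lead_coef p)%:~R :> F.
    exists (sgz (lead_coef p)); rewrite -intrM -abszEsg.
    by rewrite pmulrn.
  by rewrite -mulrA; apply: ringOM Oc; exact: ringO_int.
move: lp0 px; rewrite /lead_coef; set d := (size p).-1; set l := p`_d => lp0 px.
have sp : size p = d.+1 by rewrite /d prednK // size_poly_gt0.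
have dE : (map_poly (intr : int -> F) p).[x] = \sum_(i < d.+1) (p`_i)%:~R * x ^+ i.
  have sFp : size (map_poly (intr : int -> F) p) = d.+1.
    by rewrite size_map_poly_id0 // numfield_intr_eq0.
  by rewrite horner_coef sFp; apply: eq_bigr => i _; rewrite coef_map.
case: d sp @l lp0 dE => [|d] sp l lp0 dE.
  move: px; rewrite rootE dE big_ord_recl big_ord0 expr0 mulr1 addr0 numfield_intr_eq0.
  by rewrite (negPf lp0).
(* This is l^d p(X / l): monic, with integer coefficients and root l x. *)
pose r := 'X^(d.+1) + \poly_(i < d.+1) (p`_i * l ^+ (d - i)).
exists r.
  rewrite monicE lead_coefDl ?lead_coefXn // size_polyXn.
  exact: leq_ltn_trans (size_poly _ _) _.
rewrite rootE /r rmorphD /= map_polyXn hornerD hornerXn poly_def rmorph_sum horner_sum /=.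
apply/eqP; transitivity (l%:~R ^+ d * (map_poly intr p).[x]); last by rewrite (rootP px) mulr0.
rewrite dE [in RHS]big_ord_recr /= mulrDr addrC; congr (_ + _); last by rewrite exprMn exprS; ring.
rewrite mulr_sumr; apply: eq_bigr => i _.
rewrite map_polyZ /= map_polyXn hornerZ hornerXn rmorphM rmorphXn /= exprMn.
have id : (i <= d)%N by rewrite -ltnS.
have -> : l%:~R ^+ d = l%:~R ^+ (d - i) * l%:~R ^+ i :> F by rewrite -exprD subnK.
by ring.
Qed.

End Integers.

Lemma det_int (m : nat) (A : 'M[rat]_m) :
  (forall i j, A i j \is a Num.int) -> \det A \is a Num.int.
Proof. by move=> iA; apply: rpred_sum => s _; rewrite rpredMsign; apply: rpred_prod. Qed.

(** * The trace form and finiteness modulo the integers *)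

Section Lattice.
Context {R : realType} {F : fieldExtType rat} {n : nat}.
Variable sigma : 'I_n -> {rmorphism F -> R}.
Hypothesis hF : totally_real_field sigma.
Local Notation O := (@ringO F).
Local Notation J := (codifferent sigma).

Lemma ratr_int (q : rat) : (ratr q : R) \is a Num.int -> q \is a Num.int.
Proof.
by case/intrP => z qz; apply/intrP; exists z; apply: (fmorph_inj (ratr : rat -> R)); rewrite [RHS]rmorph_int.
Qed.

Lemma integral_embedding j x : O x -> integralOver (intr : int -> R) (sigma j x).
Proof.
case=> p mp /(rmorph_root (sigma j)) px; exists p => //.
congr (root _ _): px; rewrite -map_poly_comp; apply: eq_map_poly => z /=; exact: rmorph_int.
Qed.

Lemma trace_ringO x : O x -> trace sigma x \is a Num.int.
Proof.
move=> Ox; have [tr trE] := trace_rational hF.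
suff : integralOver (intr : int -> R) (trace sigma x).
  case=> p mp; rewrite trE => px.
  suff /rat_integral_int/intrP[z ->] : integralOver (intr : int -> rat) (tr x).
    by rewrite [ratr _]rmorph_int intr_int.
  exists p => //; rewrite -(fmorph_root (ratr : rat -> R)) -map_poly_comp.
  by congr (root _ _): px; apply: eq_map_poly => z /=; rewrite rmorph_int.
rewrite /trace; elim/big_ind: _ => [|y z|j _].
- exact: (integral_nat _ 0).
- exact: integral_add.
- exact: integral_embedding.
Qed.

Lemma traceD x y : trace sigma (x + y) = trace sigma x + trace sigma y.
Proof. by rewrite /trace -big_split; apply: eq_bigr => j _; rewrite rmorphD. Qed.

Lemma codifferent_submodule : O_submodule J.
Proof.
split=> [y Oy|x y Jx Jy z Oz|a x Oa Jx y Oy].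
- by rewrite mul0r /trace big1 // => j _; rewrite rmorph0.
- by rewrite mulrDl traceD rpredD ?Jx ?Jy.
- by rewrite -mulrA mulrCA; apply: Jx; exact: ringOM.
Qed.

Lemma ringO_codifferent x : O x -> J x.
Proof. by move=> Ox y Oy; apply: trace_ringO; exact: ringOM. Qed.

(** A basis of integral elements gives the first property. For the second, pairing x with this basis
    under the trace form gives integers, and Cramer's rule recovers the coordinates up to the Gram
    determinant, whose absolute value is [N]. *)
Lemma lattice_coordinates : exists (N : nat) (a : 'I_n -> {linear F -> rat^o}),
  [/\ (0 < N)%N, forall x, (forall i, a i x \is a Num.int) -> O x &
      forall x i, J x -> N%:R * a i x \is a Num.int].
Proof.
have [e [a [ea aK]]] := rational_basis hF.
have /choice[m hm] : forall i, exists k, (0 < k)%N /\ O (k%:R * e i).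
  by move=> i; have [k k0 Ok] := ringO_denominator (e i); exists k.
have [tr trE] := trace_rational hF.
have trI x y : J x -> O y -> tr (x * y) \is a Num.int.
  by move=> Jx Oy; apply: ratr_int; rewrite -trE; exact: Jx.
have mq i : (m i)%:R != 0 :> rat by rewrite pnatr_eq0 -lt0n; case: (hm i).
have trZ (c : rat) y : tr (c *: y) = c * tr y by exact: linearZ_LR.
pose e' i := (m i)%:R * e i.
have Oe' i : O (e' i) by exact: (hm i).2.
have Je' i : J (e' i) by exact: ringO_codifferent.
pose a' i : {linear F -> rat^o} := [the {linear F -> rat^o} of ((m i)%:R^-1 : rat) \*: a i].
have a'Z i (c : rat) y : a' i (c *: y) = c * a' i y by exact: linearZ_LR.
have a'e i j : a' i (e' j) = (i == j)%:R.
  rewrite /a' /e' /= mulr_natl raddfMn /= aK /GRing.scale /=.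
  by case: eqVneq => [->|_]; rewrite ?mul0rn ?mulr0 // mulVf.
have ea' x : x = \sum_i a' i x *: e' i.
  rewrite {1}(ea x); apply: eq_bigr => i _.
  rewrite /a' /= /e' mulr_natl -scaler_nat scalerA; congr (_ *: _).
  by rewrite mulrC /GRing.scale /= mulrA mulfV ?mul1r.
pose G := \matrix_(i, k) tr (e' i * e' k) : 'M[rat]_n.
have GI i k : G i k \is a Num.int.
  by rewrite mxE; apply: trI.
have aG x : (\row_i a' i x) *m G = \row_k tr (x * e' k).
  apply/rowP => k; rewrite !mxE {2}(ea' x) mulr_suml raddf_sum.
  apply: eq_bigr => i _; rewrite !mxE -[in RHS]scalerAl; exact/esym/trZ.
have G0 : \det G != 0.
  rewrite -unitfE -unitmxE -row_free_unit; apply: inj_row_free => v v0.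
  pose x := \sum_i v 0 i *: e' i.
  have va i : a' i x = v 0 i.
    rewrite /x linear_sum (bigD1 i) //= big1 => [|j ji].
      by rewrite addr0 [LHS]a'Z a'e eqxx mulr1.
    by rewrite [LHS]a'Z a'e eq_sym (negPf ji) mulr0.
  have tx0 y : tr (x * y) = 0.
    rewrite (ea' y) mulr_sumr raddf_sum big1 // => k _.
    rewrite -scalerAr [LHS]trZ.
    have /rowP/(_ k) := aG x; rewrite !mxE => <-.
    rewrite [X in _ * X](_ : _ = 0) ?mulr0 //.
    have /rowP/(_ k) := v0; rewrite !mxE => {2}<-; apply: eq_bigr => i _.
    by rewrite !mxE va.
  apply/rowP => i; rewrite mxE -va.
  suff -> : x = 0 by rewrite raddf0.
  (* If x were nonzero, 1 = x / x would have trace 0; but its trace is n, and n > 0 because the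
     index [i] exists. *)
  apply: contra_notP (negP (negbT (ltnn 0))) => /eqP x0.
  have := trE 1; rewrite -(mulfV x0) tx0 rmorph0 mulfV // /trace.
  under eq_bigr do rewrite rmorph1.
  rewrite sumr_const card_ord => /eqP; rewrite pnatr_eq0 => /eqP n0.
  by have := leq_ltn_trans (leq0n i) (ltn_ord i); rewrite n0.
have /intrP[d dE] := det_int GI.
exists `|d|%N, a'; split=> [|x ai|x i Jx].
- by rewrite absz_gt0; apply: contraNneq G0 => d0; rewrite dE d0.
- rewrite (ea' x); apply: ringO_sum => i _; have /intrP[z ->] := ai i.
  rewrite -mulr_algl -[_%:A]/(in_alg F _) rmorph_int.
  by apply: ringOM; [exact: ringO_int|exact: (hm i).2].
- suff dI : \det G * a' i x \is a Num.int.
    by rewrite pmulrn abszEsg intrM -dE -mulrA; apply: rpredM => //; rewrite intr_int.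
  have /(congr1 (fun A => A *m \adj G)) := aG x.
  rewrite -mulmxA mul_mx_adj mul_mx_scalar => /rowP/(_ i); rewrite !mxE => ->.
  apply: rpred_sum => k _; rewrite !mxE; apply: rpredM; first exact: trI.
  by rewrite rpredMsign; apply: det_int => *; rewrite !mxE; apply: trI.
Qed.

(** The label of x is its tuple of coordinates, scaled to integers by K = M N and reduced modulo K;
    equal labels make the coordinates of x - y integers. *)
Lemma congruence_label (M : nat) : (0 < M)%N ->
  exists (T : finType) (lab : F -> T), forall x y,
    J (M%:R * x) -> J (M%:R * y) -> lab x = lab y -> O (x - y).
Proof.
move=> M0; have [N [a [N0 aO aJ]]] := lattice_coordinates.
pose K := (M * N)%N; have K0 : (0 < K)%N by rewrite muln_gt0 M0.
have K0q : (K%:R : rat) != 0 by rewrite pnatr_eq0 -lt0n.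
pose c i x := Num.floor (K%:R * a i x : rat).
have cE x i : J (M%:R * x) -> K%:R * a i x = (c i x)%:~R.
  move=> Jx; apply/esym/eqP; rewrite -intrEfloor.
  have := aJ _ i Jx; have -> : a i (M%:R * x) = M%:R * a i x by rewrite !mulr_natl; exact: linearMn.
  by rewrite mulrA -natrM mulnC.
exists {ffun 'I_n -> 'I_K.-1.+1},
  (fun x => [ffun i => inord `|(c i x %% K%:Z)%Z|%N]) => x y Jx Jy /ffunP lxy.
apply: aO => i.
have := lxy i; rewrite !ffunE => /(congr1 val).
have bd z : (`|(c i z %% K%:Z)%Z| < K.-1.+1)%N.
  by rewrite prednK // -ltz_nat gez0_abs ?modz_ge0 ?ltz_mod // ?eqz_nat -lt0n.
rewrite /= !inordK // => cxy.
have : (c i x == c i y %[mod K%:Z])%Z.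
  apply/eqP; rewrite -[LHS]gez0_abs ?modz_ge0 ?eqz_nat -?lt0n // cxy.
  by rewrite gez0_abs // modz_ge0 // eqz_nat -lt0n.
rewrite eqz_mod_dvd => /dvdzP[q qE].
rewrite raddfB /=; apply/intrP; exists q.
apply: (mulfI K0q); rewrite mulrBr !cE // -intrB qE intrM mulrC.
by rewrite pmulrn.
Qed.

End Lattice.

Lemma pigeonhole_nat (T : finType) (f : nat -> T) :
  exists i j, (i < j)%N /\ f i = f j.
Proof.
pose g (i : 'I_#|T|.+1) := f i.
have /injectivePn[i [j ij gij]] : ~~ injectiveb g.
  by apply/negP => /injectiveP/leq_card; rewrite card_ord ltnn.
by case: (ltngtP i j) => h; [exists i, j|exists j, i|case/eqP: ij; exact: val_inj].
Qed.

(** Stands in for the ascending chain condition. An ideal containing [a] is determined by the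
    residues modulo [a] that it contains, so an inclusion of such ideals that does not raise the
    count of residues is an equality. *)
Lemma count_sub_eq (T : eqType) (P Q : pred T) (s : seq T) :
  subpred P Q -> (count Q s <= count P s)%N -> {in s, forall y, Q y -> P y}.
Proof.
move=> PQ; elim: s => //= x s IH cQP.
have cPQ := sub_count PQ s.
have QPx : (Q x <= P x)%N by lia.
move=> y; rewrite inE => /predU1P[->|ys]; first by case: (Q x) QPx; case: (P x).
by apply: IH ys; have := PQ x; case: (P x) (Q x) cQP => -[] /=; lia.
Qed.

(** * Integrality by pigeonhole and the inverse of a prime *)

Section Orders.
Context {R : realType} {F : fieldExtType rat} {n : nat}.
Variable sigma : 'I_n -> {rmorphism F -> R}.
Hypothesis hF : totally_real_field sigma.
Local Notation O := (@ringO F).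
Local Notation J := (codifferent sigma).

Lemma ringO_divides_nat (x : F) : x != 0 ->
  exists N y, [/\ (0 < N)%N, O y & N%:R = x * y].
Proof.
move=> x0; have [N N0 Oy] := ringO_denominator x^-1.
by exists N, (N%:R * x^-1); rewrite mulrCA mulfV ?mulr1.
Qed.


(** The powers of x share a denominator [N], so two of them, with exponents i < j, agree modulo O.
    Then x is a root of the monic polynomial X^j - X^i - (x^j - x^i). *)
Lemma almost_integral (c x : F) : c != 0 -> (forall k, O (c * x ^+ k)) -> O x.
Proof.
move=> c0 Ox; have [N [y [N0 Oy NE]]] := ringO_divides_nat c0.
have [T [lab labP]] := congruence_label hF N0.
have [i [j [ij lij]]] := pigeonhole_nat (fun k => lab (x ^+ k)).
have Jx k : J (N%:R * x ^+ k).
  by apply: ringO_codifferent => //; rewrite NE mulrAC; apply: ringOM.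
have Od : O (x ^+ j - x ^+ i) by apply: labP.
apply: (@ringO_root_monic _ x ('X^j - ('X^i + (x ^+ j - x ^+ i)%:P))).
- rewrite monicE lead_coefDl ?lead_coefXn // size_polyN size_polyXn ltnS.
  apply: leq_trans (size_polyD _ _) _.
  by rewrite geq_max size_polyXn ij (leq_trans (size_polyC_leq1 _)) ?(leq_ltn_trans _ ij).
- by rewrite rootE hornerD hornerN hornerD hornerC !hornerXn; apply/eqP; ring.
- move=> k; rewrite coefB coefD !coefXn poly.coefC.
  apply: ringOB; [|apply: ringOD]; try exact: ringO_nat.
  by case: eqP => _ //; exact: ringO0.
Qed.

Lemma ringO_residues (a : F) : O a -> a != 0 -> exists s : seq F,
  (forall y, y \in s -> O y) /\
  forall x, O x -> exists2 y, y \in s & exists2 z, O z & x - y = a * z.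
Proof.
move=> Oa a0; have [N [b [N0 Ob NE]]] := ringO_divides_nat a0.
have Nf : N%:R != 0 :> F by rewrite numfield_natr_eq0 -lt0n.
have [T [lab labP]] := congruence_label hF N0.
(* One representative for each label that is attained by some x / N; the other labels get 0. *)
have /choice[r rP] t : exists y, O y /\ ((exists2 x, O x & lab (x / N%:R) = t) ->
    lab (y / N%:R) = t).
  have [[x Ox xt]|nx] := pselect (exists2 x, O x & lab (x / N%:R) = t); first by exists x.
  by exists 0; split=> // ; exact: ringO0.
exists [seq r t | t <- enum T]; split=> [y /mapP[t _ ->]|x Ox]; first exact: (rP t).1.
exists (r (lab (x / N%:R))); first by rewrite map_f // mem_enum.
set y := r _; have [Oy /(_ _)ly] := rP (lab (x / N%:R)).
have {}ly : lab (x / N%:R) = lab (y / N%:R) by rewrite ly //; exists x.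
exists (b * (x / N%:R - y / N%:R)); last first.
  by rewrite mulrA -NE -mulrBl mulrCA mulfV ?mulr1.
apply: ringOM => //; apply: labP => //; apply: ringO_codifferent => //; by rewrite mulrCA mulfV ?mulr1.
Qed.

Lemma ringO_powers_congruent (a x : F) : O a -> a != 0 -> O x ->
  exists i j, (i < j)%N /\ exists2 z, O z & x ^+ j - x ^+ i = a * z.
Proof.
move=> Oa a0 Ox; have [s [Os sP]] := ringO_residues Oa a0.
have /choice[f fP] k : exists y : seq_sub s, exists2 z, O z & x ^+ k - val y = a * z.
  by have [y ys yz] := sP _ (ringOX k Ox); exists (SeqSub ys).
have [i [j [ij fij]]] := pigeonhole_nat f.
exists i, j; split=> //.
have [z Oz zE] := fP i; have [w Ow wE] := fP j.
by exists (w - z); [exact: ringOB|rewrite mulrBr -zE -wE fij; ring].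
Qed.

Lemma codifferent_denominator : exists2 d : nat, (0 < d)%N & forall x, J x -> O (d%:R * x).
Proof.
have [N [a [N0 aO aJ]]] := lattice_coordinates hF.
exists N => // x Jx; apply: aO => i.
have -> : a i (N%:R * x) = N%:R * a i x by rewrite !mulr_natl; exact: linearMn.
exact: aJ.
Qed.

(* If [x J] has integral traces then [x J] is contained in [J], so the powers *)
(* of [x] have bounded denominators.                                          *)
Lemma codifferent_dual (x : F) :
  (forall y, J y -> trace sigma (x * y) \is a Num.int) -> O x.
Proof.
move=> xJ; have [_ _ JM] := codifferent_submodule sigma.
have xJJ y : J y -> J (x * y).
  by move=> Jy z Oz; rewrite -mulrA; apply: xJ; rewrite mulrC; exact: JM.
have xk k : J (x ^+ k).
  elim: k => [|k IH]; first by apply: ringO_codifferent => //; exact: ringO1.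
  by rewrite exprS; exact: xJJ.
have [d d0 dJ] := codifferent_denominator.
apply: (@almost_integral d%:R) => [|k]; last exact: dJ.
by rewrite numfield_natr_eq0 -lt0n.
Qed.

(** For a nonzero [a] in p, the prime p is a colon ideal (a : b), found by a maximality argument.
    Then tau = b / a maps p into O and is not integral. If tau mapped p into p, all a tau^k would be
    integral and [almost_integral] would make tau integral. *)
Lemma prime_ideal_inverse (p : set F) : prime_ideal p ->
  exists tau pi, [/\ forall x, p x -> O (tau * x), p pi & ~ p (tau * pi)].
Proof.
move=> [[[p0 pD pM] [a pa a0] pO] p1 pP].
have Oa := pO _ pa.
have [s [Os sP]] := ringO_residues Oa a0.
(* [cond b] says that the colon ideal (a : b), of the x with x b in aO, is contained in p; [mu b]
   counts its residues modulo [a]. The choice b = 1 qualifies because (a : 1) = aO. *)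
pose cond b := O b /\ forall x, O x -> O (x * b / a) -> p x.
pose mu b := count (fun y => `[<O (y * b / a)>]) s.
have [b [[Ob bp] bmax]] : exists b, cond b /\ forall b', cond b' -> (mu b' <= mu b)%N.
  have ex : exists m, `[<exists2 b, cond b & mu b = m>].
    exists (mu 1); apply/asboolP; exists 1 => //; split; first exact: ringO1.
    by move=> x Ox; rewrite mulr1 => Oxa; rewrite -(divfK a0 x); exact: pM.
  have bd m : `[<exists2 b, cond b & mu b = m>] -> (m <= size s)%N.
    by move=> /asboolP[b _ <-]; exact: count_size.
  case: (ex_maxnP ex bd) => m /asboolP[b cb mb] mx; exists b; split=> // b' cb'.
  by rewrite mb; apply: mx; apply/asboolP; exists b'.
have maxE b' : cond b' -> (forall x, O (x * b / a) -> O (x * b' / a)) ->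
    forall y, O y -> O (y * b' / a) -> O (y * b / a).
  move=> cb' sub y Oy yb'; have [r rs [z Oz yr]] := sP _ Oy.
  have yE : y = r + a * z by rewrite -yr addrC subrK.
  have E c : y * c / a = r * c / a + c * z by rewrite yE; field.
  rewrite E; apply: ringOD; last exact: ringOM.
  have /count_sub_eq sc : subpred (fun y => `[<O (y * b / a)>]) (fun y => `[<O (y * b' / a)>]).
    by move=> x /asboolP/sub/asboolP.
  apply/asboolP/(sc _ (bmax _ cb')) => //; apply/asboolP.
  have -> : r * b' / a = y * b' / a - b' * z by rewrite E addrK.
  by apply: ringOB => //; apply: ringOM => //; case: cb'.
have tp x : p x -> O (x * b / a).
  move=> px; have Ox := pO _ px; apply: contrapT => nx.
  (* If (a : bx) is inside p, maximality gives (a : bx) = (a : b), so x^i can be cancelled from x^i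
     (1 - x^(j-i)) b in aO. Then p contains 1 - x^(j-i) as well as x, which is absurd. Otherwise
     some y outside p has y b x in aO; as p is prime, (a : by) is inside p, hence equals (a : b),
     and it contains x. *)
  have [cbx|ncbx] := pselect (cond (b * x)).
    have E := maxE _ cbx.
    have {}E y : O y -> O (y * (b * x) / a) -> O (y * b / a).
      apply: E => z Oz; have -> : z * (b * x) / a = x * (z * b / a) by ring.
      exact: ringOM.
    have Ek k y : O y -> O (y * x ^+ k * b / a) -> O (y * b / a).
      elim: k y => [|k IH] y Oy; first by rewrite expr0 mulr1.
      move=> h; apply: IH => //; apply: E; first by apply: ringOM => //; exact: ringOX.
      by congr O : h; rewrite exprS; ring.
    have [i [j [ij [z Oz xE]]]] := ringO_powers_congruent Oa a0 Ox.
    have : O ((1 - x ^+ (j - i)) * b / a).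
      apply: (Ek i); first by apply: ringOB; [exact: ringO1|exact: ringOX].
      rewrite mulrBl mul1r -exprD subnK ?(ltnW ij) // -opprB xE.
      have -> : - (a * z) * b / a = - (z * b) by field.
      by apply: ringON; exact: ringOM.
    have [e ->] : exists e, (j - i)%N = e.+1 by exists (j - i).-1; rewrite prednK ?subn_gt0.
    move=> h; apply: p1; rewrite -(subrK (x ^+ e.+1) 1); apply: pD.
      by apply: bp => //; apply: ringOB; [exact: ringO1|exact: ringOX].
    by rewrite exprSr; apply: pM => //; exact: ringOX.
  have [y [Oy Oyx npy]] : exists y, [/\ O y, O (y * (b * x) / a) & ~ p y].
    apply: contrapT => h; apply: ncbx; split; first exact: ringOM.
    by move=> y Oy Oyx; apply: contrapT => npy; apply: h; exists y.
  have cby : cond (b * y).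
    split=> [|z Oz zby]; first exact: ringOM.
    have : p (z * y).
      by apply: bp; [exact: ringOM|congr O : zby; ring].
    by move/(pP _ _ Oz Oy) => [].
  apply: nx; apply: (maxE _ cby) => //.
    move=> z Oz; have -> : z * (b * y) / a = y * (z * b / a) by ring.
    exact: ringOM.
  by congr O : Oyx; ring.
have nOt : ~ O (b / a).
  by move=> h; apply/p1/bp; [exact: ringO1|rewrite mul1r].
exists (b / a).
have tp' x : p x -> O (b / a * x) by move=> /tp; congr O; ring.
suff [x px nx] : exists2 x, p x & ~ p (b / a * x) by exists x.
apply: contrapT => h; apply: nOt; apply: (almost_integral a0) => k; apply: (pO).
elim: k => [|k IH]; first by rewrite expr0 mulr1.
apply: contrapT => hk; apply: h; exists (a * (b / a) ^+ k) => //.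
by move=> hk'; apply: hk; congr p : hk'; rewrite exprS; ring.
Qed.

End Orders.

(** * Ideals, primes and absolute values *)

Section IdealProducts.
Context {F : fieldExtType rat}.
Local Notation O := (@ringO F).
Implicit Types I K : set F.

Lemma idealM_mem I K x y : I x -> K y -> idealM I K (x * y).
Proof.
move=> Ix Ky; exists [:: (x, y)]; split; last by rewrite big_seq1.
by move=> u; rewrite inE => /eqP ->.
Qed.

Lemma idealM_ind I K (P : F -> Prop) : P 0 -> (forall x y, P x -> P y -> P (x + y)) ->
  (forall x y, I x -> K y -> P (x * y)) -> forall x, idealM I K x -> P x.
Proof.
move=> P0 PD PM x [s [sIK ->]]; rewrite big_seq; elim/big_ind: _ => // u us.
by apply: PM; case: (sIK u us).
Qed.

Lemma idealM_submodule I K : O_submodule I -> O_submodule K -> O_submodule (idealM I K).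
Proof.
move=> [I0 ID IM] [K0 KD KM]; split.
- by exists [::]; split=> //; rewrite big_nil.
- move=> x y [s [sIK ->]] [s' [sIK' ->]]; exists (s ++ s'); split; last by rewrite big_cat.
  by move=> u; rewrite mem_cat => /orP[/sIK|/sIK'].
- move=> a x Oa; apply: (@idealM_ind I K (fun x => idealM I K (a * x))) => [|y z|y z Iy Kz].
  + by rewrite mulr0; exists [::]; split=> //; rewrite big_nil.
  + move=> [s [sIK sE]] [s' [sIK' sE']]; exists (s ++ s'); split.
      by move=> u; rewrite mem_cat => /orP[/sIK|/sIK'].
    by rewrite big_cat mulrDr sE sE'.
  + by rewrite mulrA; apply: idealM_mem => //; exact: IM.
Qed.

Lemma integral_idealM I K : integral_ideal I -> integral_ideal K -> integral_ideal (idealM I K).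
Proof.
move=> [Is [x Ix x0] IO] [Ks [y Ky y0] KO]; split; first exact: idealM_submodule.
- by exists (x * y); [exact: idealM_mem|rewrite mulf_neq0].
- apply: idealM_ind => [|u v|u v /IO Ou /KO Ov]; [exact: ringO0|exact: ringOD|exact: ringOM].
Qed.

Lemma integral_ideal_ringO : integral_ideal O.
Proof.
split=> //; last by exists 1; [exact: ringO1|exact: oner_neq0].
split; [exact: ringO0|exact: ringOD|exact: ringOM].
Qed.

Lemma integral_idealX I m : integral_ideal I -> integral_ideal (idealX I m).
Proof.
move=> hI; elim: m => [|m IH]; first exact: integral_ideal_ringO.
exact: integral_idealM.
Qed.

Lemma idealM_ringO I : O_submodule I -> idealM I O = I.
Proof.
move=> [I0 ID IM]; rewrite eqEsubset; split=> x.
  by apply: idealM_ind => // u v Iu Ov; rewrite mulrC; exact: IM.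
by rewrite -{2}(mulr1 x) => Ix; apply: idealM_mem => //; exact: ringO1.
Qed.

Lemma idealM_subr I K : O_submodule K -> I `<=` O -> idealM I K `<=` K.
Proof. by move=> [K0 KD KM] IO x; apply: idealM_ind => // u v /IO Ou; exact: KM. Qed.

Lemma idealM_subl I K : O_submodule I -> K `<=` O -> idealM I K `<=` I.
Proof. by move=> [I0 ID IM] KO x; apply: idealM_ind => // u v Iu /KO Ov; rewrite mulrC; exact: IM. Qed.

End IdealProducts.

(** * Residue rings and powers of a prime *)

Section Primes.
Context {R : realType} {F : fieldExtType rat} {n : nat}.
Variable sigma : 'I_n -> {rmorphism F -> R}.
Hypothesis hF : totally_real_field sigma.
Local Notation O := (@ringO F).

Definition ideal_cosets (I : set F) : set (set F) :=
  [set A : set F | exists2 x, O x & A = [set x + y | y in I]].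

Lemma ideal_coset_eq (I : set F) x y : O_submodule I -> I (x - y) ->
  [set x + z | z in I] = [set y + z | z in I].
Proof.
move=> [I0 ID IM] Ixy; have IN z : I z -> I (- z).
  by rewrite -[- z]mulN1r; apply: IM; apply: ringON; exact: ringO1.
rewrite eqEsubset; split=> _ [z Iz <-].
  by exists (x - y + z); [exact: ID|ring].
by exists (- (x - y) + z); [apply: ID => //; exact: IN|ring].
Qed.

Lemma ideal_cosets_finite (I : set F) : integral_ideal I -> finite_set (ideal_cosets I).
Proof.
move=> [sI [a Ia a0] IO]; have [I0 ID IM] := sI.
have [s [Os sP]] := ringO_residues hF (IO _ Ia) a0.
apply: (@sub_finite_set _ _ ((fun x => [set x + y | y in I]) @` [set` s])).
  move=> A [x Ox ->]; have [y ys [z Oz xy]] := sP _ Ox.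
  by exists y => //; apply/esym/ideal_coset_eq => //; rewrite xy mulrC; exact: IM.
by apply: finite_image; exact: finite_seq.
Qed.

Lemma idealN_gt0 (I : set F) : integral_ideal I -> (0 < idealN I)%N.
Proof.
move=> hI; have [[I0 _ _] _ _] := hI.
rewrite /idealN cardfs_gt0; apply/fset0Pn; exists [set 0 + y | y in I].
by rewrite in_fset_set ?inE; [exists 0 => //; exact: ringO0|exact: ideal_cosets_finite].
Qed.

Lemma idealN_gt1 (I : set F) : integral_ideal I -> ~ I 1 -> (1 < idealN I)%N.
Proof.
move=> hI nI1; have [[I0 _ _] _ _] := hI.
have fI := ideal_cosets_finite hI.
set A := [set 0 + y | y in I]; set B := [set 1 + y | y in I].
have AB : A != B.
  apply/eqP => AB; apply: nI1; have : B 1 by exists 0; rewrite ?addr0.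
  by rewrite -AB => -[y Iy <-]; rewrite add0r.
have := @fsubset_leq_card _ [fset A; B]%fset (fset_set (ideal_cosets I)).
rewrite cardfs2 AB; apply; apply/fsubsetP => C; rewrite !inE in_fset_set // => /orP[]/eqP ->.
  by rewrite inE; exists 0 => //; exact: ringO0.
by rewrite inE; exists 1 => //; exact: ringO1.
Qed.

Variable p : set F.
Hypothesis hp : prime_ideal p.

Let pI : integral_ideal p := let: And3 h _ _ := hp in h.
Let pS : O_submodule p := let: And3 h _ _ := pI in h.
Let pO : p `<=` O := let: And3 _ _ h := pI in h.

(** O/p is a finite domain: in a congruence between x^i and x^j modulo an element of p, the factor
    x^i cancels, and x^(j-i-1) is the inverse. *)
Lemma prime_inverse_mod x : O x -> ~ p x -> exists2 y, O y & p (1 - x * y).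
Proof.
move=> Ox npx; have [_ np1 pP] := hp; have [_ [a pa a0] _] := pI; have [_ _ pM] := pS.
have [i [j [ij [z Oz xE]]]] := ringO_powers_congruent hF (pO pa) a0 Ox.
have nxi : ~ p (x ^+ i).
  elim: i {xE ij} => [|i IH]; first by rewrite expr0.
  by rewrite exprS => /(pP _ _ Ox (ringOX _ Ox))[].
exists (x ^+ (j - i).-1); first exact: ringOX.
rewrite -exprS prednK ?subn_gt0 //.
have : p (x ^+ i * (1 - x ^+ (j - i))).
  rewrite mulrBr mulr1 -exprD subnKC ?(ltnW ij) // -opprB xE -mulNr mulrC mulrN -mulNr.
  by apply: pM => //; exact: ringON.
by move/(pP _ _ (ringOX _ Ox) (ringOB ringO1 (ringOX _ Ox))) => [].
Qed.

Lemma idealXS_sub m : idealX p m.+1 `<=` idealX p m.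
Proof. by apply: idealM_subr => //; case: (integral_idealX m pI). Qed.

Lemma idealX_ringO m : idealX p m `<=` O.
Proof. by case: (integral_idealX m pI). Qed.

Lemma idealX1 : idealX p 1 = p.
Proof. exact: idealM_ringO. Qed.

Section Inverse.
Variable tau : F.
Hypothesis tauP : forall x, p x -> O (tau * x).

Lemma inverse_idealX m x : idealX p m.+1 x -> idealX p m (tau * x).
Proof.
have [[X0 XD XM] _ _] := integral_idealX m pI.
apply: (@idealM_ind _ _ _ (fun x => idealX p m (tau * x))); rewrite ?mulr0 // => y z.
  by rewrite mulrDr; exact: XD.
by move=> py Xz; rewrite mulrA; apply: XM => //; exact: tauP.
Qed.

Lemma inverseX_ringO m x : idealX p m x -> O (tau ^+ m * x).
Proof.
elim: m x => [|m IH] x; first by rewrite mul1r.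
by rewrite exprSr -mulrA => /inverse_idealX; exact: IH.
Qed.

End Inverse.

(** If x lay in every power of p, tau^m x would be integral for all m, and tau itself would be
    integral by [almost_integral]. But [tau * pi] is outside p although pi is in p. *)
Lemma idealX_exact x : O x -> x != 0 -> exists m, idealX p m x /\ ~ idealX p m.+1 x.
Proof.
move=> Ox x0; have [tau [pi [tauP ppi ntp]]] := prime_ideal_inverse hF hp.
apply: contrapT => h.
have Xx m : idealX p m x.
  by elim: m => // m IH; apply: contrapT => nX; apply: h; exists m.
have [_ _ pM] := pS.
apply: ntp; apply: pM => //; apply: (almost_integral hF x0) => k.
by rewrite mulrC; apply: inverseX_ringO.
Qed.

End Primes.

Section AbsoluteValue.
Context {R : realType} {F : fieldExtType rat} {p : set F}.
Variable c : completion R p.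
Implicit Types x y : c.

Lemma cabs0 : cabs c 0 = 0. Proof. exact/cabs_eq0. Qed.

Lemma cabs_neq0 x : (cabs c x != 0) = (x != 0).
Proof. by congr (~~ _); apply/eqP/eqP => /cabs_eq0. Qed.

Lemma cabs_gt0 x : (0 < cabs c x) = (x != 0).
Proof. by rewrite lt_neqAle cabs_ge0 andbT eq_sym cabs_neq0. Qed.

Lemma cabs1 : cabs c 1 = 1.
Proof.
have c1 : cabs c 1 != 0 by rewrite cabs_neq0 oner_eq0.
by apply: (mulfI c1); rewrite -cabsM !mulr1.
Qed.

Lemma cabsX x m : cabs c (x ^+ m) = cabs c x ^+ m.
Proof. by elim: m => [|m IH]; rewrite ?cabs1 // !exprS cabsM IH. Qed.

Lemma cabsV x : cabs c x^-1 = (cabs c x)^-1.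
Proof.
have [->|x0] := eqVneq x 0; first by rewrite invr0 cabs0 invr0.
have cx : cabs c x != 0 by rewrite cabs_neq0.
by apply: (mulfI cx); rewrite -cabsM !mulfV // cabs1.
Qed.

Lemma cabsN x : cabs c (- x) = cabs c x.
Proof.
have : cabs c (-1) ^+ 2 == 1 by rewrite -cabsX sqrrN expr1n cabs1.
rewrite sqrf_eq1 => /orP[]/eqP h; first by rewrite -mulN1r cabsM h mul1r.
by have := cabs_ge0 (c := c) (-1); rewrite h oppr_ge0 ler10.
Qed.

Lemma cabsD_le x y (r : R) : cabs c x <= r -> cabs c y <= r -> cabs c (x + y) <= r.
Proof. by move=> xr yr; apply: le_trans (cabsD _ _) _; rewrite ge_max xr. Qed.

Lemma cabsB_le x y (r : R) : cabs c x <= r -> cabs c y <= r -> cabs c (x - y) <= r.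
Proof. by move=> xr yr; apply: cabsD_le; rewrite ?cabsN. Qed.

Lemma cabsM_le1 x y : cabs c x <= 1 -> cabs c y <= 1 -> cabs c (x * y) <= 1.
Proof. by move=> x1 y1; rewrite cabsM mulr_ile1 ?cabs_ge0. Qed.

Lemma cabs_close x y : cabs c (x - y) < cabs c x -> cabs c y = cabs c x.
Proof.
move=> h; apply/eqP; rewrite eq_le; apply/andP; split.
  rewrite -[y](subKr x); apply: cabsB_le => //; exact: ltW.
rewrite leNgt; apply/negP => yx.
have := cabsD (x - y) y; rewrite subrK le_max => /orP[]; rewrite leNgt ?h ?yx //.
Qed.

Lemma cemb_approx (x : c) : x != 0 ->
  exists2 y : F, y != 0 & cabs c (cemb c y) = cabs c x.
Proof.
rewrite -cabs_gt0 => x0; have [y xy] := cemb_dense x x0.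
have E := cabs_close xy; exists y => //.
by rewrite -(fmorph_eq0 (cemb c)) -cabs_neq0 E gt_eqF.
Qed.

Lemma cemb_abs_neq0 (x : F) : (cabs c (cemb c x) != 0) = (x != 0).
Proof. by rewrite cabs_neq0 fmorph_eq0. Qed.

End AbsoluteValue.

(** * The p-adic absolute value *)

Section Valuation.
Context {R : realType} {F : fieldExtType rat} {n : nat}.
Variable sigma : 'I_n -> {rmorphism F -> R}.
Hypothesis hF : totally_real_field sigma.
Variable p : set F.
Hypothesis hp : prime_ideal p.
Variable c : completion R p.
Local Notation O := (@ringO F).
Local Notation "`| x |_p" := (cabs c (cemb c x)) (at level 0, format "`| x |_p").
Local Notation q := ((idealN p)%:R : R).

Let pI : integral_ideal p := let: And3 h _ _ := hp in h.
Let pS : O_submodule p := let: And3 h _ _ := pI in h.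
Let pO : p `<=` O := let: And3 _ _ h := pI in h.
Let np1 : ~ p 1 := let: And3 _ h _ := hp in h.

Lemma place_norm_gt1 : 1 < q.
Proof. by rewrite ltr1n; apply: (idealN_gt1 hF). Qed.

Let q0 : 0 < q. Proof. exact: lt_trans ltr01 place_norm_gt1. Qed.

Lemma place_norm_lt1 : q^-1 < 1.
Proof. by rewrite invf_lt1 // place_norm_gt1. Qed.

Lemma place_norm_expV_le m k : (q ^- m <= q ^- k) = (k <= m)%N.
Proof. by rewrite lef_pV2 ?posrE ?exprn_gt0 // ler_eXn2l // place_norm_gt1. Qed.

Lemma cabs_exact x : O x -> x != 0 ->
  exists m, [/\ idealX p m x, ~ idealX p m.+1 x & `|x|_p = q ^- m].
Proof.
move=> Ox x0; have [m [Xm nXm]] := idealX_exact hF hp Ox x0.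
by exists m; split=> //; exact: cabs_emb.
Qed.

Lemma idealX_le k m : (k <= m)%N -> idealX p m `<=` idealX p k.
Proof.
move=> /subnK <-; elim: (m - k)%N => // d IH x; rewrite addSn => /idealXS_sub.
by move=> h; apply: IH; exact: h.
Qed.

Lemma idealX_cabsP m x : O x -> (`|x|_p <= q ^- m) <-> idealX p m x.
Proof.
move=> Ox; have [->|x0] := eqVneq x 0.
  rewrite rmorph0 cabs0 invr_ge0 exprn_ge0 ?ler0n //; split=> // _.
  by have [[X0 _ _] _ _] := integral_idealX m pI.
have [k [Xk nXk ->]] := cabs_exact Ox x0; rewrite place_norm_expV_le; split.
  by move=> /idealX_le; apply.
move=> Xm; rewrite leqNgt; apply/negP => km; apply: nXk; exact: idealX_le Xm.
Qed.

Lemma cabs_ringO x : O x -> `|x|_p <= 1.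
Proof. by move=> Ox; have [_] := idealX_cabsP 0 Ox; rewrite expr0 invr1; apply. Qed.

Lemma cabs_primeP x : O x -> (`|x|_p <= q^-1) <-> p x.
Proof. by move=> Ox; have := idealX_cabsP 1 Ox; rewrite idealX1 // expr1. Qed.

Lemma cabs_prime x : p x -> `|x|_p <= q^-1.
Proof. by move=> px; apply/cabs_primeP => //; exact: pO. Qed.

Lemma cabs_unit x : O x -> ~ p x -> `|x|_p = 1.
Proof.
move=> Ox npx; have x0 : x != 0 by apply/eqP => x0; apply: npx; rewrite x0; case: pS.
have [[|m] [Xm nXm ->]] := cabs_exact Ox x0; first by rewrite expr0 invr1.
by case: npx; rewrite -(idealX1 hp); exact: idealX_le Xm.
Qed.

Lemma cabs_uniformizer : exists tau pi, [/\ forall x, p x -> O (tau * x), p pi,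
  ~ p (tau * pi), `|pi|_p = q^-1 & `|tau|_p = q].
Proof.
have [tau [pi [tauP ppi ntp]]] := prime_ideal_inverse hF hp.
have pi0 : pi != 0 by apply/eqP => pi0; apply: ntp; rewrite pi0 mulr0; case: pS.
(* The exponent is not 0 because pi is in p, and an exponent of at least 2 would put [tau * pi] in
   p. *)
have pia : `|pi|_p = q^-1.
  have [[|[|m]] [Xm nXm piE]] := cabs_exact (pO ppi) pi0; last 2 first.
  - by rewrite piE expr1.
  - case: ntp; have /(inverse_idealX hp tauP) : idealX p 2 pi by exact: idealX_le Xm.
    by rewrite idealX1.
  by case: nXm; rewrite idealX1.
exists tau, pi; split=> //.
have := cabs_unit (tauP _ ppi) ntp; rewrite rmorphM cabsM pia => h.
by apply: (mulIf (x := q^-1)); rewrite ?invr_eq0 ?gt_eqF // h mulfV ?gt_eqF.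
Qed.

(** Take a positive integer N with N x integral and remove its exact p-part p^m by multiplying with
    tau^m. *)
Lemma cabs_denominator x : `|x|_p <= 1 -> exists d, [/\ O d, ~ p d & O (d * x)].
Proof.
have [tau [pi [tauP ppi ntp _ taua]]] := cabs_uniformizer.
have [N N0 ONx] := ringO_denominator x.
have Nf : N%:R != 0 :> F by rewrite numfield_natr_eq0 -lt0n.
have [m [Xm nXm NE]] := cabs_exact (ringO_nat N) Nf.
move=> x1; exists (tau ^+ m * N%:R); split.
- exact: (inverseX_ringO hp).
- have Od : O (tau ^+ m * N%:R) by exact: (inverseX_ringO hp).
  move=> /(cabs_primeP Od); rewrite rmorphM rmorphXn cabsM cabsX taua NE.
  by rewrite mulfV ?expf_neq0 ?gt_eqF // leNgt place_norm_lt1.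
- rewrite -mulrA; apply: (inverseX_ringO hp) => //.
  apply/idealX_cabsP => //; rewrite rmorphM cabsM NE.
  by rewrite ler_piMr // invr_ge0 exprn_ge0 ?ltW.
Qed.

(** The value group is discrete: by density x may be replaced by an element of F, and a denominator
    prime to p moves it into O, where norm less than 1 means membership in p. *)
Lemma cabs_lt1 (x : c) : cabs c x < 1 -> cabs c x <= q^-1.
Proof.
have [->|x0] := eqVneq x 0; first by rewrite cabs0 invr_ge0 ltW.
have [y y0 <-] := cemb_approx x0 => y1.
have [d [Od npd Ody]] := cabs_denominator (ltW y1).
have dE : `|d * y|_p = `|y|_p by rewrite rmorphM cabsM cabs_unit ?mul1r.
rewrite -dE; apply/cabs_prime; apply: contrapT => npdy.
by move: y1; rewrite -dE cabs_unit ?ltxx.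
Qed.

Lemma integers_dense (x : c) : cabs c x <= 1 -> exists2 y, O y & cabs c (x - cemb c y) <= q^-1.
Proof.
move=> x1; have [z xz] := cemb_dense x ltr01.
have z1 : `|z|_p <= 1.
  by rewrite -[cemb c z](subKr x); apply: cabsB_le => //; exact: ltW.
have [d [Od npd Odz]] := cabs_denominator z1.
have [e Oe pe] := prime_inverse_mod hF hp Od npd.
(* As [e] inverts [d] modulo p, this element differs from z by (1 - d e) z, of norm at most 1/q. *)
exists (e * (d * z)); first exact: ringOM.
have -> : x - cemb c (e * (d * z)) = (x - cemb c z) + cemb c (1 - d * e) * cemb c z.
  have -> : e * (d * z) = z - (1 - d * e) * z by ring.
  by rewrite (rmorphB (cemb c)) (rmorphM (cemb c)) opprB addrCA addrC.
apply: cabsD_le; first exact: cabs_lt1.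
rewrite cabsM -[leRHS]mulr1; apply: ler_pM => //; rewrite ?cabs_ge0 //.
exact: cabs_prime.
Qed.

End Valuation.

Lemma exprM_small (R : realType) (r b e : R) : 0 <= r < 1 -> 0 <= b -> 0 < e ->
  exists N, r ^+ N * b <= e.
Proof.
move=> /andP[r0 r1] b0 e0.
have e1 : 0 < e / (b + 1) by rewrite divr_gt0 // ltr_wpDl.
have /cvg_expr/cvgrPdist_lt/(_ _ e1)[N _ /(_ N (leqnn N))] : `|r| < 1 by rewrite ger0_norm.
rewrite /= sub0r normrN ger0_norm ?exprn_ge0 // ltr_pdivlMr ?ltr_wpDl // => /ltW h.
by exists N; apply: le_trans h; rewrite ler_wpM2l ?exprn_ge0 // lerDl.
Qed.

(** * The set of finite places *)

Section Places.
Context {R : realType} {F : fieldExtType rat} {n : nat}.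
Variable sigma : 'I_n -> {rmorphism F -> R}.
Hypothesis hF : totally_real_field sigma.
Local Notation O := (@ringO F).
Local Notation J := (codifferent sigma).

(** Among the proper ideals containing I, one with the most residues modulo [a] is maximal. It is
    prime: for x outside M, the ideal M' = M + xO contains 1, and multiplying by y puts y in M. *)
Lemma prime_ideal_above (I : set F) : integral_ideal I -> ~ I 1 ->
  exists v : fplace F, I `<=` sval v.
Proof.
move=> [sI [a Ia a0] IO] nI1.
have [s [Os sP]] := ringO_residues hF (IO _ Ia) a0.
pose cond M := [/\ O_submodule M, M `<=` O, ~ M 1 & I `<=` M].
pose mu M := count (fun y => `[<M y>]) s.
have [M [cM Mmax]] : exists M, cond M /\ forall M', cond M' -> (mu M' <= mu M)%N.
  have ex : exists m, `[<exists2 M, cond M & mu M = m>].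
    by exists (mu I); apply/asboolP; exists I => //; split.
  have bd m : `[<exists2 M, cond M & mu M = m>] -> (m <= size s)%N.
    by move=> /asboolP[M _ <-]; exact: count_size.
  case: (ex_maxnP ex bd) => m /asboolP[M cM mM] mx; exists M; split=> // M' cM'.
  by rewrite mM; apply: mx; apply/asboolP; exists M'.
have [sM MO nM1 IM] := cM; have [M0 MD MM] := sM.
suff pM : prime_ideal M by exists (exist _ M pM).
split=> //; first by split=> //; exists a => //; exact: IM.
move=> x y Ox Oy Mxy; have [Mx|nMx] := pselect (M x); [by left|right].
pose M' := [set u | exists m o, [/\ M m, O o & u = m + o * x]].
have MM' : M `<=` M' by move=> m Mm; exists m, 0; split=> //; [exact: ringO0|ring].
have [M1x|nn1] := pselect (M' 1).
  have [m [b1 [Mm Ob1 E]]] := M1x.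
  rewrite -(mul1r y) E mulrDl; apply: MD; first by rewrite mulrC; exact: MM.
  by rewrite -mulrA; exact: MM.
have M'x : M' x by exists 0, 1; split=> //; [exact: ringO1|ring].
have cM' : cond M'.
  split=> //.
  - split; first exact: MM'.
      move=> _ _ [m [b1 [Mm Ob1 ->]]] [m' [b2 [Mm' Ob2 ->]]].
      by exists (m + m'), (b1 + b2); split; [exact: MD|exact: ringOD|ring].
    move=> b _ Ob [m [b1 [Mm Ob1 ->]]].
    by exists (b * m), (b * b1); split; [exact: MM|exact: ringOM|ring].
  - move=> _ [m [b1 [/MO Om Ob1 ->]]]; apply: ringOD => //; exact: ringOM.
  - by apply: subset_trans MM'.
exfalso; apply: nMx; have [r rs [z Oz xr]] := sP _ Ox.
have Maz : M (a * z) by rewrite mulrC; apply: MM => //; exact: IM.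
have Mr : M r.
  have sub : subpred (fun y => `[<M y>]) (fun y => `[<M' y>]).
    by move=> u /asboolP/MM'/asboolP.
  apply/asboolP/(count_sub_eq sub (Mmax _ cM') rs)/asboolP.
  have [_ M'D _ _] := cM'; have [_ {}M'D M'M] := let: And4 h _ _ _ := cM' in h.
  have -> : r = x + (- 1) * (a * z) by rewrite -xr; ring.
  by apply: M'D => //; apply: M'M; [apply: ringON; exact: ringO1|exact: MM'].
by rewrite -(subrK r x) xr; exact: MD.
Qed.

Lemma places_separated (v w : fplace F) : w <> v -> exists2 z, sval w z & ~ sval v z.
Proof.
move=> wv; apply: contrapT => h; apply: wv.
have wsv z : sval w z -> sval v z by move=> wz; apply: contrapT => nvz; apply: h; exists z.
have vsw z : sval v z -> sval w z.
  move=> vz; apply: contrapT => nwz.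
  have [[[_ vD vM] _ vO] nv1 _] := svalP v.
  have [y Oy wy] := prime_inverse_mod hF (svalP w) (vO _ vz) nwz.
  apply: nv1; rewrite -(subrK (z * y) 1); apply: vD; first exact: wsv.
  by rewrite mulrC; exact: vM.
have E : sval w = sval v by rewrite eqEsubset.
case: v w E {wsv vsw h} => [v pv] [w pw] /= E; subst w.
by congr exist; exact: Prop_irrelevance.
Qed.

Variable Fv : forall v : fplace F, completion R (sval v).
Local Notation "`| x |_ v" := (cabs (Fv v) x)
  (at level 0, v at level 2, format "`| x |_ v").
Local Notation iota v := (cemb (Fv v)).

(** A prime containing a nonzero integral y is determined by which of the finitely many residues
    modulo y it contains, so there are finitely many such primes. A general x is a quotient of
    integral elements. *)
Lemma almost_all_unit (x : F) : x != 0 -> almost_all (fun v => `|iota v x|_v = 1).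
Proof.
suff Ounit y : O y -> y != 0 -> almost_all (fun v => `|iota v y|_v = 1).
  move=> x0; have [N N0 ONx] := ringO_denominator x.
  have Nf : N%:R != 0 :> F by rewrite numfield_natr_eq0 -lt0n.
  have fN := Ounit _ (ringO_nat N) Nf.
  have fNx := Ounit _ ONx (mulf_neq0 Nf x0).
  have : finite_set ([set v | ~ (`|iota v N%:R|_v = 1)] `|` [set v | ~ (`|iota v (N%:R * x)|_v = 1)]).
    by rewrite finite_setU.
  apply: sub_finite_set => v /= nx; apply/not_andP => -[h1 h2]; apply: nx.
  by move: h2; rewrite rmorphM cabsM h1 mul1r.
move=> Oy y0; have [s [Os sP]] := ringO_residues hF Oy y0.
have inB v : ~ `|iota v y|_v = 1 -> sval v y.
  by move=> h; apply: contrapT => /(cabs_unit hF (svalP v) (Fv v) Oy)/h.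
pose f (v : fplace F) : {ffun seq_sub s -> bool} := [ffun i => `[<sval v (val i)>]].
apply: (@sub_finite_set _ _ [set v : fplace F | sval v y]) => [v /inB//|].
have finj : {in [set v : fplace F | sval v y] &, injective f}.
  move=> v w; rewrite !inE /= => vy wy /ffunP fvw.
  suff half (v' w' : fplace F) : sval v' y -> sval w' y -> f v' = f w' -> sval v' `<=` sval w'.
    apply: contrapT => vw; have [z wz nvz] := places_separated (nesym vw).
    by apply: nvz; apply: half wz => //; apply/esym/ffunP => i; rewrite fvw.
  move=> v'y w'y /ffunP fvw' z v'z; have [[[_ vD vM] _ vO] _ _] := svalP v'.
  have [[_ wD wM] _ _] := let: And3 h _ _ := svalP w' in h.
  have [r rs [t Ot zr]] := sP _ (vO _ v'z).
  have v'r : sval v' r.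
    have -> : r = z + (- 1) * (t * y) by rewrite mulrC -[t * y]mulrC -zr; ring.
    by apply: vD => //; apply: (vM); [apply: ringON; exact: ringO1|exact: vM].
  have := fvw' (SeqSub rs); rewrite !ffunE /= => E.
  have w'r : sval w' r by apply/asboolP; rewrite -E; apply/asboolP.
  by rewrite -(subrK r z) zr; apply: wD => //; rewrite mulrC; exact: wM.
have : finite_set (f @` [set v | sval v y]) by exact: finite_finset.
by rewrite (eq_finite_set (inj_card_eq finj)).
Qed.

End Places.

(** * Divisibility, the local-global principle and approximation *)

Section LocalGlobal.
Context {R : realType} {F : fieldExtType rat} {n : nat}.
Variable sigma : 'I_n -> {rmorphism F -> R}.
Hypothesis hF : totally_real_field sigma.
Local Notation O := (@ringO F).
Local Notation J := (codifferent sigma).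
Local Notation D := (different sigma).

Lemma different_integral : integral_ideal D.
Proof.
split; first split.
- by move=> y _; rewrite mul0r; exact: ringO0.
- by move=> x y Dx Dy z Jz; rewrite mulrDl; apply: ringOD; [exact: Dx|exact: Dy].
- by move=> a x Oa Dx y Jy; rewrite -mulrA; apply: ringOM => //; exact: Dx.
- have [d d0 dJ] := codifferent_denominator hF; exists d%:R => //.
  by rewrite numfield_natr_eq0 -lt0n.
- move=> x Dx; rewrite -(mulr1 x); apply: Dx; apply: ringO_codifferent => //; exact: ringO1.
Qed.

(** The cofactor is K = (I : p). That I is inside pK follows from 1 = pi tau y + w with w in p,
    available because [tau * pi] is a unit modulo p. *)
Lemma ideal_dvd_prime (p I : set F) : prime_ideal p -> integral_ideal I ->
  I `<=` p -> ideal_dvd p I.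
Proof.
move=> hp [[I0 ID IM] [x Ix x0] IO] Ip; have [[[p0 pD pM] _ pO] _ _] := hp.
have [tau [pi [tauP ppi ntp]]] := prime_ideal_inverse hF hp.
have [y Oy pw] := prime_inverse_mod hF hp (tauP _ ppi) ntp.
set w := 1 - _ in pw.
have split1 u : u = pi * (tau * y * u) + w * u by rewrite /w; ring.
pose K := [set u : F | forall z, p z -> I (z * u)].
have IK : I `<=` K by move=> u Iu z pz; apply: (IM) => //; exact: pO.
have KS : O_submodule K.
  split; first exact: IK.
  - by move=> u v Ku Kv z pz; rewrite mulrDr; apply: (ID); [exact: Ku|exact: Kv].
  - by move=> a u Oa Ku z pz; rewrite mulrCA; apply: (IM) => //; exact: Ku.
exists K.
  split=> //; first by exists x => //; exact: IK.
  move=> u Ku; rewrite (split1 u); apply: ringOD; last by apply: IO; exact: Ku.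
  have -> : pi * (tau * y * u) = y * (tau * (pi * u)) by ring.
  by apply: ringOM => //; apply: tauP; apply: Ip; exact: Ku.
rewrite eqEsubset; split=> u; last by apply: idealM_ind => // z v pz; apply.
move=> Iu; rewrite (split1 u); have [_ MD _] := idealM_submodule (And3 p0 pD pM) KS.
apply: MD; apply: idealM_mem => //; last exact: IK.
move=> z pz; have -> : z * (tau * y * u) = (y * (tau * z)) * u by ring.
by apply: (IM) => //; apply: ringOM => //; exact: tauP.
Qed.

Lemma not_dvd_different (p c1 c2 : set F) : prime_ideal p ->
  integral_ideal c1 -> integral_ideal c2 ->
  ~ ideal_dvd p (idealM (idealM c1 c2) D) ->
  [/\ exists2 x, c1 x & ~ p x, exists2 x, c2 x & ~ p x & exists2 x, D x & ~ p x].
Proof.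
move=> hp hc1 hc2 nd; have [[[p0 pD pM] _ pO] _ _] := hp.
have hc12 := integral_idealM hc1 hc2; have hD := different_integral.
have hI := integral_idealM hc12 hD.
have [c12S _ c12O] := hc12; have [DS _ DO] := hD.
have [c1S _ c1O] := hc1; have [c2S _ c2O] := hc2.
have key (K : set F) : (forall x, idealM (idealM c1 c2) D x -> K x) -> exists2 x, K x & ~ p x.
  move=> IK; apply: contrapT => h; apply: nd; apply: (ideal_dvd_prime hp hI) => x /IK Kx.
  by apply: contrapT => npx; apply: h; exists x.
split; apply: key => x h.
- by apply: (idealM_subl c1S c2O); exact: (idealM_subl c12S DO).
- by apply: (idealM_subr c2S c1O); exact: (idealM_subl c12S DO).
- exact: (idealM_subr DS c12O).
Qed.

Variable Fv : forall v : fplace F, completion R (sval v).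
Local Notation "`| x |_ v" := (cabs (Fv v) x)
  (at level 0, v at level 2, format "`| x |_ v").
Local Notation iota v := (cemb (Fv v)).
Local Notation loc I v := (@loc R F Fv I v).

(** The integral a with a y in M form an ideal. If it were proper it would lie in a prime v; but y
    is bounded at v by some j in M, so y / j has a denominator d outside v, and d y is in M. *)
Lemma local_global (M : set F) y : O_submodule M -> (exists2 m, M m & m != 0) ->
  (forall v, loc M v (iota v y)) -> M y.
Proof.
move=> [M0 MD MM] [m Mm m0] lM.
pose I := [set a | O a /\ M (a * y)].
have [I1|nI1] := pselect (I 1); first by case: I1; rewrite mul1r.
have hI : integral_ideal I.
  split; first split.
  - by split; [exact: ringO0|rewrite mul0r].
  - by move=> a b [Oa Ma] [Ob Mb]; split; [exact: ringOD|rewrite mulrDl; exact: MD].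
  - by move=> a b Oa [Ob Mb]; split; [exact: ringOM|rewrite -mulrA; exact: MM].
  - have [N N0 ON] := ringO_denominator (y / m); exists N%:R.
      split; first exact: ringO_nat.
      have -> : N%:R * y = N%:R * (y / m) * m by field.
      exact: MM.
    by rewrite numfield_natr_eq0 -lt0n.
  - by move=> a [].
have [v Iv] := prime_ideal_above hF hI nI1.
have [j Mj yj] := lM v; exfalso.
have [y0|y0] := eqVneq y 0.
  by apply: nI1; split; [exact: ringO1|rewrite y0 mulr0].
have j0 : j != 0.
  apply: contraNneq y0 => j0; move: yj; rewrite j0 rmorph0 cabs0 => yj.
  rewrite -(fmorph_eq0 (iota v)); apply/eqP/(cabs_eq0 (c := Fv v))/eqP.
  by rewrite eq_le yj cabs_ge0.
have : `|iota v (y / j)|_v <= 1.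
  by rewrite fmorph_div cabsM cabsV ler_pdivrMr ?mul1r // cabs_gt0 fmorph_eq0.
move=> /(cabs_denominator hF (svalP v))[d [Od nvd Ody]].
apply: nvd; apply: Iv; split=> //.
have -> : d * y = d * (y / j) * j by field.
exact: MM.
Qed.

Lemma ringO_local x : O x <-> forall v, `|iota v x|_v <= 1.
Proof.
split=> [Ox v|h]; first exact: (cabs_ringO hF (svalP v)).
have [S1 S2 _] := @integral_ideal_ringO F.
by apply: local_global => // v; exists 1; [exact: ringO1|rewrite rmorph1 cabs1].
Qed.

Lemma codifferent_local x : (forall v, loc J v (iota v x)) -> J x.
Proof.
apply: local_global; first exact: codifferent_submodule.
by exists 1; [apply: ringO_codifferent => //; exact: ringO1|exact: oner_neq0].
Qed.

Lemma locD I v x y : loc I v x -> loc I v y -> loc I v (x + y).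
Proof.
move=> [a Ia xa] [b Ib yb].
have [ab|ba] := leP `|iota v a|_v `|iota v b|_v.
  by exists b => //; apply: cabsD_le => //; apply: le_trans ab.
by exists a => //; apply: cabsD_le => //; apply: le_trans (ltW ba).
Qed.

Lemma loc_le I v (x y : Fv v) : loc I v x -> `|y|_v <= `|x|_v -> loc I v y.
Proof. by move=> [a Ia xa] yx; exists a => //; apply: le_trans xa. Qed.

Lemma locMl I v (x y : Fv v) : `|x|_v <= 1 -> loc I v y -> loc I v (x * y).
Proof. by move=> x1 ly; apply: loc_le ly _; rewrite cabsM ler_piMl // cabs_ge0. Qed.

Lemma locMr I v (x y : Fv v) : loc I v x -> `|y|_v <= 1 -> loc I v (x * y).
Proof. by move=> lx y1; rewrite mulrC; exact: locMl. Qed.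

Lemma locN I v (x : Fv v) : loc I v x -> loc I v (- x).
Proof. by move=> lx; apply: loc_le lx _; rewrite cabsN. Qed.

Lemma loc0 I v : I 0 -> loc I v 0.
Proof. by move=> I0; exists 0 => //; rewrite rmorph0. Qed.

Lemma loc_integral I v (x : Fv v) : I `<=` O -> loc I v x -> `|x|_v <= 1.
Proof. by move=> IO [a /IO Oa xa]; apply: le_trans xa _; exact: (cabs_ringO hF (svalP v)). Qed.

Lemma loc_unit I v (x : Fv v) : I `<=` O -> (exists2 a, I a & ~ sval v a) ->
  `|x|_v <= 1 -> loc I v x.
Proof.
by move=> IO [a Ia nva] x1; exists a => //; rewrite (cabs_unit hF (svalP v)) //; exact: IO.
Qed.

Lemma loc_codifferent1 v (x : Fv v) : `|x|_v <= 1 -> loc J v x.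
Proof.
by move=> x1; exists 1; [apply: ringO_codifferent => //; exact: ringO1|rewrite rmorph1 cabs1].
Qed.

Lemma loc_codifferent_le1 v (x : Fv v) : (exists2 a, D a & ~ sval v a) ->
  loc J v x -> `|x|_v <= 1.
Proof.
move=> [a Da nva] [y Jy xy]; apply: le_trans xy _.
have Oa : O a by case: different_integral => _ _; apply.
have := cabs_ringO hF (svalP v) (Fv v) (Da _ Jy).
by rewrite rmorphM cabsM (cabs_unit hF (svalP v)) ?mul1r.
Qed.

Lemma loc_codifferentM b v (x y : Fv v) : b `<=` O -> loc J v x -> loc (idealM b D) v y ->
  `|x * y|_v <= 1.
Proof.
move=> bO [a Ja xa] [d Dd yd]; rewrite cabsM.
have Od : O (a * d).
  move: Dd; apply: (@idealM_ind _ _ _ (fun d => O (a * d))) => [|u w|u w bu Dw].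
  - by rewrite mulr0; exact: ringO0.
  - by rewrite mulrDr; exact: ringOD.
  - by rewrite mulrCA; apply: ringOM; [exact: bO|rewrite mulrC; exact: Dw].
apply: le_trans (cabs_ringO hF (svalP v) (Fv v) Od).
by rewrite rmorphM cabsM ler_pM ?cabs_ge0.
Qed.

(** Start with y in F of the right norm at v0. It exceeds the bound at finitely many places w only;
    a high power of an element of w outside v0 lowers the norm at w, keeps it at v0 and raises it
    nowhere. *)
Lemma prescribed_norm (s : forall v, Fv v) (v0 : fplace F) :
  (forall v, s v != 0) -> almost_all (fun v => `|s v|_v = 1) ->
  exists x : F, `|iota v0 x|_v0 = `|s v0|_v0 /\ forall w, `|iota w x|_w <= `|s w|_w.
Proof.
move=> s0 s1; have [y y0 yv] := cemb_approx (s0 v0).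
pose T : set {classic fplace F} := [set w | ~ `|iota w y|_w <= `|s w|_w].
have fT : finite_set T.
  have : finite_set ([set v | ~ (`|s v|_v = 1)] `|` [set v | ~ (`|iota v y|_v = 1)]).
    by rewrite finite_setU; split=> //; exact: (almost_all_unit hF).
  apply: sub_finite_set => v /= h; apply/not_andP => -[h1 h2]; apply: h.
  by rewrite h1 h2.
suff [z [Oz zv zT]] : exists z, [/\ O z, `|iota v0 z|_v0 = 1 &
    forall w, T w -> w <> v0 -> `|iota w (z * y)|_w <= `|s w|_w].
  exists (z * y); split; first by rewrite rmorphM cabsM zv mul1r.
  move=> w; have [->|wv] := pselect (w = v0); first by rewrite rmorphM cabsM zv mul1r yv.
  have [Tw|/contrapT nTw] := pselect (T w); first exact: zT.
  rewrite rmorphM cabsM; apply: le_trans nTw.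
  by rewrite ler_piMl ?cabs_ge0 // (cabs_ringO hF (svalP w)).
have [l ->] := (finite_seqP T).1 fT.
elim: l => [|w l [z [Oz zv zl]]]; first by exists 1; split=> //; [exact: ringO1|rewrite rmorph1 cabs1].
have [wv|wv] := pselect (w = v0).
  exists z; split=> // u; rewrite /= inE => /predU1P[->|ul] uv; first by [].
  exact: zl.
have [t wt nvt] := places_separated hF wv.
have Ot : O t by have [[_ _ h] _ _] := svalP w; exact: h.
have t1 : `|iota w t|_w < 1.
  apply: le_lt_trans (cabs_prime hF (svalP w) _ wt) _; exact: (place_norm_lt1 hF (svalP w)).
have [|||N hN] := @exprM_small R `|iota w t|_w `|iota w y|_w `|s w|_w.
- by rewrite cabs_ge0.
- exact: cabs_ge0.
- by rewrite cabs_gt0.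
exists (t ^+ N * z); split.
- by apply: ringOM => //; exact: ringOX.
- by rewrite rmorphM rmorphXn cabsM cabsX zv (cabs_unit hF (svalP v0)) // expr1n mulr1.
- move=> u; rewrite /= inE => /predU1P[->|ul] uv.
    rewrite !rmorphM rmorphXn !cabsM cabsX mulrAC; apply: le_trans hN.
    rewrite -[leRHS]mulr1; apply: ler_pM => //; rewrite ?cabs_ge0 //.
    + by rewrite mulr_ge0 ?exprn_ge0 // cabs_ge0.
    + exact: (cabs_ringO hF (svalP w)).
  rewrite -mulrA rmorphM cabsM; apply: le_trans (zl u ul uv).
  by rewrite ler_piMl ?cabs_ge0 // (cabs_ringO hF (svalP u)) //; exact: ringOX.
Qed.

End LocalGlobal.

(** * The adelic lift *)

Section Matrix2.
Context {K : fieldType}.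
Implicit Types A B : 'M[K]_2.

Lemma mulmx2E A B i j : (A *m B) i j = A i 0 * B 0 j + A i 1 * B 1 j.
Proof.
rewrite !mxE !big_ord_recl big_ord0 addr0.
by congr (_ * _ + A i _ * B _ j); exact: val_inj.
Qed.

Lemma mx2_eta A : A = mx2 (A 0 0) (A 0 1) (A 1 0) (A 1 1).
Proof. by apply/matrixP => -[[|[|//]] hi] [[|[|//]] hj]; rewrite !mxE /=; congr (A _ _); exact: val_inj. Qed.

Lemma mx2_00 (a b c d : K) : mx2 a b c d 0 0 = a. Proof. by rewrite mxE. Qed.
Lemma mx2_01 (a b c d : K) : mx2 a b c d 0 1 = b. Proof. by rewrite mxE. Qed.
Lemma mx2_10 (a b c d : K) : mx2 a b c d 1 0 = c. Proof. by rewrite mxE. Qed.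
Lemma mx2_11 (a b c d : K) : mx2 a b c d 1 1 = d. Proof. by rewrite mxE. Qed.
Definition mx2E := (mx2_00, mx2_01, mx2_10, mx2_11).

Lemma mulmx2 (a b c d a' b' c' d' : K) :
  mx2 a b c d *m mx2 a' b' c' d' =
  mx2 (a * a' + b * c') (a * b' + b * d') (c * a' + d * c') (c * b' + d * d').
Proof. by rewrite [LHS]mx2_eta !mulmx2E !mx2E. Qed.

Lemma det_mx2 A : \det A = A 0 0 * A 1 1 - A 0 1 * A 1 0.
Proof.
rewrite (expand_det_row _ 0) !big_ord_recl big_ord0 addr0 /cofactor !det_mx11 !mxE /=.
rewrite expr0 mul1r expr1 mulN1r mulrN.
by congr (A _ _ * A _ _ - A _ _ * A _ _); exact: val_inj.
Qed.

Lemma adj_mx2 A : \adj A = mx2 (A 1 1) (- A 0 1) (- A 1 0) (A 0 0).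
Proof.
rewrite [LHS]mx2_eta !mxE /cofactor !det_mx11 !mxE /= !expr0 !expr1 !mul1r !mulN1r sqrrN expr1n mul1r.
by congr mx2; try congr (- _); congr (A _ _); exact: val_inj.
Qed.

Lemma scale_mx2 u (a b c d : K) : u *: mx2 a b c d = mx2 (u * a) (u * b) (u * c) (u * d).
Proof. by rewrite [LHS]mx2_eta !mxE. Qed.

Lemma mx2_1 : 1%:M = mx2 1 0 0 1 :> 'M[K]_2.
Proof. by rewrite [LHS]mx2_eta !mxE. Qed.

Lemma invmx_adj A : A \in unitmx -> invmx A = (\det A)^-1 *: \adj A.
Proof. by rewrite /invmx => ->. Qed.

End Matrix2.

Lemma map_mx2 (K L : fieldType) (f : {rmorphism K -> L}) (a b c d : K) :
  map_mx f (mx2 a b c d) = mx2 (f a) (f b) (f c) (f d).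
Proof. by rewrite [LHS]mx2_eta !mxE. Qed.

(** * The slash action *)

Section Slash.
Local Open Scope complex_scope.
Context {R : realType} {n : nat}.
Local Notation C := R[i].
Implicit Types (A B : 'I_n -> 'M[R]_2) (z : 'rV[C]_n) (k : 'I_n -> nat).

Lemma aut_factor_neq0 A z j : \det (A j) != 0 -> 0 < complex.Im (z 0 j) ->
  aut_factor A z j != 0.
Proof.
move=> dA z0; apply: contraNneq dA; rewrite /aut_factor; case: (z 0 j) z0 => x y /= y0.
move=> /eqP; rewrite eq_complex /= !mul0r subr0 !addr0 => /andP[/eqP h1 /eqP h2].
have c0 : A j 1 0 = 0 by apply/eqP; rewrite -(mulIr_eq0 _ (mulIf (lt0r_neq0 y0))) h2.
by rewrite det_mx2 c0 mulr0 subr0; move: h1; rewrite c0 mul0r add0r => ->; rewrite mulr0.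
Qed.

Lemma moebius_upper_half A z : (forall j, 0 < \det (A j)) -> upper_half z ->
  upper_half (moebius A z).
Proof.
move=> dA hz j; rewrite mxE.
have := aut_factor_neq0 (lt0r_neq0 (dA j)) (hz j).
move: (dA j) (hz j); rewrite det_mx2 /aut_factor; case: (z 0 j) => x y /=.
set a := A j 0 0; set b := A j 0 1; set c := A j 1 0; set d := A j 1 1 => dt y0.
rewrite eq_complex /= !mul0r !subr0 !addr0 => nz.
have N0 : 0 < (c * x + d) ^+ 2 + (c * y) ^+ 2.
  rewrite lt_neqAle addr_ge0 ?sqr_ge0 // andbT eq_sym.
  by rewrite paddr_eq0 ?sqr_ge0 // !sqrf_eq0.
set N := _ + _ in N0 *; set u := _ / N; set v := _ / N.
have -> : (a * x + b) * - u + a * y * v = ((a * d - b * c) * y) / N.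
  by rewrite /u /v; field; rewrite gt_eqF.
by rewrite divr_gt0 // mulr_gt0.
Qed.

Lemma aut_factorM A B z j : \det (B j) != 0 -> 0 < complex.Im (z 0 j) ->
  aut_factor (fun j => A j *m B j) z j = aut_factor A (moebius B z) j * aut_factor B z j.
Proof.
move=> dB z0; have := aut_factor_neq0 dB z0.
rewrite {1 3}/aut_factor => nz; rewrite /aut_factor !mulmx2E [moebius B z 0 j]mxE.
by rewrite /aut_factor !(rmorphD, rmorphM) /=; field.
Qed.

Lemma moebiusM A B z : (forall j, \det (A j) != 0) -> (forall j, \det (B j) != 0) ->
  (forall j, 0 < \det (B j)) -> upper_half z ->
  moebius (fun j => A j *m B j) z = moebius A (moebius B z).
Proof.
move=> dA dB pB hz; apply/rowP => j; rewrite [LHS]mxE [RHS]mxE.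
rewrite aut_factorM //; have hB := moebius_upper_half pB hz.
have n1 := aut_factor_neq0 (dB j) (hz j).
have n2 := aut_factor_neq0 (dA j) (hB j).
rewrite invfM !mulmx2E [moebius B z 0 j]mxE; set v := aut_factor A _ j in n2 *; rewrite /aut_factor in n1 *.
by rewrite !(rmorphD, rmorphM) /=; field; rewrite n1 n2.
Qed.

Lemma slashM k A B f z : (forall j, 0 < \det (A j)) -> (forall j, 0 < \det (B j)) ->
  upper_half z -> slash k (fun j => A j *m B j) f z = slash k B (slash k A f) z.
Proof.
move=> dA dB hz; have dA' j := lt0r_neq0 (dA j); have dB' j := lt0r_neq0 (dB j).
rewrite /slash moebiusM // mulrA -big_split /=; congr (_ * _).
apply: eq_bigr => j _; rewrite aut_factorM // det_mulmx powRM ?ltW //.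
by rewrite rmorphM exprMn invfM /=; ring.
Qed.

End Slash.

(** * The local groups and the values of the lift *)

Section Lift.
Local Open Scope complex_scope.
Context {R : realType} {F : fieldExtType rat} {n : nat}.
Variable sigma : 'I_n -> {rmorphism F -> R}.
Hypothesis hF : totally_real_field sigma.
Local Notation O := (@ringO F).
Local Notation J := (codifferent sigma).
Local Notation D := (different sigma).
Local Notation C := R[i].
Variable Fv : forall v : fplace F, completion R (sval v).
Local Notation "`| x |_ v" := (cabs (Fv v) x)
  (at level 0, v at level 2, format "`| x |_ v").
Local Notation iota v := (cemb (Fv v)).
Variable b : set F.
Hypothesis hb : integral_ideal b.

Let bO : b `<=` O := let: And3 _ _ h := hb in h.
Let bD0 : idealM b D 0.
Proof. by have [[h _ _] _ _] := integral_idealM hb (different_integral hF). Qed.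
Let J0 : J 0. Proof. by have [] := codifferent_submodule sigma. Qed.

Lemma Kloc_mul v (x y : 'M[Fv v]_2) : Kloc sigma b x -> Kloc sigma b y -> Kloc sigma b (x *m y).
Proof.
move=> [x00 x11 x01 x10 dx] [y00 y11 y01 y10 dy]; split; rewrite ?mulmx2E.
- by apply: cabsD_le; [exact: cabsM_le1|exact: (loc_codifferentM hF bO)].
- by apply: cabsD_le; [rewrite mulrC; exact: (loc_codifferentM hF bO)|exact: cabsM_le1].
- by apply: locD; [exact: locMl|exact: locMr].
- by apply: locD; [exact: locMr|exact: locMl].
- by rewrite det_mulmx cabsM dx dy mulr1.
Qed.

Lemma Kloc_adj v (x : 'M[Fv v]_2) : Kloc sigma b x -> Kloc sigma b (\adj x).
Proof.
move=> [x00 x11 x01 x10 dx]; rewrite adj_mx2; split; rewrite ?mx2E //; try exact: locN.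
by rewrite det_mx2 !mx2E mulrNN mulrC [x 0 1 * _]mulrC [X in _ - X]mulrC -det_mx2.
Qed.

Lemma Kloc_unitmx v (x : 'M[Fv v]_2) : Kloc sigma b x -> x \in unitmx.
Proof. by move=> [_ _ _ _ dx]; rewrite unitmxE unitfE -(cabs_neq0 (c := Fv v)) dx oner_eq0. Qed.

Lemma Kloc_scale v u (x : 'M[Fv v]_2) : `|u|_v = 1 -> Kloc sigma b x -> Kloc sigma b (u *: x).
Proof.
move=> u1 [x00 x11 x01 x10 dx]; split; rewrite ?mxE; try (by rewrite cabsM u1 mul1r).
- by apply: locMl => //; rewrite u1.
- by apply: locMl => //; rewrite u1.
- by rewrite detZ cabsM cabsX u1 expr1n mul1r.
Qed.

Lemma Kloc_inv v (x : 'M[Fv v]_2) : Kloc sigma b x -> Kloc sigma b (invmx x).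
Proof.
move=> Kx; rewrite invmx_adj; last exact: Kloc_unitmx Kx.
by apply: Kloc_scale; [case: Kx => _ _ _ _ dx; rewrite cabsV dx invr1|exact: Kloc_adj].
Qed.

Lemma Kloc_upper v (x y z : Fv v) : `|x|_v = 1 -> loc J y -> `|z|_v = 1 ->
  Kloc sigma b (mx2 x y 0 z).
Proof.
move=> x1 Jy z1; split; rewrite ?mx2E ?x1 ?z1 //; first exact: loc0.
by rewrite det_mx2 !mx2E mulr0 subr0 cabsM x1 z1 mulr1.
Qed.

Lemma Kloc1 v : Kloc sigma b (1%:M : 'M[Fv v]_2).
Proof. by rewrite mx2_1; apply: Kloc_upper; rewrite ?cabs1 //; exact: loc0. Qed.

Variables (h : nat) (t : 'I_h -> fin_idele Fv).
Hypothesis ht : narrow_class_reps sigma t.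
Variables (k : 'I_n -> nat) (f : 'I_h -> 'rV[C]_n -> C).
Hypothesis hf : cusp_form sigma t k b f.

Lemma class_rep_neq0 nu v : t nu v != 0.
Proof. by have [/(_ nu)[_ h' _] _] := ht; exact: h'. Qed.

Lemma class_rep_almost_unit nu : almost_all (fun v => `|t nu v|_v = 1).
Proof. by have [/(_ nu)[_ _ h'] _] := ht. Qed.

Lemma class_rep_inj nu nu' (x : F) : x != 0 -> totally_positive sigma x ->
  (forall v, `|t nu' v|_v = `|iota v x * t nu v|_v) -> nu = nu'.
Proof.
move=> x0 xp xt; have [hid hcl] := ht.
have [nu0 [_ u]] := hcl (fun _ => 1, t nu') (hid nu').
rewrite -(u nu) ?(u nu') //; last first.
  by exists x; split=> // j; rewrite /= mul1r; exact: xp.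
exists 1; split=> [|j|v]; first exact: oner_neq0.
  by rewrite /= mul1r rmorph1.
by rewrite rmorph1 mul1r.
Qed.

Lemma upper_half_i : upper_half (const_mx 'i : 'rV[C]_n).
Proof. by move=> j; rewrite mxE /=. Qed.

(** Two decompositions differ by G = g'^-1 g. Comparing determinants shows that t_nu and t_nu' have
    the same narrow class, so nu = nu'. Then G lies in [Gamma sigma t b nu], and the invariance of
    [f nu] under G identifies the two values. *)
Lemma adelic_lift_unique g nu w g' nu' w' :
  \det g != 0 -> \det g' != 0 -> Wgroup sigma b w -> Wgroup sigma b w' ->
  adele_mx_mul (adele_mx_mul (principal_mx sigma Fv g) (xNi t nu)) w =
  adele_mx_mul (adele_mx_mul (principal_mx sigma Fv g') (xNi t nu')) w' ->
  slash k w.1 (f nu) (const_mx 'i) = slash k w'.1 (f nu') (const_mx 'i).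
Proof.
move=> dg dg' [dw Kw] [dw' Kw'] [Einf Efin].
have Ginf j : map_mx (sigma j) g *m w.1 j = map_mx (sigma j) g' *m w'.1 j.
  by have := congr1 (@^~ j) Einf; rewrite /= !mulmx1.
have Gfin v : map_mx (iota v) g *m mx2 (t nu v)^-1 0 0 1 *m w.2 v =
    map_mx (iota v) g' *m mx2 (t nu' v)^-1 0 0 1 *m w'.2 v.
  by have := congr1 (@^~ v) Efin.
have ug' : g' \in unitmx by rewrite unitmxE unitfE.
pose G := invmx g' *m g.
have dG : \det G = (\det g')^-1 * \det g by rewrite det_mulmx det_inv.
have dG0 : \det G != 0 by rewrite dG mulf_neq0 ?invr_neq0.
have GE : g = g' *m G by rewrite /G mulKVmx.
clearbody G.
have winf j : w'.1 j = map_mx (sigma j) G *m w.1 j.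
  have ug'j : map_mx (sigma j) g' \in unitmx by rewrite map_unitmx.
  by apply: (can_inj (mulKmx ug'j)); rewrite mulmxA -map_mxM -GE Ginf.
have wfin v : map_mx (iota v) G *m mx2 (t nu v)^-1 0 0 1 *m w.2 v =
    mx2 (t nu' v)^-1 0 0 1 *m w'.2 v.
  have ug'v : map_mx (iota v) g' \in unitmx by rewrite map_unitmx.
  by apply: (can_inj (mulKmx ug'v)); rewrite !mulmxA -map_mxM -GE Gfin.
have Gpos : totally_positive sigma (\det G).
  move=> j; have := dw' j; rewrite winf det_mulmx det_map_mx.
  by rewrite pmulr_lgt0.
have nuE : nu = nu'.
  apply: (@class_rep_inj _ _ (\det G)^-1); first by rewrite invr_eq0.
    by move=> j; rewrite fmorphV invr_gt0; exact: Gpos.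
  move=> v; have /(congr1 (fun A => `|\det A|_v)) := wfin v.
  have [_ _ _ _ d1] := Kw v; have [_ _ _ _ d2] := Kw' v.
  rewrite !det_mulmx !det_map_mx !(det_mx2 (mx2 _ _ _ _)) !mx2E !mulr1 !mul0r !subr0.
  rewrite !cabsM d1 d2 !mulr1 !cabsV fmorphV cabsV => E.
  have : `|iota v (\det G)|_v != 0 by rewrite cemb_abs_neq0.
  have : `|t nu v|_v != 0 by rewrite cabs_neq0 class_rep_neq0.
  have : `|t nu' v|_v != 0 by rewrite cabs_neq0 class_rep_neq0.
  move: E; set X := `|iota v _|_v; set Y := `|t nu v|_v; set Z := `|t nu' v|_v => E Z0 Y0 X0.
  by rewrite -[LHS]invrK -E; field; rewrite X0 Y0.
subst nu'; have tnz v := class_rep_neq0 nu v.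
have GG : Gamma sigma t b nu G.
  split=> //; exists (fun j => map_mx (sigma j) G, fun v => w'.2 v *m invmx (w.2 v)).
    split=> /= [j|v]; first by rewrite det_map_mx; exact: Gpos.
    by apply: Kloc_mul => //; exact: Kloc_inv.
  congr pair; apply: functional_extensionality_dep => v /=.
    by rewrite mulmx1 mul1mx.
  have uw := Kloc_unitmx (Kw v).
  apply: (can_inj (mulmxK uw)); rewrite -!mulmxA mulVmx // mulmx1 !mulmxA.
  (* x_nu is the scalar t_nu times x_nu^{-iota}, so [wfin] is the relation that defines [Gamma]. *)
  have -> : mx2 1 0 0 (t nu v) = t nu v *: mx2 (t nu v)^-1 0 0 1.
    by rewrite scale_mx2 !mulr0 mulr1 mulfV.
  by rewrite -scalemxAr -!scalemxAl wfin.
have -> : w'.1 = (fun j => map_mx (sigma j) G *m w.1 j).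
  by apply/funext => j; exact: winf.
rewrite slashM //; last exact: upper_half_i.
  rewrite [LHS]/slash [RHS]/slash; congr (_ * _); apply/esym.
  by apply: (cusp_form_slash hf GG); apply: moebius_upper_half => //; exact: upper_half_i.
by move=> j; rewrite det_map_mx; exact: Gpos.
Qed.

Lemma adelic_liftE g nu w : \det g != 0 -> Wgroup sigma b w ->
  adelic_lift sigma t k b f (adele_mx_mul (adele_mx_mul (principal_mx sigma Fv g) (xNi t nu)) w)
  = slash k w.1 (f nu) (const_mx 'i).
Proof.
move=> dg Ww; apply: xget_unique; first by exists g, nu, w.
move=> _ [g' [nu' [w' [dg' Ww' E ->]]]].
by apply/esym/(adelic_lift_unique dg dg') => //.
Qed.

Lemma adelic_lift_Kloc x (w : fin_mx Fv) : (forall v, Kloc sigma b (w v)) ->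
  adelic_lift sigma t k b f (x.1, fun v => x.2 v *m w v) = adelic_lift sigma t k b f x.
Proof.
suff half y (u : fin_mx Fv) c : (forall v, Kloc sigma b (u v)) ->
    (exists (g : 'M[F]_2) (nu : 'I_h) (w : adele_mx (n := n) Fv),
      [/\ \det g != 0, Wgroup sigma b w,
        y = adele_mx_mul (adele_mx_mul (principal_mx sigma Fv g) (xNi t nu)) w &
        c = slash k w.1 (f nu) (const_mx 'i)]) ->
    (exists (g : 'M[F]_2) (nu : 'I_h) (w : adele_mx (n := n) Fv),
      [/\ \det g != 0, Wgroup sigma b w,
        (y.1, fun v => y.2 v *m u v) = adele_mx_mul (adele_mx_mul (principal_mx sigma Fv g) (xNi t nu)) w &
        c = slash k w.1 (f nu) (const_mx 'i)]).
  move=> Kw; rewrite /adelic_lift; congr (xget 0 _); rewrite eqEsubset; split=> c /=.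
    move=> /(half _ (fun v => invmx (w v)) _ (fun v => Kloc_inv (Kw v))) /=.
    have -> // : (x.1, fun v => x.2 v *m w v *m invmx (w v)) = x.
    case: x => x1 x2 /=; congr pair; apply: functional_extensionality_dep => v.
    by rewrite mulmxK //; exact: Kloc_unitmx (Kw v).
  exact: half.
move=> Ku [g [nu [w' [dg [dw Kw'] -> ->]]]]; exists g, nu, (w'.1, fun v => w'.2 v *m u v).
split=> //; first by split=> // v; exact: Kloc_mul.
congr pair; apply: functional_extensionality_dep => v /=; by rewrite mulmxA.
Qed.

(* The infinite part of this upper triangular adele sends [i] to [z]. *)
Lemma adelic_lift_upper (gamma beta : F) mu (a : fin_idele Fv) (z : 'rV[C]_n) :
  totally_positive sigma gamma -> gamma != 0 -> upper_half z ->
  (forall v, `|iota v gamma * a v|_v = (`|t mu v|_v)^-1) ->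
  adelic_lift sigma t k b f
    (fun j => mx2 (complex.Im (z 0 j)) (complex.Re (z 0 j)) 0 1,
     fun v => mx2 (a v) (- iota v (beta / gamma)) 0 1)
  = (\prod_j ((sigma j gamma * complex.Im (z 0 j)) `^ ((k j)%:R / 2)))%:C
    * f mu (\row_j ((sigma j gamma)%:C * z 0 j + (sigma j beta)%:C)).
Proof.
move=> gp g0 hz ga.
pose w : adele_mx (n := n) Fv :=
  (fun j => mx2 (sigma j gamma * complex.Im (z 0 j)) (sigma j gamma * complex.Re (z 0 j) + sigma j beta) 0 1,
   fun v => mx2 (t mu v * iota v gamma * a v) 0 0 1).
(* This is the inverse of (gamma beta; 0 1). Splitting it off on the left leaves an infinite part
   that sends i to gamma z + beta and a finite part in K. *)
pose g := mx2 gamma^-1 (- (beta / gamma)) 0 1.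
have dg : \det g != 0 by rewrite det_mx2 !mx2E mulr0 subr0 mulr1 invr_eq0.
have Ww : Wgroup sigma b w.
  split=> [j|v] /=.
    by rewrite det_mx2 !mx2E mulr0 subr0 mulr1 mulr_gt0 //; exact: hz.
  apply: Kloc_upper; rewrite ?cabs1 //; last exact: loc0.
  by rewrite -mulrA cabsM ga mulfV // cabs_neq0 class_rep_neq0.
have -> : (fun j => mx2 (complex.Im (z 0 j)) (complex.Re (z 0 j)) 0 1,
     fun v => mx2 (a v) (- iota v (beta / gamma)) 0 1) =
    adele_mx_mul (adele_mx_mul (principal_mx sigma Fv g) (xNi t mu)) w.
  congr pair; apply: functional_extensionality_dep => v /=.
    rewrite mulmx1 map_mx2 mulmx2 rmorph0 rmorph1 rmorphN !fmorph_div fmorphV.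
    have s0 : sigma v gamma != 0 by rewrite fmorph_eq0.
    by congr mx2; [field|field|ring|ring].
  have s0 : iota v gamma != 0 by rewrite fmorph_eq0.
  have t0 := class_rep_neq0 mu v.
  rewrite map_mx2 !mulmx2 rmorph0 rmorph1 rmorphN !fmorph_div fmorphV.
  by congr mx2; [field; rewrite s0|ring|ring|ring].
rewrite adelic_liftE // /slash; congr (_ * f _ _).
  rewrite rmorph_prod; apply: eq_bigr => j _ /=.
  rewrite /aut_factor det_mx2 !mx2E mulr0 subr0 mulr1 mul0r add0r.
  by rewrite rmorph1 expr1n invr1 mulr1.
apply/rowP => j; rewrite !mxE /aut_factor !mx2E mul0r add0r rmorph1 divr1 /=.
case: (z 0 j) => x y /=; apply/eqP; rewrite eq_complex /=; apply/andP; split; apply/eqP; ring.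
Qed.

End Lift.

(** * The Hecke operator at a good prime *)

Section Hecke.
Local Open Scope complex_scope.
Context {R : realType} {F : fieldExtType rat} {n : nat}.
Variable sigma : 'I_n -> {rmorphism F -> R}.
Hypothesis hF : totally_real_field sigma.
Local Notation O := (@ringO F).
Local Notation J := (codifferent sigma).
Local Notation D := (different sigma).
Local Notation C := R[i].
Variable Fv : forall v : fplace F, completion R (sval v).
Local Notation "`| x |_ v" := (cabs (Fv v) x)
  (at level 0, v at level 2, format "`| x |_ v").
Local Notation iota v := (cemb (Fv v)).
Variable b : set F.
Hypothesis hb : integral_ideal b.
Variable v0 : fplace F.
Local Notation p := (sval v0).
Hypothesis bv0 : exists2 a, b a & ~ p a.
Hypothesis Dv0 : exists2 a, D a & ~ p a.
Local Notation q := ((idealN p)%:R : R).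
Variable pi : F.
Hypothesis pi_norm : `|iota v0 pi|_v0 = q^-1.

Let bO : b `<=` O := let: And3 _ _ h := hb in h.
Let b0 : b 0. Proof. by have [[]] := hb. Qed.
Let DO : D `<=` O. Proof. by have [] := different_integral hF. Qed.
Let bDI : integral_ideal (idealM b D) := integral_idealM hb (different_integral hF).
Let bDO : idealM b D `<=` O. Proof. by have [] := bDI. Qed.
Let bD0 : idealM b D 0. Proof. by have [[h _ _] _ _] := bDI. Qed.
Let J0 : J 0. Proof. by have [] := codifferent_submodule sigma. Qed.
Let q0 : 0 < q. Proof. exact: lt_trans ltr01 (place_norm_gt1 hF (svalP v0)). Qed.

Definition unif : fin_idele Fv := fun v => if `[<v = v0>] then iota v pi else 1.

Lemma unif_at : unif v0 = iota v0 pi.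
Proof. by rewrite /unif; case: asboolP. Qed.

Lemma unif_off v : v <> v0 -> unif v = 1.
Proof. by rewrite /unif; case: asboolP. Qed.

Lemma unif_norm_at : `|unif v0|_v0 = q^-1.
Proof. by rewrite unif_at pi_norm. Qed.

Lemma unif_norm_off v : v <> v0 -> `|unif v|_v = 1.
Proof. by move=> /unif_off ->; rewrite cabs1. Qed.

Lemma unif_norm_le1 v : `|unif v|_v <= 1.
Proof.
have [->|/unif_norm_off -> //] := pselect (v = v0).
by rewrite unif_norm_at ltW // (place_norm_lt1 hF (svalP v0)).
Qed.

Lemma unif_neq0 v : unif v != 0.
Proof.
rewrite -(cabs_neq0 (c := Fv v)).
have [->|/unif_norm_off ->] := pselect (v = v0); last exact: oner_neq0.
by rewrite unif_norm_at invr_eq0 gt_eqF.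
Qed.

Lemma unif_almost_unit : almost_all (fun v => `|unif v|_v = 1).
Proof.
apply: (@sub_finite_set _ _ [set v0]); last exact: finite_set1.
by move=> v /= h; apply: contrapT => /unif_norm_off.
Qed.

Lemma loc_prime v x : @loc R F Fv p v x <-> `|x|_v <= `|unif v|_v.
Proof.
have [[[_ _ pM] _ pO] _ _] := svalP v0.
case: (pselect (v = v0)) x => [->|vv0] x.
  rewrite unif_norm_at; split.
    by move=> [y py xy]; apply: le_trans xy (cabs_prime hF (svalP v0) _ py).
  have [tau [rho [_ prho _ rhoE _]]] := cabs_uniformizer hF (svalP v0) (Fv v0).
  by exists rho; rewrite ?rhoE.
rewrite unif_norm_off //; split; first exact: (loc_integral hF).
move=> x1; have [z pz nvz] := places_separated hF (nesym vv0).
by apply: (loc_unit hF pO) x1; exists z.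
Qed.

Definition hecke_coset (y : fin_mx Fv) : set (fin_mx Fv) :=
  [set (fun v => g v *m y v) | g in [set g : fin_mx Fv | forall v, Kloc sigma b (g v)]].

Lemma hecke_coset_mem y : hecke_coset y y.
Proof.
exists (fun v => 1%:M) => [v|]; first exact: (Kloc1 hF _ hb).
by apply: functional_extensionality_dep => v; rewrite mul1mx.
Qed.

Lemma hecke_coset_eq (y y' g : fin_mx Fv) : (forall v, Kloc sigma b (g v)) ->
  (forall v, y' v = g v *m y v) -> hecke_coset y' = hecke_coset y.
Proof.
move=> Kg yE; rewrite eqEsubset; split=> _ [g' Kg' <-].
  exists (fun v => g' v *m g v) => [v|]; first exact: (Kloc_mul hF hb).
  by apply: functional_extensionality_dep => v; rewrite yE mulmxA.
exists (fun v => g' v *m invmx (g v)) => [v|].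
  by apply: (Kloc_mul hF hb) => //; exact: Kloc_inv.
apply: functional_extensionality_dep => v; rewrite yE mulmxA mulmxKV //.
exact: Kloc_unitmx (Kg v).
Qed.

Definition upper_rep (s : fin_idele Fv) : fin_mx Fv := fun v => mx2 1 (s v) 0 (unif v).
Definition lower_rep : fin_mx Fv := fun v => mx2 (unif v) 0 0 1.

Let detE v (y : 'M[Fv v]_2) : `|\det y|_v = `|unif v|_v ->
  [set x | `|x|_v <= `|\det y|_v] = @loc R F Fv p v.
Proof. by move=> ->; rewrite eqEsubset; split=> x /loc_prime. Qed.

Lemma hecke_cosets_upper s : (forall v, loc J (s v)) ->
  hecke_cosets sigma b p (hecke_coset (upper_rep s)).
Proof.
move=> Js; exists (upper_rep s); split=> // v; last first.
  by apply: detE; rewrite det_mx2 !mx2E mul1r mulr0 subr0.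
split; rewrite ?mx2E ?cabs1 ?unif_norm_le1 //; first exact: loc0.
  by rewrite det_mx2 !mx2E mul1r mulr0 subr0 unif_neq0.
by exists 1, 0; split; rewrite ?cabs1 ?mulr1 ?addr0 //; exact: loc0.
Qed.

Lemma hecke_cosets_lower : hecke_cosets sigma b p (hecke_coset lower_rep).
Proof.
exists lower_rep; split=> // v; last first.
  by apply: detE; rewrite det_mx2 !mx2E mulr1 mulr0 subr0.
split; rewrite ?mx2E ?cabs1 ?unif_norm_le1 //; try exact: loc0.
  by rewrite det_mx2 !mx2E mulr1 mulr0 subr0 unif_neq0.
have [->|vv0] := pselect (v = v0).
  (* At v0 the ideal b is locally the unit ideal, so the entry pi is a unit modulo b_v. *)
  exists 0, 1; split; rewrite ?cabs0 ?mulr0 ?add0r //.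
  by apply: (loc_unit hF bO); rewrite ?cabs1.
by exists 1, 0; split; rewrite ?cabs1 ?mulr1 ?addr0 ?unif_off //; exact: loc0.
Qed.

Lemma hecke_coset_upper_lower s : hecke_coset (upper_rep s) <> hecke_coset lower_rep.
Proof.
move=> E; have := hecke_coset_mem lower_rep; rewrite -E => -[g Kg gE].
have := congr1 (@^~ v0) gE; rewrite /lower_rep /upper_rep /= => gE0.
have := congr1 (fun A : 'M[Fv v0]_2 => A 1 0) gE0; rewrite mulmx2E !mx2E mulr0 addr0 mulr1 => g10.
have := congr1 (fun A : 'M[Fv v0]_2 => A 1 1) gE0; rewrite mulmx2E !mx2E g10 mul0r add0r => g11.
have [_ g11le _ _ _] := Kg v0.
have : `|(1 : Fv v0)|_v0 <= q^-1.
  by rewrite -g11 cabsM unif_norm_at ler_piMl // invr_ge0 ltW.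
by rewrite cabs1 leNgt (place_norm_lt1 hF (svalP v0)).
Qed.

(* At v0 the group K is GL_2(O_v0). *)
Lemma Kloc_at (g : 'M[Fv v0]_2) : (forall i j, `|g i j|_v0 <= 1) -> `|\det g|_v0 = 1 ->
  Kloc sigma b g.
Proof.
move=> g1 dg; split=> //; first exact: loc_codifferent1.
apply: (loc_unit hF bDO) => //.
have [a ba npa] := bv0; have [d Dd npd] := Dv0.
exists (a * d); first exact: idealM_mem.
have [_ _ pP] := svalP v0.
by move=> /(pP _ _ (bO ba) (DO Dd))[].
Qed.

Lemma Kloc_mx2 (x y z w : Fv v0) : `|x|_v0 <= 1 -> `|y|_v0 <= 1 -> `|z|_v0 <= 1 ->
  `|w|_v0 <= 1 -> `|x * w - y * z|_v0 = 1 -> Kloc sigma b (mx2 x y z w).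
Proof.
move=> x1 y1 z1 w1 d1; apply: Kloc_at; last by rewrite det_mx2 !mx2E.
by move=> i j; rewrite mxE; do 2!case: ifP => _.
Qed.

Lemma unif_divides (x : Fv v0) : `|x|_v0 <= q^-1 -> `|x / unif v0|_v0 <= 1.
Proof.
by move=> xq; rewrite cabsM cabsV unif_norm_at ler_pdivrMr ?mul1r // invr_gt0.
Qed.

(** Modulo pi the second column of y is s times the first, so y (1 s; 0 pi)^-1 is integral; its
    determinant is a unit. *)
Lemma upper_divides (y : 'M[Fv v0]_2) (s : Fv v0) : (forall i j, `|y i j|_v0 <= 1) ->
  `|\det y|_v0 = q^-1 ->
  `|y 0 1 - y 0 0 * s|_v0 <= q^-1 -> `|y 1 1 - y 1 0 * s|_v0 <= q^-1 ->
  exists2 g, Kloc sigma b g & y = g *m mx2 1 s 0 (unif v0).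
Proof.
move=> y1 dy h1 h2; have u0 := unif_neq0 v0.
exists (mx2 (y 0 0) ((y 0 1 - y 0 0 * s) / unif v0) (y 1 0) ((y 1 1 - y 1 0 * s) / unif v0)).
  apply: Kloc_mx2 => //; try exact: unif_divides.
  have -> : y 0 0 * ((y 1 1 - y 1 0 * s) / unif v0) - (y 0 1 - y 0 0 * s) / unif v0 * y 1 0
     = \det y / unif v0 by rewrite det_mx2; field.
  by rewrite cabsM cabsV dy unif_norm_at mulfV // invr_eq0 gt_eqF.
by rewrite mulmx2 [LHS]mx2_eta; congr mx2; field.
Qed.

Variables (S : seq F) (s1 : fin_idele Fv).
Hypothesis SO : forall o, o \in S -> O o.
Hypothesis Sres : forall x, O x -> exists2 o, o \in S & p (x - o).
Hypothesis Js1 : forall v, loc J (s1 v).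
Hypothesis s1_unit : `|s1 v0|_v0 = 1.

(** All upper right entries are multiples, by elements [o] of F, of one idele [s1]. In
    [hecke_relation] this makes them come from global translations beta. *)
Definition residue_idele (o : F) : fin_idele Fv := fun v => iota v o * s1 v.

Lemma residue_idele_loc o v : O o -> loc J (residue_idele o v).
Proof. by move=> Oo; apply: locMl => //; exact: (cabs_ringO hF (svalP v)). Qed.

Lemma residue_idele_approx (x : Fv v0) : `|x|_v0 <= 1 ->
  exists2 o, o \in S & `|x - residue_idele o v0|_v0 <= q^-1.
Proof.
move=> x1; have s10 : s1 v0 != 0 by rewrite -(cabs_neq0 (c := Fv v0)) s1_unit oner_neq0.
have /(integers_dense hF (svalP v0))[y Oy xy] : `|x / s1 v0|_v0 <= 1.
  by rewrite cabsM cabsV s1_unit invr1 mulr1.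
have [r So py] := Sres Oy; exists r => //.
have -> : x - residue_idele r v0 = (x / s1 v0 - iota v0 y + iota v0 (y - r)) * s1 v0.
  by rewrite rmorphB /residue_idele; field.
rewrite cabsM s1_unit mulr1; apply: cabsD_le => //.
exact: (cabs_prime hF (svalP v0)).
Qed.

(** Away from v0, y lies in K. At v0 its determinant vanishes modulo pi. If the first column
    contains a unit, the second column is a multiple of the first modulo pi and [upper_divides]
    applies; otherwise pi divides the first column and can be split off as (pi 0; 0 1). *)
Lemma hecke_cosets_split A : hecke_cosets sigma b p A ->
  A = hecke_coset lower_rep \/
  exists2 o, o \in S & A = hecke_coset (upper_rep (residue_idele o)).
Proof.
move=> [y [Yy dy ->]].
have dyn v : `|\det (y v)|_v = `|unif v|_v.
  have E (x : Fv v) : (`|x|_v <= `|\det (y v)|_v) <-> (`|x|_v <= `|unif v|_v).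
    by rewrite -loc_prime -(dy v).
  by apply/eqP; rewrite eq_le; apply/andP; split; apply/E.
have yint i j : `|y v0 i j|_v0 <= 1.
  have [[y00 y11] y01 y10 _ _] := Yy v0.
  have y01' := loc_codifferent_le1 hF Dv0 y01.
  have y10' := loc_integral hF bDO y10.
  by rewrite (mx2_eta (y v0)) mxE; do 2!case: ifP => _.
have Koff v : v <> v0 -> Kloc sigma b (y v).
  move=> vv0; have [[y00 y11] y01 y10 _ _] := Yy v.
  by split=> //; rewrite dyn unif_norm_off.
have Kinv v (z : fin_mx Fv) : v <> v0 -> Kloc sigma b (z v) -> Kloc sigma b (y v *m invmx (z v)).
  by move=> vv0 Kz; apply: (Kloc_mul hF hb); [exact: Koff|exact: Kloc_inv].
(* Away from v0 both y and its representative z lie in K. *)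
have glue (z : fin_mx Fv) : (forall v, v <> v0 -> Kloc sigma b (z v)) ->
    (exists2 g, Kloc sigma b g & y v0 = g *m z v0) -> hecke_coset y = hecke_coset z.
  move=> Kz [g Kg yg].
  have ex v : exists g : 'M[Fv v]_2, Kloc sigma b g /\ y v = g *m z v.
    have [->|vv0] := pselect (v = v0); first by exists g.
    exists (y v *m invmx (z v)); split; first by apply: Kinv => //; exact: Kz.
    by rewrite mulmxKV //; exact: Kloc_unitmx (Kz v vv0).
  by apply: (@hecke_coset_eq _ _ (fun v => projT1 (cid (ex v)))) => v; case: (projT2 (cid (ex v))).
have Kupper s v : v <> v0 -> loc J (s v) -> Kloc sigma b (upper_rep s v).
  by move=> vv0 Js; apply: (Kloc_upper hF hb); rewrite ?cabs1 // unif_norm_off.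
have upper (s : Fv v0) : `|s|_v0 <= 1 ->
    `|y v0 0 1 - y v0 0 0 * s|_v0 <= q^-1 -> `|y v0 1 1 - y v0 1 0 * s|_v0 <= q^-1 ->
    exists2 o, o \in S & hecke_coset y = hecke_coset (upper_rep (residue_idele o)).
  move=> s1' h1 h2; have [r Sr sr] := residue_idele_approx s1'.
  exists r => //; apply: glue => [v vv0|].
    by apply: Kupper => //; exact: residue_idele_loc (SO Sr).
  have E i : `|y v0 i 1 - y v0 i 0 * s|_v0 <= q^-1 ->
      `|y v0 i 1 - y v0 i 0 * residue_idele r v0|_v0 <= q^-1.
    move=> h; have -> : y v0 i 1 - y v0 i 0 * residue_idele r v0 =
      (y v0 i 1 - y v0 i 0 * s) + y v0 i 0 * (s - residue_idele r v0) by ring.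
    apply: cabsD_le => //; rewrite cabsM; apply: le_trans sr.
    by rewrite ler_piMl // cabs_ge0.
  by apply: upper_divides => //; [rewrite dyn unif_norm_at|exact: E|exact: E].
have dq : `|y v0 0 0 * y v0 1 1 - y v0 0 1 * y v0 1 0|_v0 <= q^-1.
  by rewrite -det_mx2 dyn unif_norm_at.
have nz i : `|y v0 i 0|_v0 = 1 -> y v0 i 0 != 0.
  by move=> h; rewrite -(cabs_neq0 (c := Fv v0)) h oner_neq0.
have [a1|a1] := eqVneq (`|y v0 0 0|_v0) 1.
  right; apply: (upper (y v0 0 1 / y v0 0 0)).
  - by rewrite cabsM cabsV a1 invr1 mulr1.
  - by rewrite mulrC divfK ?nz // subrr cabs0 invr_ge0 ltW.
  - have -> : y v0 1 1 - y v0 1 0 * (y v0 0 1 / y v0 0 0) =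
      (y v0 0 0 * y v0 1 1 - y v0 0 1 * y v0 1 0) / y v0 0 0 by field; rewrite nz.
    by rewrite cabsM cabsV a1 invr1 mulr1.
have [c1|c1] := eqVneq (`|y v0 1 0|_v0) 1.
  right; apply: (upper (y v0 1 1 / y v0 1 0)).
  - by rewrite cabsM cabsV c1 invr1 mulr1.
  - have -> : y v0 0 1 - y v0 0 0 * (y v0 1 1 / y v0 1 0) =
      - (y v0 0 0 * y v0 1 1 - y v0 0 1 * y v0 1 0) / y v0 1 0 by field; rewrite nz.
    by rewrite cabsM cabsV c1 invr1 mulr1 cabsN.
  - by rewrite mulrC divfK ?nz // subrr cabs0 invr_ge0 ltW.
left; apply: glue => [v vv0|].
  by apply: (Kloc_upper hF hb); rewrite ?cabs1 ?unif_norm_off //; exact: loc0.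
have lt1 i : `|y v0 i 0|_v0 != 1 -> `|y v0 i 0|_v0 <= q^-1.
  by move=> h; apply: (cabs_lt1 hF (svalP v0)); rewrite lt_neqAle h yint.
have u0 := unif_neq0 v0.
exists (mx2 (y v0 0 0 / unif v0) (y v0 0 1) (y v0 1 0 / unif v0) (y v0 1 1)).
  apply: Kloc_mx2 => //; try by apply: unif_divides; exact: lt1.
  have -> : y v0 0 0 / unif v0 * y v0 1 1 - y v0 0 1 * (y v0 1 0 / unif v0)
     = \det (y v0) / unif v0 by rewrite det_mx2; field.
  by rewrite cabsM cabsV dyn mulfV // cabs_neq0.
by rewrite mulmx2 [LHS]mx2_eta; congr mx2; field.
Qed.

End Hecke.

Lemma adj_mulmx2 (K : fieldType) (A B : 'M[K]_2) : \adj (A *m B) = \adj B *m \adj A.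
Proof. by rewrite !adj_mx2 mulmx2 !mulmx2E; congr mx2; ring. Qed.

(** * The eigenvalue equation on the components of the form *)

Section HeckeRelation.
Local Open Scope complex_scope.
Context {R : realType} {F : fieldExtType rat} {n : nat}.
Variable sigma : 'I_n -> {rmorphism F -> R}.
Hypothesis hF : totally_real_field sigma.
Local Notation O := (@ringO F).
Local Notation J := (codifferent sigma).
Local Notation D := (different sigma).
Local Notation C := R[i].
Variable Fv : forall v : fplace F, completion R (sval v).
Local Notation "`| x |_ v" := (cabs (Fv v) x)
  (at level 0, v at level 2, format "`| x |_ v").
Local Notation iota v := (cemb (Fv v)).
Variable b : set F.
Hypothesis hb : integral_ideal b.
Variables (h : nat) (t : 'I_h -> fin_idele Fv).
Hypothesis ht : narrow_class_reps sigma t.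
Variables (k : 'I_n -> nat) (f : 'I_h -> 'rV[C]_n -> C).
Hypothesis hf : cusp_form sigma t k b f.

Local Notation phi := (adelic_lift sigma t k b f).

(** The representative picked from the coset does not matter: the adjugate reverses products, so a
    left factor in K becomes a right factor, under which the lift is invariant. *)
Lemma hecke_coset_value (y : fin_mx Fv) (x : adele_mx (n := n) Fv) :
  xget 0 [set c | exists2 y', hecke_coset sigma b y y' &
    c = phi (x.1, fun v => x.2 v *m \adj (y' v))] =
  phi (x.1, fun v => x.2 v *m \adj (y v)).
Proof.
apply: xget_unique => [|c /=]; first by exists y => //; exact: (hecke_coset_mem hF).
move=> [_ [g Kg <-] ->].
have -> : (x.1, fun v => x.2 v *m \adj (g v *m y v)) =
    ((x.1, fun v => x.2 v *m \adj (y v)).1,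
     fun v => (x.1, fun v => x.2 v *m \adj (y v)).2 v *m \adj (g v)).
  by congr pair; apply: functional_extensionality_dep => v /=; rewrite adj_mulmx2 mulmxA.
by rewrite (adelic_lift_Kloc hF hb) // => v; exact: Kloc_adj.
Qed.

(** This is gamma^(k/2) in multi-index notation. *)
Definition norm_factor (gamma : F) : R := \prod_j (sigma j gamma `^ ((k j)%:R / 2)).

Variable v0 : fplace F.
Local Notation p := (sval v0).
Hypothesis bv0 : exists2 a, b a & ~ p a.
Hypothesis Dv0 : exists2 a, D a & ~ p a.
Local Notation q := ((idealN p)%:R : R).
Variable pi : F.
Hypothesis pi_norm : `|iota v0 pi|_v0 = q^-1.
Local Notation u := (unif Fv v0 pi).

(** Cosets are counted rather than residues, because a list of residues modulo an element of p can
    contain several representatives of one class modulo p. *)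
Definition upper_count : nat :=
  #|` fset_set (hecke_cosets sigma b p `\ hecke_coset sigma b (lower_rep Fv v0 pi))|%fset.

Variable lambda : C.
Hypothesis eigen : forall x, GL2A x -> heckeT sigma b p phi x = lambda * phi x.

(** The eigenvalue equation is evaluated at the adele that is x_nu^{-iota} at the finite places and
    sends i to z at infinity. Here mu and mu' are the classes of t_nu / u and t_nu u, with gamma and
    gamma' realizing the equivalences. By [adelic_lift_upper] the cosets of (1 s; 0 pi) give [f mu]
    at gamma z + beta, and that of (pi 0; 0 1) gives [f mu'] at gamma' z. *)
Theorem hecke_relation nu mu mu' (gamma gamma' : F) :
  totally_positive sigma gamma -> gamma != 0 ->
  totally_positive sigma gamma' -> gamma' != 0 ->
  (forall v, `|iota v gamma * ((t nu v)^-1 * u v)|_v = (`|t mu v|_v)^-1) ->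
  (forall v, `|iota v gamma' * ((t nu v)^-1 * (u v)^-1)|_v = (`|t mu' v|_v)^-1) ->
  exists l : seq F, [/\ l != [::], size l = upper_count,
    forall beta, beta \in l -> forall v, loc J (iota v (beta / gamma) * t nu v) &
    forall z, upper_half z -> lambda * f nu z =
      (norm_factor gamma)%:C * (\sum_(beta <- l)
        f mu (\row_j ((sigma j gamma)%:C * z 0 j + (sigma j beta)%:C)))
      + (norm_factor gamma')%:C * f mu' (\row_j ((sigma j gamma')%:C * z 0 j))].
Proof.
move=> gp g0 gp' g0' gmu gmu'.
have tn0 v : t nu v != 0 by exact: (class_rep_neq0 ht).
have u0 v : u v != 0 by exact: (unif_neq0 hF).
have [_ [a pa a0] pO] : integral_ideal p by have [] := svalP v0.
have [[_ _ pM] _ _] : integral_ideal p by have [] := svalP v0.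
have [S [SO SP]] := ringO_residues hF (pO _ pa) a0.
have Sres x : O x -> exists2 y, y \in S & p (x - y).
  by move=> /SP[y yS [z Oz xy]]; exists y => //; rewrite xy mulrC; exact: pM.
(* With this [beta0] the idele [s1] below is a unit at v0 and integral everywhere, as
   [hecke_cosets_split] requires. *)
have [||beta0 [b0v b0le]] := @prescribed_norm _ _ _ sigma hF Fv (fun v => iota v gamma * (t nu v)^-1) v0.
- by move=> v; apply: mulf_neq0; rewrite ?invr_eq0 ?fmorph_eq0 //; exact: tn0.
- have : finite_set ([set v | ~ (`|iota v gamma|_v = 1)] `|` [set v | ~ (`|t nu v|_v = 1)]).
    rewrite finite_setU; split; first exact: (almost_all_unit hF Fv g0).
    exact: (class_rep_almost_unit ht).
  apply: sub_finite_set => v /= hv; apply/not_andP => -[h1 h2]; apply: hv.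
  by rewrite cabsM cabsV h1 h2 invr1 mulr1.
pose s1 : fin_idele Fv := fun v => iota v (beta0 / gamma) * t nu v.
have s1E v : `|s1 v|_v = `|iota v beta0|_v / `|iota v gamma * (t nu v)^-1|_v.
  by rewrite /s1 fmorph_div !cabsM !cabsV invfM invrK mulrA.
have gn v : 0 < `|iota v gamma * (t nu v)^-1|_v.
  by rewrite cabs_gt0; apply: mulf_neq0; rewrite ?invr_eq0 ?fmorph_eq0 //; exact: tn0.
have Js1 v : loc J (s1 v).
  by apply: (loc_codifferent1 hF); rewrite s1E ler_pdivrMr ?mul1r.
have s1u : `|s1 v0|_v0 = 1 by rewrite s1E b0v mulfV // gt_eqF.
pose H := hecke_cosets sigma b p : set (set (fin_mx Fv)).
pose Ainf := hecke_coset sigma b (lower_rep Fv v0 pi).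
pose Aup r := hecke_coset sigma b (upper_rep v0 pi (residue_idele s1 r)).
have Hsplit A : H A -> A = Ainf \/ exists2 r, r \in S & A = Aup r.
  exact: (hecke_cosets_split hF hb bv0 Dv0 pi_norm SO Sres Js1 s1u).
have Hinf : H Ainf by exact: (hecke_cosets_lower hF).
have Hup r : r \in S -> H (Aup r).
  by move=> rS; apply: (hecke_cosets_upper hF) => // v; apply: (residue_idele_loc hF) => //; exact: SO.
have Hfin : finite_set H.
  apply: (@sub_finite_set _ _ (Ainf |` (Aup @` [set` S]))).
    by move=> A /Hsplit[->|[r rS ->]]; [left|right; exists r].
  rewrite finite_setU; split; first exact: finite_set1.
  by apply: finite_image; exact: finite_seq.
pose rep A := xget 0 [set r | r \in S /\ A = Aup r].
have repP A : A \in fset_set (H `\ Ainf) -> rep A \in S /\ A = Aup (rep A).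
  rewrite in_fset_set; last exact: finite_setD.
  rewrite inE => -[/Hsplit[//|[r rS Ar]] _].
  by apply: (@xgetPex _ 0 [set r | r \in S /\ A = Aup r]); exists r.
exists [seq rep A * beta0 | A <- fset_set (H `\ Ainf)]; split.
- have [r rS _] := Sres 0 (ringO0).
  have : Aup r \in fset_set (H `\ Ainf).
    rewrite in_fset_set; last exact: finite_setD.
    by rewrite inE; split; [exact: Hup|exact: (hecke_coset_upper_lower hF)].
  by move=> /(map_f (fun A => rep A * beta0)); case: [seq _ | _ <- _].
- by rewrite size_map.
- move=> _ /mapP[A /repP[rS _] ->] v.
  have -> : iota v (rep A * beta0 / gamma) * t nu v = residue_idele s1 (rep A) v.
    by rewrite /residue_idele /s1 -mulrA rmorphM mulrA.
  by apply: (residue_idele_loc hF) => //; exact: SO.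
move=> z hz.
pose x : adele_mx (n := n) Fv := (fun j => mx2 (complex.Im (z 0 j)) (complex.Re (z 0 j)) 0 1,
     fun v => mx2 (t nu v)^-1 0 0 1).
have upper1 (y w : R) : 0 < y -> mx2 y w 0 1 \in unitmx.
  by move=> y0; rewrite unitmxE unitfE det_mx2 !mx2E mulr0 subr0 mulr1 gt_eqF.
have GLdiag (d : fin_idele Fv) : (forall v, d v != 0) -> almost_all (fun v => `|d v|_v = 1) ->
    GL2A (x.1, fun v => mx2 (d v) 0 0 1).
  move=> d0 d1; split=> /= [j|v|]; first by apply: upper1; exact: hz.
    by rewrite unitmxE unitfE det_mx2 !mx2E mulr0 subr0 mulr1.
  apply: sub_finite_set d1 => v /= hv dv; apply: hv; split.
    by move=> i j; rewrite mxE; do 2!case: ifP => _; rewrite ?dv ?cabs0 ?cabs1.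
  by rewrite det_mx2 !mx2E mulr0 subr0 mulr1.
have tV1 : almost_all (fun v => `|(t nu v)^-1|_v = 1).
  apply: sub_finite_set (class_rep_almost_unit ht nu) => v /= hv tv.
  by apply: hv; rewrite cabsV tv invr1.
have GLx : GL2A x by apply: GLdiag => // v; rewrite invr_eq0; exact: tn0.
pose yk := \prod_j (complex.Im (z 0 j) `^ ((k j)%:R / 2)) : R.
have yk0 : yk != 0.
  by apply/prodf_neq0 => j _; rewrite gt_eqF // powR_gt0 //; exact: hz.
have factor g : totally_positive sigma g ->
    \prod_j ((sigma j g * complex.Im (z 0 j)) `^ ((k j)%:R / 2)) = norm_factor g * yk.
  move=> gp0; rewrite /norm_factor /yk -big_split /=; apply: eq_bigr => j _.
  by rewrite powRM // ltW //; exact: hz.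
have phix : phi x = yk%:C * f nu z.
  have := @adelic_lift_upper _ _ _ _ hF Fv _ hb _ _ ht k f hf 1 0 nu (fun v => (t nu v)^-1) z.
  rewrite factor; last by move=> j; rewrite rmorph1.
  have -> : norm_factor 1 = 1 by rewrite /norm_factor big1 // => j _; rewrite rmorph1 powR1.
  rewrite mul1r; have -> : (\row_j ((sigma j 1)%:C * z 0 j + (sigma j 0)%:C)) = z.
    by apply/rowP => j; rewrite mxE rmorph1 rmorph0 rmorph1 mul1r addr0.
  move=> <- //; last by move=> v; rewrite rmorph1 mul1r cabsV.
  - congr (phi (_, _)); apply: functional_extensionality_dep => v.
    by rewrite mul0r rmorph0 oppr0.
  - by move=> j; rewrite rmorph1.
  - exact: oner_neq0.
pose val A := xget 0 [set c | exists2 y, A y & c = phi (x.1, fun v => x.2 v *m \adj (y v))].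
have valup r : val (Aup r) = (norm_factor gamma * yk)%:C *
    f mu (\row_j ((sigma j gamma)%:C * z 0 j + (sigma j (r * beta0))%:C)).
  rewrite /val hecke_coset_value -factor //.
  rewrite -(@adelic_lift_upper _ _ _ _ hF Fv _ hb _ _ ht k f hf gamma (r * beta0) mu
    (fun v => (t nu v)^-1 * u v) z) //.
  congr (phi (_, _)); apply: functional_extensionality_dep => v /=.
  rewrite adj_mx2 !mx2E mulmx2 /residue_idele /s1; congr mx2; try ring.
  by rewrite -[r * _ / _]mulrA rmorphM; field; rewrite fmorph_eq0 g0; exact: tn0.
have valinf : val Ainf = (norm_factor gamma' * yk)%:C *
    f mu' (\row_j ((sigma j gamma')%:C * z 0 j)).
  rewrite /val hecke_coset_value -factor //.
  have -> : \row_j ((sigma j gamma')%:C * z 0 j) =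
      \row_j ((sigma j gamma')%:C * z 0 j + (sigma j 0)%:C).
    by apply/rowP => j; rewrite !mxE !rmorph0 addr0.
  rewrite -(@adelic_lift_upper _ _ _ _ hF Fv _ hb _ _ ht k f hf gamma' 0 mu'
    (fun v => (t nu v)^-1 * (u v)^-1) z) //.
  (* The coset of (pi 0; 0 1) leads to diag(t^-1, u), which is u times diag(t^-1 u^-1, 1).
     Invariance under the center, that is, trivial nebentypus, removes the scalar u. *)
  pose su : idele Fv := (fun j : 'I_n => 1, u).
  have su_idele : is_idele su.
    split=> /= [j|v|]; [exact: oner_neq0|exact: u0|exact: unif_almost_unit].
  pose x' : adele_mx (n := n) Fv := (x.1, fun v => mx2 ((t nu v)^-1 * (u v)^-1) 0 0 1).
  have GLx' : GL2A x'.
    apply: GLdiag => [v|]; first by apply: mulf_neq0; rewrite invr_eq0; [exact: tn0|exact: u0].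
    have : finite_set ([set v | ~ (`|(t nu v)^-1|_v = 1)] `|` [set v | ~ (`|u v|_v = 1)]).
      by rewrite finite_setU; split=> //; exact: unif_almost_unit.
    apply: sub_finite_set => v /= hv; apply/not_andP => -[h1 h2]; apply: hv.
    by rewrite cabsM h1 cabsV h2 invr1 mulr1.
  have := cusp_form_center hf su_idele GLx'.
  have -> : adele_mx_scale su x' = (x.1, fun v => x.2 v *m \adj (lower_rep Fv v0 pi v)).
    congr pair; apply: functional_extensionality_dep => v /=; first by rewrite scale1r.
    rewrite scale_mx2 /lower_rep adj_mx2 !mx2E mulmx2; congr mx2; try ring.
    by field; rewrite u0 tn0.
  move=> ->; congr (phi (_, _)); apply: functional_extensionality_dep => v /=.
  by rewrite mul0r rmorph0 oppr0.
have := eigen GLx; rewrite phix /heckeT.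
rewrite -[X in X = _]/(\sum_(A \in H) val A) (fsbigD1 Ainf) //=.
rewrite valinf fsbig_finite /=; last exact: finite_setD.
rewrite big_seq (eq_bigr (fun A => (norm_factor gamma * yk)%:C *
    f mu (\row_j ((sigma j gamma)%:C * z 0 j + (sigma j (rep A * beta0))%:C)))); last first.
  by move=> A /repP[_ {1}->]; exact: valup.
rewrite -big_seq -mulr_sumr big_map => E.
have ykC : yk%:C != 0 :> C by rewrite fmorph_eq0.
apply: (mulfI ykC).
rewrite mulrCA -E !rmorphM /=; ring.
Qed.

End HeckeRelation.

(** * Fourier expansions *)

Section Exponential.
Local Open Scope complex_scope.
Context {R : realType}.
Local Notation C := R[i].

Lemma cexpD (w z : C) : cexp (w + z) = cexp w * cexp z.
Proof.
case: w z => [a b] [c d]; rewrite /cexp /= expRD cosD sinD.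
by apply/eqP; rewrite eq_complex /=; apply/andP; split; apply/eqP; ring.
Qed.

Lemma cexp0 : cexp 0 = 1 :> C.
Proof. by rewrite /cexp /= expR0 cos0 sin0; apply/eqP; rewrite eq_complex /=; apply/andP; split; apply/eqP; ring. Qed.

Lemma cexp_neq0 (w : C) : cexp w != 0.
Proof.
have : cexp w * cexp (- w) != 0 by rewrite -cexpD subrr cexp0 oner_neq0.
by rewrite mulf_eq0 negb_or => /andP[].
Qed.

Definition ee (w : C) : C := cexp ((2 * pi)%:C * 'i * w).

Lemma eeD (w z : C) : ee (w + z) = ee w * ee z.
Proof. by rewrite /ee mulrDr cexpD. Qed.

Lemma ee0 : ee 0 = 1. Proof. by rewrite /ee mulr0 cexp0. Qed.

Lemma ee_neq0 (w : C) : ee w != 0. Proof. exact: cexp_neq0. Qed.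

Lemma ee_real (r : R) : ee r%:C = cos (2 * pi * r) +i* sin (2 * pi * r).
Proof.
have E : (2 * pi)%:C * 'i * r%:C = 0 +i* (2 * pi * r) :> C.
  by apply/eqP; rewrite eq_complex /=; apply/andP; split; apply/eqP; ring.
rewrite /ee E /cexp /= expR0.
by apply/eqP; rewrite eq_complex /=; apply/andP; split; apply/eqP; ring.
Qed.

Lemma norm_ee_real (r : R) : `|ee r%:C| = 1.
Proof. by rewrite ee_real normc_def /= cos2Dsin2 sqrtr1. Qed.

Lemma ee_half : ee (1 / 2)%:C = - 1.
Proof.
rewrite ee_real mulrAC div1r mulfV ?pnatr_eq0 // mul1r cospi sinpi.
by apply/eqP; rewrite eq_complex /= oppr0 !eqxx.
Qed.

Lemma ee_int (r : R) : r \is a Num.int -> ee r%:C = 1.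
Proof.
have ee1 : ee 1%:C = 1.
  have -> : (1 : R)%:C = (1 / 2)%:C + (1 / 2)%:C by rewrite -rmorphD -splitr.
  by rewrite eeD ee_half mulrNN mulr1.
have een m : ee (m%:R : R)%:C = 1.
  elim: m => [|m IH]; first by rewrite rmorph0 ee0.
  by rewrite -natr1 rmorphD eeD IH ee1 mulr1.
case/intrP => -[m|m] ->; first exact: een.
rewrite NegzE mulrNz rmorphN -[LHS]mulr1 -{1}(een m.+1) -eeD.
by rewrite -pmulrn addNr ee0.
Qed.

(** For the fractional part s of r, cos(2 pi s) = 1 forces sin(pi s) = 0, whereas the sine is
    positive strictly between 0 and pi. *)
Lemma ee_eq1 (r : R) : ee r%:C = 1 -> r \is a Num.int.
Proof.
move=> r1; pose m := Num.floor r; have /andP[mr rm] := floor_itv r.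
pose s := r - m%:~R.
have s1 : ee s%:C = 1.
  have -> : s%:C = r%:C + (- m%:~R : R)%:C by rewrite -rmorphD.
  by rewrite eeD r1 mul1r ee_int // rpredN intr_int.
have s01 : 0 <= s < 1.
  by rewrite /s subr_ge0 mr ltrBlDl; move: rm; rewrite intrD.
suff s0 : s = 0 by rewrite -(subrK m%:~R r) -/s s0 add0r intr_int.
apply/eqP; apply: contraTT isT => sn0.
have sp : 0 < s by rewrite lt_neqAle eq_sym sn0; case/andP: s01.
have : sin (pi * s) != 0.
  rewrite gt_eqF // sin_gt0_pi // mulr_gt0 ?pi_gt0 //=.
  by rewrite gtr_pMr ?pi_gt0 //; case/andP: s01.
move: s1; rewrite ee_real => /eqP; rewrite eq_complex /= => /andP[/eqP c1 _].
have : cos (pi * s *+ 2) = 1 by rewrite -c1; congr cos; rewrite -mulr_natl mulrA.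
rewrite cos_mulr2n cos2sin2 => h.
have : sin (pi * s) ^+ 2 = 0 by lra.
by move=> /eqP; rewrite sqrf_eq0 => /eqP ->; rewrite eqxx.
Qed.

End Exponential.

(** * Unconditional sums and almost periodic functions *)

Section HasSum.
Local Open Scope complex_scope.
Context {R : realType} {I : choiceType}.
Local Notation C := R[i].
Implicit Types (a : I -> C) (s : C).

Lemma has_sum_ext a a' s : (forall x, a x = a' x) -> has_sum a s -> has_sum a' s.
Proof. by move=> /funext ->. Qed.

Lemma has_sum0 : has_sum (fun _ : I => 0 : C) 0.
Proof.
by move=> e e0; exists fset0 => B _; rewrite big1 // subrr normr0 ltcR.
Qed.

Lemma has_sumD a a' s s' : has_sum a s -> has_sum a' s' -> has_sum (fun x => a x + a' x) (s + s').
Proof.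
move=> sa sa' e e0; have e2 : 0 < e / 2 by rewrite divr_gt0.
have [A hA] := sa _ e2; have [A' hA'] := sa' _ e2.
exists (A `|` A')%fset => B /fsubUsetP[AB AB'].
rewrite big_split /= opprD addrACA; apply: le_lt_trans (ler_normD _ _) _.
by rewrite (splitr e) rmorphD ltrD ?hA ?hA'.
Qed.

Lemma has_sumZ (c : C) a s : has_sum a s -> has_sum (fun x => c * a x) (c * s).
Proof.
move=> sa e e0; have [cr cE] : exists r : R, `|c| = r%:C.
  by rewrite normc_def; eexists.
have cr0 : 0 <= cr by rewrite -lecR -cE normr_ge0.
have e1 : 0 < e / (cr + 1) by rewrite divr_gt0 // ltr_wpDl.
have [A hA] := sa _ e1; exists A => B /hA.
rewrite -mulr_sumr -mulrBr normrM cE => h.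
apply: (@le_lt_trans _ _ ((cr + 1)%:C * `|\sum_(x <- B) a x - s|)).
  by rewrite ler_wpM2r ?normr_ge0 // lecR lerDl.
have cr1 : 0 < cr + 1 by rewrite ltr_wpDl.
have cr1C : 0 < (cr + 1)%:C :> C by rewrite ltcR.
apply: (@lt_le_trans _ _ ((cr + 1)%:C * (e / (cr + 1))%:C)); first by rewrite ltr_pM2l.
by rewrite -rmorphM mulrCA mulfV ?mulr1 // gt_eqF.
Qed.

Lemma has_sumN a s : has_sum a s -> has_sum (fun x => - a x) (- s).
Proof.
move=> /(has_sumZ (-1)); rewrite mulN1r; apply: has_sum_ext => x; exact: mulN1r.
Qed.

Lemma has_sum_big (T : Type) (l : seq T) (a : T -> I -> C) (s : T -> C) :
  (forall i, has_sum (a i) (s i)) ->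
  has_sum (fun x => \sum_(i <- l) a i x) (\sum_(i <- l) s i).
Proof.
move=> sa; elim: l => [|i l IH].
  by rewrite big_nil; apply: has_sum_ext has_sum0 => x; rewrite big_nil.
rewrite big_cons; apply: has_sum_ext (has_sumD (sa i) IH) => x.
by rewrite big_cons.
Qed.

Lemma has_sum_reindex (g g' : I -> I) a s : cancel g g' -> cancel g' g ->
  has_sum a s -> has_sum (a \o g) s.
Proof.
move=> gK g'K sa e e0; have [A hA] := sa _ e0.
exists [fset g' x | x in A]%fset => B AB.
have := hA [fset g x | x in B]%fset; rewrite big_imfset /=; last first.
  by move=> x y _ _; exact: can_inj gK x y.
apply; apply/fsubsetP => x xA; apply/imfsetP; exists (g' x); rewrite ?g'K //=.
by apply: (fsubsetP AB); apply/imfsetP; exists x.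
Qed.

(** Splitting D by the sign of r turns a bound on all partial sums into a bound on the sum of
    absolute values. *)
Lemma norm_sum_real (r : I -> R) (D : {fset I}) (M : R) :
  (forall D', (D' `<=` D)%fset -> `|\sum_(x <- D') r x| <= M) ->
  \sum_(x <- D) `|r x| <= M + M.
Proof.
move=> hM; rewrite (big_fsetID _ (fun x => 0 <= r x)) /=; apply: lerD.
  apply: le_trans (hM [fset x in D | 0 <= r x]%fset _); last by apply/fsubsetP => x; rewrite !inE => /andP[].
  apply: le_trans (ler_norm _); rewrite big_seq [leRHS]big_seq; apply: ler_sum => x.
  by rewrite !inE => /andP[_ h]; rewrite ger0_norm.
apply: le_trans (hM [fset x in D | ~~ (0 <= r x)]%fset _); last by apply/fsubsetP => x; rewrite !inE => /andP[].
rewrite -normrN -sumrN; apply: le_trans (ler_norm _); rewrite big_seq [leRHS]big_seq; apply: ler_sum => x.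
by rewrite !inE => /andP[_ h]; rewrite ler0_norm // ltW // ltNge.
Qed.

Lemma norm_ge_Im (z : C) : `|complex.Im z|%:C <= `|z|.
Proof. by rewrite normc_def lecR -sqrtr_sqr ler_wsqrtr // lerDr sqr_ge0. Qed.

Lemma norm_le_ReIm (z : C) : `|z| <= (`|complex.Re z| + `|complex.Im z|)%:C.
Proof.
rewrite normc_def lecR -[leRHS]ger0_norm ?addr_ge0 // -sqrtr_sqr ler_wsqrtr //.
rewrite sqrrD !real_normK ?num_real // lerD2r lerDl.
by rewrite mulrn_wge0 // mulr_ge0.
Qed.

Lemma norm_sum_complex (b : I -> C) (D : {fset I}) (M : R) :
  (forall D', (D' `<=` D)%fset -> `|\sum_(x <- D') b x| <= M%:C) ->
  \sum_(x <- D) `|b x| <= (M + M + (M + M))%:C.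
Proof.
move=> hM; apply: (@le_trans _ _ (\sum_(x <- D) (`|complex.Re (b x)| + `|complex.Im (b x)|)%:C)).
  by apply: ler_sum => x _; exact: norm_le_ReIm.
rewrite -rmorph_sum lecR big_split /=; apply: lerD; apply: norm_sum_real => D' /hM h.
  by rewrite -lecR; apply: le_trans h; rewrite -raddf_sum; exact: normc_ge_Re.
by rewrite -lecR; apply: le_trans h; rewrite -raddf_sum; exact: norm_ge_Im.
Qed.

(* Averaging the sum with its shift by d, twisted so that the term of x0 is   *)
(* preserved, kills the term of x when 2 d (L x - L x0) = 1, and does not     *)
(* increase the sup norm. *)
Lemma frequency_bound (L : I -> R) (s : seq I) (x0 : I) (c : I -> C) (M : C) :
  injective L -> x0 \notin s ->
  (forall r : R, `|c x0 * ee (L x0 * r)%:C + \sum_(x <- s) c x * ee (L x * r)%:C| <= M) ->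
  `|c x0| <= M.
Proof.
move=> Linj; elim: s c => [|x s IH] c.
  by move=> _ /(_ 0); rewrite big_nil addr0 mulr0 rmorph0 ee0 mulr1.
rewrite inE negb_or => /andP[xx0 x0s] hM.
have dL : L x - L x0 != 0.
  by rewrite subr_eq0; apply: contraNneq xx0 => /Linj ->.
pose d := (2 * (L x - L x0))^-1.
pose m y := (1 + ee ((L y - L x0) * d)%:C) / 2.
have m0 : m x0 = 1.
  by rewrite /m subrr mul0r rmorph0 ee0 -[1 + 1]/(2%:R) mulfV // pnatr_eq0.
have mx : m x = 0.
  rewrite /m (_ : (L x - L x0) * d = 1 / 2); last by rewrite /d; field.
  by rewrite ee_half subrr mul0r.
have := IH (fun y => c y * m y) x0s; rewrite m0 mulr1; apply=> r.
pose P r := c x0 * ee (L x0 * r)%:C + \sum_(y <- x :: s) c y * ee (L y * r)%:C.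
have -> : c x0 * ee (L x0 * r)%:C + \sum_(y <- s) c y * m y * ee (L y * r)%:C =
    (P r + ee (- (L x0 * d))%:C * P (r + d)) / 2.
  have E y : c y * m y * ee (L y * r)%:C = (c y * ee (L y * r)%:C +
      ee (- (L x0 * d))%:C * (c y * ee (L y * (r + d))%:C)) / 2.
    rewrite /m mulrBl rmorphB eeD -rmorphN mulrDr [(_ + _)%:C in RHS]rmorphD eeD.
    by ring.
  rewrite /P mulrDr addrACA mulrDl -E m0 mulr1; congr (_ + _).
  rewrite mulr_sumr -big_split mulr_suml /= big_cons -E mx mulr0 mul0r add0r.
  by apply: eq_bigr => y _; rewrite E.
rewrite normrM (_ : `|2^-1| = 2^-1 :> C); last by rewrite ger0_norm // invr_ge0 ler0n.
rewrite ler_pdivrMr ?ltr0n // mulr_natr mulr2n.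
apply: le_trans (ler_normD _ _) _; apply: lerD; first exact: hM.
by rewrite normrM norm_ee_real mul1r; exact: hM.
Qed.

Lemma sum_fsetUD (b : I -> C) (A B : {fset I}) :
  \sum_(x <- (A `|` B)%fset) b x = \sum_(x <- A) b x + \sum_(x <- (B `\` A)%fset) b x.
Proof.
rewrite (big_fsetID _ (mem A)) /=; congr (_ + _).
  have -> // : [fset x in (A `|` B)%fset | x \in A]%fset = A.
  by apply/fsetP => x; rewrite !inE /=; case: (x \in A); rewrite ?andbF.
have -> // : [fset x in (A `|` B)%fset | x \notin A]%fset = (B `\` A)%fset.
by apply/fsetP => x; rewrite !inE /=; case: (x \in A); rewrite ?andbF ?andbT.
Qed.

(** Outside a finite set the norms of the coefficients have small sums, and the twists have norm 1.
    Hence the remaining finite exponential sum is small uniformly in r, and [frequency_bound] bounds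
    its coefficient at x0. *)
Lemma almost_periodic_eq0 (L : I -> R) (b : I -> C) : injective L ->
  (forall r : R, has_sum (fun x => b x * ee (L x * r)%:C) 0) -> forall x, b x = 0.
Proof.
move=> Linj sb x0; apply/eqP; rewrite -normr_eq0; apply/eqP/le_anti.
rewrite normr_ge0 andbT.
have [y yE] : exists r : R, `|b x0| = r%:C by rewrite normc_def; eexists.
rewrite yE lecR; apply/ler_addgt0Pr => e0 e00; rewrite add0r -lecR -yE.
(* One e bounds the full partial sum. The other eight bound the tail: its partial sums are at most
   2e, and passing to absolute values costs a factor 4. *)
pose e := e0 / 9; have ep : 0 < e by rewrite divr_gt0.
have [A hA] := sb 0 _ ep.
have {}hA B : (A `<=` B)%fset -> `|\sum_(x <- B) b x| < e%:C.
  move=> /hA; rewrite subr0; congr (`|_| < _); apply: eq_bigr => x _.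
  by rewrite mulr0 rmorph0 ee0 mulr1.
pose A' := (x0 |` A)%fset.
have AA' : (A `<=` A')%fset by exact: fsubsetU1.
have small (D' : {fset I}) : [disjoint A' & D']%fset -> `|\sum_(x <- D') b x| <= (e + e)%:C.
  move=> dD; have -> : \sum_(x <- D') b x = \sum_(x <- (A' `|` D')%fset) b x - \sum_(x <- A') b x.
    have /fsetDidPl DE : [disjoint D' & A']%fset by rewrite fdisjoint_sym.
    rewrite sum_fsetUD DE.
    by rewrite addrAC subrr add0r.
  apply: le_trans (ler_normB _ _) _; rewrite rmorphD; apply: lerD; apply/ltW/hA => //.
  by apply: fsubset_trans AA' _; exact: fsubsetUl.
have bound r : `|b x0 * ee (L x0 * r)%:C + \sum_(x <- (A' `\ x0)%fset) b x * ee (L x * r)%:C| <= e0%:C.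
  rewrite -(big_fsetD1 _ (F := fun x => b x * ee (L x * r)%:C)) ?fset1U1 //=.
  have [A1 hA1] := sb r _ ep.
  have /hA1 : (A1 `<=` A' `|` A1)%fset by exact: fsubsetUr.
  rewrite subr0 sum_fsetUD.
  set Y := (X in `|_ + X|) => XY.
  rewrite -[X in `|X|](addrK Y).
  have Yle : `|Y| <= (e + e + (e + e) + (e + e + (e + e)))%:C.
    apply: le_trans (ler_norm_sum _ _ _) _.
    rewrite (eq_bigr (fun x => `|b x|)); last by move=> x _; rewrite normrM norm_ee_real mulr1.
    apply: norm_sum_complex => D' /fsubsetP D'D; apply: small.
    apply/fdisjointP => x xA'; apply/negP => /D'D.
    by rewrite in_fsetD xA'.
  apply: le_trans (ler_normB _ _) _.
  have -> : e0%:C = e%:C + (e + e + (e + e) + (e + e + (e + e)))%:C :> C.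
    by rewrite -rmorphD; congr (_ %:C); rewrite /e; field.
  by apply: lerD => //; exact: ltW.
by apply: frequency_bound bound => //; rewrite in_fsetD1 eqxx.
Qed.

End HasSum.

(** * Fourier coefficients of cusp forms *)

Section Fourier.
Local Open Scope complex_scope.
Context {R : realType} {F : fieldExtType rat} {n : nat}.
Variable sigma : 'I_n -> {rmorphism F -> R}.
Hypothesis hF : totally_real_field sigma.
Local Notation O := (@ringO F).
Local Notation J := (codifferent sigma).
Local Notation D := (different sigma).
Local Notation C := R[i].

Definition phase (x : F) (z : 'rV[C]_n) : C := \sum_j (sigma j x)%:C * z 0 j.

(** Moving the real part of a single coordinate gives an almost periodic function of one variable,
    whose frequencies [sigma j0 x] are distinct because an embedding is injective. *)
Lemma fourier_unique (a : F -> C) :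
  (forall z, upper_half z -> has_sum (fun x => a x * ee (phase x z)) 0) -> forall x, a x = 0.
Proof.
move=> sa x.
have [j0 _] : exists j : 'I_n, True.
  have [e [c [ec _]]] := rational_basis hF.
  have := oner_neq0 F; rewrite (ec 1); case: (pickP 'I_n) => [j _ _|no]; first by exists j.
  by rewrite big1 ?eqxx // => j; have := no j.
pose z (r : R) : 'rV[C]_n := \row_j ('i + (if j == j0 then r else 0)%:C).
have hz r : upper_half (z r) by move=> j; rewrite mxE /= addr0.
have zE y r : phase y (z r) = phase y (z 0) + (sigma j0 y * r)%:C.
  rewrite /phase (bigD1 j0) //= [X in _ = X + _](bigD1 j0) //= !mxE eqxx.
  rewrite addrAC; congr (_ + _); first by rewrite !mulrDr rmorph0 mulr0 addr0 rmorphM.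
  by apply: eq_bigr => j /negPf jj; rewrite !mxE jj.
have sb r : has_sum (fun y => a y * ee (phase y (z 0)) * ee (sigma j0 y * r)%:C) 0.
  by apply: has_sum_ext (sa _ (hz r)) => y; rewrite zE eeD mulrA.
have /eqP := almost_periodic_eq0 (fmorph_inj (sigma j0)) sb x.
by rewrite mulf_eq0 (negPf (ee_neq0 _)) orbF => /eqP.
Qed.

Lemma phase_affine (x g be : F) (z : 'rV[C]_n) :
  phase x (\row_j ((sigma j g)%:C * z 0 j + (sigma j be)%:C)) =
  phase (x * g) z + (trace sigma (x * be))%:C.
Proof.
rewrite /phase /trace rmorph_sum -big_split /=; apply: eq_bigr => j _.
by rewrite mxE mulrDr !rmorphM /= mulrA.
Qed.

Lemma upper_half_affine (g be : F) (z : 'rV[C]_n) : totally_positive sigma g ->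
  upper_half z -> upper_half (\row_j ((sigma j g)%:C * z 0 j + (sigma j be)%:C)).
Proof.
move=> gp hz j; rewrite mxE; have := hz j; case: (z 0 j) => u w /= w0.
by rewrite mul0r !addr0 mulr_gt0 //; exact: gp.
Qed.

Variable Fv : forall v : fplace F, completion R (sval v).
Local Notation "`| x |_ v" := (cabs (Fv v) x)
  (at level 0, v at level 2, format "`| x |_ v").
Local Notation iota v := (cemb (Fv v)).
Local Notation loc I v := (@loc R F Fv I v).
Variable b : set F.
Hypothesis hb : integral_ideal b.
Variables (h : nat) (t : 'I_h -> fin_idele Fv).
Hypothesis ht : narrow_class_reps sigma t.
Variables (k : 'I_n -> nat) (f : 'I_h -> 'rV[C]_n -> C).
Hypothesis hf : cusp_form sigma t k b f.

Lemma cusp_form_translation nu (be : F) (z : 'rV[C]_n) :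
  (forall v, loc J v (iota v be * t nu v)) -> upper_half z ->
  f nu (\row_j ((sigma j 1)%:C * z 0 j + (sigma j be)%:C)) = f nu z.
Proof.
move=> Jbe hz; have G : Gamma sigma t b nu (mx2 1 be 0 1).
  split; first by rewrite det_mx2 !mx2E mulr0 subr0 mulr1 oner_neq0.
  exists (fun j => map_mx (sigma j) (mx2 1 be 0 1), fun v => mx2 1 (iota v be * t nu v) 0 1).
    split=> [j|v] /=; first by rewrite map_mx2 det_mx2 !mx2E rmorph0 rmorph1 mulr0 subr0 mulr1.
    by apply: (Kloc_upper hF hb); rewrite ?cabs1.
  congr pair; apply: functional_extensionality_dep => v /=; first by rewrite mulmx1 mul1mx.
  by rewrite map_mx2 rmorph0 rmorph1 !mulmx2; congr mx2; ring.
rewrite -[RHS](cusp_form_slash hf G hz) /slash /principal_mx /= big1 => [|j _]; last first.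
  rewrite /aut_factor map_mx2 det_mx2 !mx2E !(rmorph0, rmorph1) mulr0 subr0 mul1r.
  by rewrite powR1 mul0r add0r expr1n invr1 mulr1.
rewrite mul1r; congr (f nu _); apply/rowP => j; rewrite !mxE /aut_factor map_mx2 !mx2E.
by rewrite !(rmorph0, rmorph1) mul0r add0r divr1.
Qed.

(** Regularity at the cusps only provides an expansion over some fractional ideal, and vanishing of
    the constant term leaves totally positive exponents. That these lie in t_nu O comes from
    invariance under the translations in [Gamma], by duality for the trace form. *)
Lemma cusp_form_expansion nu : exists a,
  fourier_expansion sigma (tO t nu `&` totally_positive sigma) (f nu) a.
Proof.
have pos1 : totally_positive sigma (\det (1%:M : 'M[F]_2)) by move=> j; rewrite det1 rmorph1.
have s1 : slash k (principal_mx sigma Fv 1%:M).1 (f nu) = f nu.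
  apply/funext => z; rewrite /slash /principal_mx /= big1 => [|j _]; last first.
    by rewrite /aut_factor map_mx1 det1 !mxE !(rmorph0, rmorph1) powR1 mul0r add0r expr1n invr1 mulr1.
  rewrite mul1r; congr (f nu _); apply/rowP => j; rewrite !mxE /aut_factor map_mx1 !mxE /=.
  by rewrite !(rmorph0, rmorph1) mul0r add0r addr0 mul1r divr1.
have [I [a [fI Ea]]] := cusp_form_cusps hf nu pos1.
have a0 := cusp_form_constant hf pos1 fI Ea.
move: Ea; rewrite s1 => -[aI sa]; exists a; split=> // x xS.
apply/eqP; apply: contra_notT xS => ax.
have [Ix xtp] : cusp_support sigma I x.
  by apply: contrapT => nS; move/eqP: ax; apply; exact: aI.
have x0 : x != 0 by apply: contraNneq ax => ->; rewrite a0.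
split; last by case: xtp => // /eqP; rewrite (negPf x0).
(* Comparing the expansions at z and z + be gives a(x) (e(tr(x be)) - 1) = 0. *)
have dual be : (forall v, loc J v (iota v be * t nu v)) -> trace sigma (x * be) \is a Num.int.
  move=> Jbe; apply: ee_eq1; apply/eqP; rewrite -subr_eq0.
  have := @fourier_unique (fun y => a y * (ee (trace sigma (y * be))%:C - 1)) _ x.
  move=> /(_ _)/eqP; rewrite mulf_eq0 (negPf ax) /=; apply=> z hz.
  have one_pos : totally_positive sigma 1 by move=> j; rewrite rmorph1.
  have hz' := upper_half_affine be one_pos hz.
  have sz := sa _ hz; have sz' := sa _ hz'.
  rewrite (cusp_form_translation Jbe hz) in sz'.
  have := has_sumD sz' (has_sumN sz); rewrite subrr; apply: has_sum_ext => y.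
  rewrite -/(ee _) -/(phase _ _) -/(ee (phase y z)) phase_affine mulr1 eeD; ring.
move=> v; have tn0 w : t nu w != 0 by exact: (class_rep_neq0 ht).
(* For this [be], [codifferent_dual] makes x be integral; at v, where be has the norm of t_nu^-1,
   this bounds x by t_nu. *)
have [||be [bev bele]] := @prescribed_norm _ _ _ sigma hF Fv (fun w => (t nu w)^-1) v.
- by move=> w; rewrite invr_eq0; exact: tn0.
- apply: sub_finite_set (class_rep_almost_unit ht nu) => w /= hw tw.
  by apply: hw; rewrite cabsV tw invr1.
have be1 w : `|iota w be * t nu w|_w <= 1.
  by rewrite cabsM -ler_pdivlMr ?div1r -?cabsV ?cabs_gt0 //; exact: bele.
have /(ringO_local hF Fv)/(_ v) : O (x * be).
  apply: (codifferent_dual hF) => y Jy; rewrite -mulrA; apply: dual => w.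
  by rewrite rmorphM mulrAC; apply: locMl => //; exists y.
by rewrite rmorphM cabsM bev cabsV ler_pdivrMr ?mul1r // cabs_gt0.
Qed.

Lemma fourier_coefP nu :
  fourier_expansion sigma (tO t nu `&` totally_positive sigma) (f nu) (fourier_coef sigma t f nu).
Proof. by apply: xgetPex; exact: cusp_form_expansion. Qed.

Lemma fourier_coef_sum nu z : upper_half z ->
  has_sum (fun x => fourier_coef sigma t f nu x * ee (phase x z)) (f nu z).
Proof. by have [_ sa] := fourier_coefP nu; exact: sa. Qed.

Lemma fourier_coef_affine nu (g be : F) z : totally_positive sigma g -> g != 0 ->
  upper_half z ->
  has_sum (fun x => fourier_coef sigma t f nu (x / g) * ee (trace sigma (x / g * be))%:C
                    * ee (phase x z))
    (f nu (\row_j ((sigma j g)%:C * z 0 j + (sigma j be)%:C))).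
Proof.
move=> gp g0 hz.
have := fourier_coef_sum nu (upper_half_affine be gp hz).
move=> /(@has_sum_reindex _ _ (fun x => x / g) (fun x => x * g)).
move=> /(_ (mulfVK g0) (mulfK g0)); apply: has_sum_ext => x /=.
by rewrite phase_affine divfK // eeD -mulrA; congr (_ * _); rewrite mulrC.
Qed.

Variable v0 : fplace F.
Local Notation p := (sval v0).
Hypothesis bv0 : exists2 a, b a & ~ p a.
Hypothesis Dv0 : exists2 a, D a & ~ p a.
Local Notation q := ((idealN p)%:R : R).
Variable pi : F.
Hypothesis pi_norm : `|iota v0 pi|_v0 = q^-1.
Local Notation u := (unif Fv v0 pi).
Variable lambda : C.
Hypothesis eigen : forall x, GL2A x ->
  heckeT sigma b p (adelic_lift sigma t k b f) x = lambda * adelic_lift sigma t k b f x.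

(** Both sides of [hecke_relation] are expanded and their coefficients at xi compared. Each
    translation beta multiplies the coefficient by e(tr(xi beta / gamma)), which is 1, so the sum
    over beta becomes a multiple by [upper_count]. *)
Theorem hecke_coef_relation nu mu mu' (gamma gamma' xi : F) :
  totally_positive sigma gamma -> gamma != 0 ->
  totally_positive sigma gamma' -> gamma' != 0 ->
  (forall v, `|iota v gamma * ((t nu v)^-1 * u v)|_v = (`|t mu v|_v)^-1) ->
  (forall v, `|iota v gamma' * ((t nu v)^-1 * (u v)^-1)|_v = (`|t mu' v|_v)^-1) ->
  tO t nu xi ->
  (0 < upper_count sigma Fv b v0 pi)%N /\
  lambda * fourier_coef sigma t f nu xi =
    (norm_factor sigma k gamma)%:C * ((upper_count sigma Fv b v0 pi)%:R * fourier_coef sigma t f mu (xi / gamma))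
    + (norm_factor sigma k gamma')%:C * fourier_coef sigma t f mu' (xi / gamma').
Proof.
move=> gp g0 gp' g0' gmu gmu' txi.
have [l [l0 sl Jl rel]] := hecke_relation hF hb ht hf bv0 Dv0 pi_norm eigen gp g0 gp' g0' gmu gmu'.
rewrite -sl; split; first by case: (l) l0.
pose d x := lambda * fourier_coef sigma t f nu x -
  ((norm_factor sigma k gamma)%:C * (\sum_(be <- l) (fourier_coef sigma t f mu (x / gamma)
      * ee (trace sigma (x / gamma * be))%:C))
    + (norm_factor sigma k gamma')%:C * fourier_coef sigma t f mu' (x / gamma')).
suff /eqP : d xi = 0.
  rewrite subr_eq0 => /eqP ->; congr (_ * _ + _).
  rewrite big_seq (eq_bigr (fun=> fourier_coef sigma t f mu (xi / gamma))) => [|be bel].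
    by rewrite -big_seq big_const_seq count_predT iter_addr_0 mulr_natl.
  (* Locally xi is a multiple of t_nu and (beta / gamma) t_nu lies in the codifferent, so their
     combination does; its trace is an integer. *)
  rewrite ee_int ?mulr1 //; have : J (xi / gamma * be).
    apply: (codifferent_local hF (Fv := Fv)) => v; apply: loc_le (Jl be bel v) _.
    have -> : xi / gamma * be = xi * (be / gamma) by ring.
    rewrite rmorphM !cabsM [leLHS]mulrC ler_wpM2l ?cabs_ge0 //.
  by move=> /(_ 1 (@ringO1 F)); rewrite mulr1.
apply: fourier_unique => z hz.
have e1 := has_sumZ lambda (fourier_coef_sum nu hz).
have e2 := has_sumZ (norm_factor sigma k gamma)%:C
  (has_sum_big l (fun be => fourier_coef_affine mu be gp g0 hz)).
have e3 := has_sumZ (norm_factor sigma k gamma')%:C (fourier_coef_affine mu' 0 gp' g0' hz).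
have := has_sumD e1 (has_sumN (has_sumD e2 e3)).
have -> : \row_j ((sigma j gamma')%:C * z 0 j + (sigma j 0)%:C) = \row_j ((sigma j gamma')%:C * z 0 j).
  by apply/rowP => j; rewrite !mxE !rmorph0 addr0.
rewrite -rel // subrr; apply: has_sum_ext => x.
have -> : trace sigma (x / gamma' * 0) = 0.
  by rewrite mulr0 /trace big1 // => j _; rewrite rmorph0.
rewrite rmorph0 ee0 mulr1 /d mulrBl mulrDl; congr (_ - (_ + _)); try by rewrite mulrA.
by rewrite -mulrA; congr (_ * _); rewrite mulr_suml.
Qed.

End Fourier.

(** * Coefficients at prime powers *)

(** With d_j = c_(j-1) and d_0 = 0, let r > 0 be the first positive index where d vanishes. Then
    d_(r+j) is a nonzero multiple of d_j, so d_j = 0 exactly when r divides j. If there is no such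
    index, r = 0 works, since 0 divides no m + 1. *)
Lemma recurrence_zeros (K : fieldType) (c : nat -> K) (lambda M : K) : M != 0 -> c 0%N != 0 ->
  lambda * c 0%N = M * c 1%N ->
  (forall m, lambda * c m.+1 = M * c m.+2 + c m) ->
  exists2 r, r != 1%N & forall m, (c m == 0) = (r %| m.+1)%N.
Proof.
move=> M0 c0 rec0 rec.
have [/existsNP[m0 /negP/negPn cm0]|nz] := pselect (~ forall m, c m != 0); last first.
  exists 0%N => // m; rewrite dvd0n /=; apply/negbTE; move: m; exact: contrapT nz.
case: (ex_minnP (ex_intro (fun m => c m == 0) m0 cm0)) => m /eqP cm mmin.
pose d j := if j is i.+1 then c i else 0.
have drec j : lambda * d j.+1 = M * d j.+2 + d j.
  by case: j => [|j] /=; rewrite ?addr0 ?rec0 ?rec.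
have dr : d m.+1 = 0 by [].
(* Both sides satisfy the recurrence and agree at j = 0 and j = 1; the induction carries two
   consecutive values. *)
have shift j : d (m.+1 + j)%N * d 1%N = d m.+2 * d j.
  have [//] : d (m.+1 + j)%N * d 1%N = d m.+2 * d j /\ d (m.+1 + j.+1)%N * d 1%N = d m.+2 * d j.+1.
  elim: j => [|j [IH1 IH2]]; first by rewrite addn0 dr mul0r mulr0 addn1.
  split=> //; apply: (mulfI M0).
  have /(congr1 (fun x => x * d 1%N)) := drec (m.+1 + j)%N.
  rewrite mulrDl -!addnS => E.
  have -> : M * (d (m.+1 + j.+2)%N * d 1%N) = lambda * d (m.+1 + j.+1)%N * d 1%N - d (m.+1 + j)%N * d 1%N.
    by rewrite E; ring.
  rewrite -mulrA IH2 IH1.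
  have -> : M * (d m.+2 * d j.+2) = d m.+2 * (M * d j.+2 + d j) - d m.+2 * d j by ring.
  by rewrite -drec; ring.
(* Two consecutive zeros would propagate downwards to d_1 = c_0. *)
have dr1 : d m.+2 != 0.
  apply: contraNneq c0 => dr1.
  have down i : (i <= m)%N -> d (m.+1 - i)%N = 0 /\ d (m.+2 - i)%N = 0.
    elim: i => [|i IH] im; first by rewrite !subn0.
    have [h1 h2] := IH (ltnW im).
    have E1 : (m.+2 - i = (m.+1 - i.+1).+2)%N by lia.
    have E2 : (m.+1 - i = (m.+1 - i.+1).+1)%N by lia.
    have E3 : (m.+2 - i.+1 = (m.+1 - i.+1).+1)%N by lia.
    have e0 : d (m.+1 - i.+1)%N = 0.
      by have := drec (m.+1 - i.+1)%N; rewrite -E1 -E2 h1 h2 !mulr0 add0r.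
    by split=> //; rewrite E3 -E2.
  by have [] := down m (leqnn _); rewrite subSnn => /= -> .
have dshift j : (d (m.+1 + j)%N == 0) = (d j == 0).
  have := shift j; move=> /(congr1 (fun x => x == 0)).
  by rewrite !mulf_eq0 (negPf dr1) (negPf (c0 : d 1%N != 0)) orbF.
have dmul i j : (d (i * m.+1 + j)%N == 0) = (d j == 0).
  by elim: i => [|i IH]; rewrite ?mul0n ?add0n // mulSn -addnA dshift.
exists m.+1.
  by apply: contraNneq c0 => -[m0']; rewrite -m0' cm.
move=> i; rewrite -[c i]/(d i.+1) (divn_eq i.+1 m.+1) dmul /dvdn modnMDl modn_mod.
have := ltn_pmod i.+1 (ltn0Sn m); case: (i.+1 %% m.+1)%N => [|j] /= jm; first by rewrite !eqxx.
by apply/negbTE/negP => /mmin; rewrite leqNgt -ltnS jm.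
Qed.

Lemma periodic_positive_density (R : realType) (A : set nat) (P : nat) : (0 < P)%N ->
  A 0%N -> (forall m, A (m + P)%N <-> A m) -> has_positive_density R A.
Proof.
move=> P0 A0 AP; pose a m : nat := `[< A m >].
have aP m : a (m + P)%N = a m by congr nat_of_bool; exact: asbool_equiv_eq (AP m).
pose S N := (\sum_(0 <= m < N) a m)%N.
have S0 : S 0%N = 0%N by rewrite /S big_geq.
have SS N : S N.+1 = (S N + a N)%N by rewrite /S big_nat_recr.
have SD N : S (N + P)%N = (S N + S P)%N.
  by elim: N => [|N IH]; [rewrite S0|rewrite addSn !SS IH aP addnAC].
have Sdiv N : S N = (S P * (N %/ P) + S (N %% P))%N.
  rewrite {1}(divn_eq N P); elim: (N %/ P)%N => [|i IH]; first by rewrite mul0n muln0.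
  have -> : (i.+1 * P + N %% P = i * P + N %% P + P)%N by rewrite mulSn; lia.
  by rewrite SD IH mulnS; lia.
have Sle N : (S N <= N)%N.
  by elim: N => [|N IH]; rewrite ?S0 // SS -addn1 leq_add // /a; case: asbool.
have SP0 : (0 < S P)%N.
  by case: P P0 {AP aP SD Sdiv} => // P _; elim: P => [|P IH]; [rewrite SS S0 /a asboolT|rewrite SS addn_gt0 IH].
(* The count of the m <= N differs from S(P) N / P by a bounded amount, which also absorbs the shift
   between N + 1 terms and the divisor N. *)
have bound N : `|(S N.+1)%:R * P%:R - (S P)%:R * N%:R| <= (P * P + P)%:R :> R.
  rewrite -!natrM; set x := (_ * P)%N; set y := (_ * N)%N.
  have xy : (x <= y + (P * P + P))%N /\ (y <= x + (P * P + P))%N.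
    have := Sdiv N.+1; have := Sle (N.+1 %% P)%N; have := ltn_pmod N.+1 P0.
    have := divn_eq N.+1 P; have := Sle P; rewrite /x /y => h1 h2 h3 h4 h5; nia.
  rewrite ler_norml lerBrDl lerBlDl; case: xy => h1 h2.
  by rewrite lerBlDl -!natrD !ler_nat addnC h2 h1.
have PR : 0 < P%:R :> R by rewrite ltr0n.
exists ((S P)%:R / P%:R); first by rewrite divr_gt0 // ltr0n.
apply/cvgrPdist_le => e e0.
near=> N.
have N0 : 0 < N%:R :> R.
  by apply: (@lt_le_trans _ _ 1) => //; near: N; exact: nbhs_infty_ger.
have NP : 0 < N%:R * P%:R :> R by rewrite mulr_gt0.
rewrite -/(S N.+1) -normrN opprB.
have -> : (S N.+1)%:R / N%:R - (S P)%:R / P%:R =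
    ((S N.+1)%:R * P%:R - (S P)%:R * N%:R) / (N%:R * P%:R) :> R.
  by field; rewrite !gt_eqF.
rewrite normrM normfV (gtr0_norm NP) ler_pdivrMr //.
apply: le_trans (bound N) _; rewrite mulrA -ler_pdivrMr // -ler_pdivrMl //.
by near: N; exact: nbhs_infty_ger.
Unshelve. all: by end_near.
Qed.

Lemma joint_nondivisibility_density (R : realType) (r1 r2 : nat) : r1 != 1%N -> r2 != 1%N ->
  has_positive_density R [set m | ~~ (r1 %| m.+1)%N && ~~ (r2 %| m.+1)%N].
Proof.
(* When r = 0 no m is excluded, so any period will do and 1 is used. *)
move=> r11 r21; pose w r := if r is 0 then 1%N else r.
have wP r m q : (r %| (m + w r * q).+1)%N = (r %| m.+1)%N.
  by case: r => [|r]; rewrite ?dvd0n // -addSn dvdn_addl // dvdn_mulr.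
apply: (@periodic_positive_density _ _ (w r1 * w r2)) => /=.
- by rewrite muln_gt0; case: r1 {r11} => //; case: r2 {r21}.
- by rewrite !dvdn1 r11 r21.
- by move=> m; rewrite wP mulnC wP.
Qed.

(** * The recurrence along the powers of p *)

Section PrimePowers.
Local Open Scope complex_scope.
Context {R : realType} {F : fieldExtType rat} {n : nat}.
Variable sigma : 'I_n -> {rmorphism F -> R}.
Hypothesis hF : totally_real_field sigma.
Local Notation O := (@ringO F).
Local Notation D := (different sigma).
Local Notation C := R[i].
Variable Fv : forall v : fplace F, completion R (sval v).
Local Notation "`| x |_ v" := (cabs (Fv v) x)
  (at level 0, v at level 2, format "`| x |_ v").
Local Notation iota v := (cemb (Fv v)).

(** An idele is recovered up to units from its ideal, since by [prescribed_norm] the ideal contains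
    an element attaining the norm at any given place. *)
Lemma norm_ball_inj (s s' : fin_idele Fv) :
  (forall v, s v != 0) -> almost_all (fun v => `|s v|_v = 1) ->
  (forall v, s' v != 0) -> almost_all (fun v => `|s' v|_v = 1) ->
  [set x | forall v, `|iota v x|_v <= `|s v|_v] = [set x | forall v, `|iota v x|_v <= `|s' v|_v] ->
  forall v, `|s v|_v = `|s' v|_v.
Proof.
have half (r r' : fin_idele Fv) : (forall v, r v != 0) -> almost_all (fun v => `|r v|_v = 1) ->
    [set x | forall v, `|iota v x|_v <= `|r v|_v] `<=` [set x | forall v, `|iota v x|_v <= `|r' v|_v] ->
    forall v, `|r v|_v <= `|r' v|_v.
  by move=> r0 r1 sub v; have [x [<- /sub]] := prescribed_norm hF v r0 r1; apply.
move=> s0 s1 s0' s1' E v; apply/eqP; rewrite eq_le; apply/andP; split.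
  by apply: half => //; rewrite E.
by apply: half => //; rewrite E.
Qed.

Variables (h : nat) (t : 'I_h -> fin_idele Fv).
Hypothesis ht : narrow_class_reps sigma t.
Variable v0 : fplace F.
Local Notation p := (sval v0).
Local Notation q := ((idealN p)%:R : R).
Variable pi : F.
Hypothesis pi_norm : `|iota v0 pi|_v0 = q^-1.
Local Notation u := (unif Fv v0 pi).

Let u0 v : u v != 0. Proof. exact: (unif_neq0 hF). Qed.
Let t0 nu v : t nu v != 0. Proof. exact: (class_rep_neq0 ht). Qed.

Lemma prime_power_ball m :
  [set x | forall v, `|iota v x|_v <= `|u v ^+ m|_v] = idealX p m.
Proof.
have le1 v : `|u v ^+ m|_v <= 1.
  by rewrite cabsX exprn_ile1 ?cabs_ge0 // (unif_norm_le1 hF pi_norm).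
have at0 : `|u v0 ^+ m|_v0 = q ^- m by rewrite cabsX (unif_norm_at pi_norm) exprVn.
rewrite eqEsubset; split=> x hx.
  have Ox : O x by apply/(ringO_local hF Fv) => v; apply: le_trans (hx v) (le1 v).
  by apply/(idealX_cabsP hF (svalP v0) (Fv v0)) => //; rewrite -at0; exact: hx.
have Ox := idealX_ringO (svalP v0) hx.
move=> v; have [->|vv0] := pselect (v = v0).
  by rewrite at0; apply/(idealX_cabsP hF (svalP v0)).
rewrite unif_off // expr1n cabs1; exact: (cabs_ringO hF (svalP v)).
Qed.

Lemma class_of_idele (s : fin_idele Fv) : (forall v, s v != 0) ->
  almost_all (fun v => `|s v|_v = 1) ->
  exists nu x, [/\ x != 0, totally_positive sigma x & forall v, `|s v|_v = `|iota v x * t nu v|_v].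
Proof.
move=> s0 s1; have [_ /(_ (fun _ => 1, s))[]] := ht.
  by split=> //= j; exact: oner_neq0.
move=> nu [[x [x0 xp xs]] _]; exists nu, x; split=> // j.
by have := xp j; rewrite /= mul1r.
Qed.

Lemma almost_unitX (s : fin_idele Fv) m : almost_all (fun v => `|s v|_v = 1) ->
  almost_all (fun v => `|s v ^+ m|_v = 1).
Proof.
move=> s1; apply: sub_finite_set s1 => v /= hv sv; apply: hv.
by rewrite cabsX sv expr1n.
Qed.

Lemma prime_power_rep m : exists nu xi,
  [/\ xi != 0, totally_positive sigma xi & forall v, `|iota v xi / t nu v|_v = `|u v ^+ m|_v].
Proof.
have [||nu [x [x0 xp xs]]] := @class_of_idele (fun v => (u v ^+ m)^-1).
- by move=> v; rewrite invr_eq0; apply: expf_neq0; exact: u0.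
- apply: sub_finite_set (almost_unitX m (unif_almost_unit Fv v0 pi)) => v /= hv uv; apply: hv.
  by rewrite cabsV uv invr1.
exists nu, x^-1; split; first by rewrite invr_eq0.
  by move=> j; rewrite fmorphV invr_gt0; exact: xp.
by move=> v; rewrite fmorphV -invfM cabsV -xs cabsV invrK.
Qed.

Variables (k : 'I_n -> nat) (f : 'I_h -> 'rV[C]_n -> C).
Local Notation a := (fourier_coef sigma t f).
Local Notation nf := (norm_factor sigma k).

Lemma norm_factor_gt0 x : totally_positive sigma x -> 0 < nf x.
Proof. by move=> xp; apply: prodr_gt0 => j _; rewrite powR_gt0 //; exact: xp. Qed.

Lemma norm_factor_div x y : totally_positive sigma x -> totally_positive sigma y ->
  nf (x / y) = nf x / nf y.
Proof.
move=> xp yp; have yp' j : 0 < sigma j y by exact: yp.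
rewrite /norm_factor -prodfV -big_split /=; apply: eq_bigr => j _.
rewrite fmorph_div powRM ?invr_ge0 ?ltW //.
by rewrite -(powR_inv1 (ltW (yp' j))) -powRrM mulN1r powRN.
Qed.

(** The value of [coefC] comes from some pair (nu, xi) representing p^m, because [prime_power_rep]
    shows that one exists. The norm of p^m is positive, so its power does not affect vanishing. *)
Lemma coefC_prime_power m : exists nu xi,
  [/\ xi != 0, totally_positive sigma xi, forall v, `|iota v xi / t nu v|_v = `|u v ^+ m|_v &
      (coefC sigma t k f (idealX p m) == 0) = (a nu xi / (nf xi)%:C == 0)].
Proof.
have pI : integral_ideal p by have [] := svalP v0.
have [nu1 [xi1 [_ xi1p xi1E]]] := prime_power_rep m.
rewrite /coefC; set P := [set c | _].
have /(xgetPex 0) : exists c, P c.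
  eexists; exists nu1, xi1; split=> //.
  rewrite -prime_power_ball; congr [set x | _]; apply/funext => x; apply: eq_forall => v.
  by rewrite xi1E.
move=> [nu [xi [xip xiE ->]]]; exists nu, xi.
have [j0 _] : exists j : 'I_n, True.
  have [e [c [ec _]]] := rational_basis hF.
  have := oner_neq0 F; rewrite (ec 1); case: (pickP 'I_n) => [j _ _|no]; first by exists j.
  by rewrite big1 ?eqxx // => j; have := no j.
have xi0 : xi != 0 by rewrite -(fmorph_eq0 (sigma j0)) gt_eqF //; exact: xip.
split=> //.
  apply: norm_ball_inj => [v||v||].
  - by apply: mulf_neq0; rewrite ?invr_eq0 ?fmorph_eq0 //; exact: t0.
  - have : finite_set ([set v | ~ (`|iota v xi|_v = 1)] `|` [set v | ~ (`|t nu v|_v = 1)]).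
      rewrite finite_setU; split; first exact: (almost_all_unit hF Fv xi0).
      exact: (class_rep_almost_unit ht).
    apply: sub_finite_set => v /= hv; apply/not_andP => -[h1 h2]; apply: hv.
    by rewrite cabsM cabsV h1 h2 invr1 mulr1.
  - by apply: expf_neq0; exact: u0.
  - by apply: almost_unitX; exact: unif_almost_unit.
  - by rewrite prime_power_ball xiE.
have N0 : ((idealN (idealX p m))%:R `^ ((\max_(j < n) k j)%:R / 2) : R) != 0.
  by rewrite gt_eqF // powR_gt0 // ltr0n; apply: (idealN_gt0 hF); exact: integral_idealX.
have -> : \prod_(j < n) sigma j xi `^ (- ((k j)%:R / 2)) = (nf xi)^-1.
  by rewrite /norm_factor -prodfV; apply: eq_bigr => j _; rewrite powRN.
have nf0 : (nf xi)%:C != 0 :> C by rewrite fmorph_eq0 gt_eqF // norm_factor_gt0.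
by rewrite fmorphV !mulf_eq0 fmorph_eq0 (negPf N0) !invr_eq0 orFb.
Qed.

Variable b : set F.
Hypothesis hb : integral_ideal b.
Hypothesis bv0 : exists2 x, b x & ~ p x.
Hypothesis Dv0 : exists2 x, D x & ~ p x.
Hypothesis hf : primitive_eigenform sigma t k b f.

(** For representatives (nu m, xi m) of p^m, [hecke_coef_relation] applies with gamma = xi_m /
    xi_(m+1) and gamma' = xi_m / xi_(m-1). Dividing by xi_m^(k/2) makes the factors gamma^(k/2) and
    gamma'^(k/2) disappear, which leaves a recurrence with constant coefficients. *)
Theorem prime_power_coef_zeros : exists2 r, r != 1%N &
  forall m, (coefC sigma t k f (idealX p m) == 0) = (r %| m.+1)%N.
Proof.
have [[cf _] eig c1] := hf.
have pI : integral_ideal p by have [] := svalP v0.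
have [lambda eigen] := eig _ pI.
have [nu [xi rep]] : exists (nu : nat -> 'I_h) (xi : nat -> F), forall m,
    [/\ xi m != 0, totally_positive sigma (xi m),
        forall v, `|iota v (xi m) / t (nu m) v|_v = `|u v ^+ m|_v &
        (coefC sigma t k f (idealX p m) == 0) = (a (nu m) (xi m) / (nf (xi m))%:C == 0)].
  by have /choice[nu /choice[xi rep]] := coefC_prime_power; exists nu, xi.
pose c m := a (nu m) (xi m) / (nf (xi m))%:C.
have cE m : (coefC sigma t k f (idealX p m) == 0) = (c m == 0) by have [] := rep m.
have c0 : c 0%N != 0 by rewrite -cE [coefC _ _ _ _ _]c1 oner_neq0.
have xi0 m : xi m != 0 by have [] := rep m.
have xip m : totally_positive sigma (xi m) by have [] := rep m.
have xiE m v : `|iota v (xi m)|_v = `|u v|_v ^+ m * `|t (nu m) v|_v.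
  have [_ _ /(_ v) E _] := rep m.
  by rewrite -cabsX -E cabsM cabsV divfK // cabs_neq0; exact: t0.
have nf0 x : totally_positive sigma x -> (nf x)%:C != 0 :> C.
  by move=> xp; rewrite fmorph_eq0 gt_eqF // norm_factor_gt0.
have divp x y : totally_positive sigma x -> totally_positive sigma y -> totally_positive sigma (x / y).
  by move=> xp yp j; rewrite fmorph_div divr_gt0.
have uE v : `|u v|_v != 0 by rewrite cabs_neq0; exact: u0.
have tE m v : `|t m v|_v != 0 by rewrite cabs_neq0; exact: t0.
set M := upper_count sigma Fv b v0 pi.
have txi m : tO t (nu m) (xi m).
  move=> v; rewrite xiE ler_piMl ?cabs_ge0 // exprn_ile1 ?cabs_ge0 //.
  exact: (unif_norm_le1 hF pi_norm).
have up m v : `|iota v (xi m / xi m.+1) * ((t (nu m) v)^-1 * u v)|_v = (`|t (nu m.+1) v|_v)^-1.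
  rewrite fmorph_div !cabsM !cabsV !xiE exprS; field.
  by rewrite expf_neq0 // !tE uE.
have down m v : `|iota v (xi m.+1 / xi m) * ((t (nu m.+1) v)^-1 * (u v)^-1)|_v = (`|t (nu m) v|_v)^-1.
  rewrite fmorph_div !cabsM !cabsV !xiE exprS; field.
  by rewrite expf_neq0 // !tE uE.
(* For m = 0 there is no xi_(-1); [g] and [mu] represent the class of t_(nu 0) u instead. *)
have [||mu [g [g0 gp gE]]] := @class_of_idele (fun v => t (nu 0%N) v * u v).
- by move=> v; apply: mulf_neq0; [exact: t0|exact: u0].
- have : finite_set ([set v | ~ (`|t (nu 0%N) v|_v = 1)] `|` [set v | ~ (`|u v|_v = 1)]).
    rewrite finite_setU; split; first exact: (class_rep_almost_unit ht).
    exact: unif_almost_unit.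
  apply: sub_finite_set => v /= hv; apply/not_andP => -[h1 h2]; apply: hv.
  by rewrite cabsM h1 h2 mulr1.
have down0 v : `|iota v g * ((t (nu 0%N) v)^-1 * (u v)^-1)|_v = (`|t mu v|_v)^-1.
  have := gE v; rewrite !cabsM !cabsV => E.
  have -> : `|iota v g|_v = `|t (nu 0%N) v|_v * `|u v|_v / `|t mu v|_v by rewrite E mulfK.
  by field; rewrite !tE uE.
have rel := @hecke_coef_relation _ _ _ _ hF _ _ hb _ _ ht k f cf v0 bv0 Dv0 pi pi_norm _ eigen.
have [M0 rel0] := rel _ _ _ _ _ _ (divp _ _ (xip 0%N) (xip 1%N))
  (mulf_neq0 (xi0 0%N) (invr_neq0 (xi0 1%N))) gp g0 (up 0%N) down0 (txi 0%N).
have relS m := rel _ _ _ _ _ _ (divp _ _ (xip m.+1) (xip m.+2))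
  (mulf_neq0 (xi0 m.+1) (invr_neq0 (xi0 m.+2))) (divp _ _ (xip m.+1) (xip m))
  (mulf_neq0 (xi0 m.+1) (invr_neq0 (xi0 m))) (up m.+1) (down m) (txi m.+1).
have xiK x y : x != 0 -> y != 0 -> x / (x / y) = y :> F by move=> *; field; apply/andP.
have [r r1 rP] : exists2 r, r != 1%N & forall m, (c m == 0) = (r %| m.+1)%N.
  apply: (@recurrence_zeros _ c lambda M%:R) => //.
  - by rewrite pnatr_eq0 -lt0n.
  (* This is c_(-1) = 0: at v0 the norm of xi_0 / g is q times that of t_mu, so xi_0 / g is outside
     the support of the expansion. *)
  - have ag : a mu (xi 0%N / g) = 0.
      have [a0 _] := fourier_coefP hF hb ht cf mu.
      apply: a0 => -[/(_ v0)]; rewrite fmorph_div cabsM cabsV xiE expr0 mul1r.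
      have := gE v0; rewrite !cabsM => E.
      have -> : `|iota v0 g|_v0 = `|t (nu 0%N) v0|_v0 * `|u v0|_v0 / `|t mu v0|_v0 by rewrite E mulfK.
      have -> : `|t (nu 0%N) v0|_v0 / (`|t (nu 0%N) v0|_v0 * `|u v0|_v0 / `|t mu v0|_v0)
        = `|t mu v0|_v0 / `|u v0|_v0 by field; rewrite !tE uE.
      rewrite (unif_norm_at pi_norm) invrK ger_pMr ?cabs_gt0 // => q1 _.
      by move: q1; rewrite leNgt (place_norm_gt1 hF (svalP v0)).
    rewrite /c mulrA rel0 ag mulr0 addr0 xiK // (norm_factor_div (xip 0%N) (xip 1%N)).
    rewrite fmorph_div /=; field.
    by rewrite !nf0.
  - move=> m; rewrite /c mulrA (relS m).2 !xiK // (norm_factor_div (xip m.+1) (xip m.+2)) (norm_factor_div (xip m.+1) (xip m)) !fmorph_div /=; field.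
    by rewrite !nf0.
by exists r => // m; rewrite cE rP.
Qed.

End PrimePowers.

Theorem theorem3p2 (R : realType) (F : fieldExtType rat) (n : nat)
    (sigma : 'I_n -> {rmorphism F -> R})
    (hF : totally_real_field sigma)
    (Fv : forall v : fplace F, completion R (sval v))
    (h : nat) (t : 'I_h -> fin_idele Fv)
    (ht : narrow_class_reps sigma t)
    (c1 c2 : set F) (hc1 : integral_ideal c1) (hc2 : integral_ideal c2)
    (k l : 'I_n -> nat)
    (hk : forall j, (2 %| k j)%N /\ (2 <= k j)%N)
    (hl : forall j, (2 %| l j)%N /\ (2 <= l j)%N)
    (f g : 'I_h -> 'rV[R[i]]_n -> R[i])
    (hf : primitive_eigenform sigma t k c1 f)
    (hg : primitive_eigenform sigma t l c2 g)
    (hfCM : non_CM sigma t k f) (hgCM : non_CM sigma t l g)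
    (hfg : distinct_forms f g)
    (p : set F) (hp : prime_ideal p)
    (hpc : ~ ideal_dvd p (idealM (idealM c1 c2) (different sigma))) :
  has_positive_density R
    [set m : nat | coefC sigma t k f (idealX p m)
                   * coefC sigma t l g (idealX p m) != 0].
Proof.
have [c1p c2p Dp] := not_dvd_different hF hp hc1 hc2 hpc.
pose v0 : fplace F := exist _ p hp.
have [_ [pi [_ _ _ pi_norm _]]] := cabs_uniformizer hF hp (Fv v0).
have [r1 r11 fz] := @prime_power_coef_zeros _ _ _ _ hF _ _ _ ht v0 _ pi_norm _ _ _ hc1 c1p Dp hf.
have [r2 r21 gz] := @prime_power_coef_zeros _ _ _ _ hF _ _ _ ht v0 _ pi_norm _ _ _ hc2 c2p Dp hg.
have -> : [set m | coefC sigma t k f (idealX p m) * coefC sigma t l g (idealX p m) != 0] =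
    [set m | ~~ (r1 %| m.+1)%N && ~~ (r2 %| m.+1)%N].
  by apply/funext => m /=; rewrite mulf_eq0 negb_or (fz m) (gz m).
exact: joint_nondivisibility_density.
Qed.
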